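(* Let $\beta^2=1/4$, $\beta>0$, and let $m\ge1$ be an integer. There exist $\varepsilon_0>0$ and $C>0$, with $C$ independent of $m$, such that for all $\varepsilon\in(0,\varepsilon_0)$ and all $y,y_0\in[0,1]$ with $m|y-y_0|\le3\beta$, $$|y-y_0\pm i\varepsilon|^{-\frac12}\|\mathcal{G}^\pm_{m,\varepsilon}(y,y_0,\cdot)\|_{L^2_z(0,1)}+|y-y_0\pm i\varepsilon|^{\frac12}\|\partial_y\mathcal{G}^\pm_{m,\varepsilon}(y,y_0,\cdot)\|_{L^2_z(0,1)}\le\frac{C}{m}\Big(1+\big|\log\big(m|y-y_0\pm i\varepsilon|\big)\big|\Big).$$
   Context: For $y_0\in[0,1]$, $\varepsilon>0$ the Taylor–Goldstein operator is $\mathrm{TG}^\pm_{m,\varepsilon}=\partial_y^2-m^2+\frac{\beta^2}{(y-y_0\pm i\varepsilon)^2}$ on $y\in(0,1)$. $\mathcal{G}^\pm_{m,\varepsilon}(y,y_0,z)$ denotes its Green's function: $\mathrm{TG}^\pm_{m,\varepsilon}\mathcal{G}^\pm_{m,\varepsilon}(\cdot,y_0,z)=\delta(\cdot-z)$ with homogeneous Dirichlet conditions at $y=0$ and $y=1$. The estimate is asserted for each choice of sign $\pm$. *)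

(* Defs.v *)
From Stdlib Require Import Reals.
From Coquelicot Require Import Coquelicot.
Open Scope R_scope.

(** The sign [±] in [y - y0 ± i eps] is a boolean, [true] for [+]. *)
Definition pm (s : bool) (x : R) : R := if s then x else - x.

Definition shift (s : bool) (eps y0 y : R) : C := (y - y0, pm s eps).

Definition unit_interval (t : R) : Prop := 0 <= t <= 1.

Definition test_function (phi : R -> R) : Prop :=
  (forall (n : nat) (x : R), ex_derive_n phi n x) /\
  exists a b : R, 0 < a /\ a < b /\ b < 1 /\
    forall x : R, x < a \/ b < x -> phi x = 0.

Definition TG (beta : R) (s : bool) (m : nat) (eps y0 : R)
    (phi : R -> R) (y : R) : C :=
  (RtoC (Derive_n phi 2 y) - RtoC (INR m ^ 2) * RtoC (phi y)
   + RtoC (beta ^ 2) / (shift s eps y0 y * shift s eps y0 y)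
       * RtoC (phi y))%C.

(** [G y z] is the Green's function for fixed [y0].  The equation
    [TG G(.,z) = delta(. - z)] is meant in the sense of distributions on
    [(0,1)]; [TG] is formally equal to its own transpose (no complex
    conjugation), so it is moved unchanged onto the test function, and by
    linearity real-valued test functions suffice.  The values of [G] for [y]
    outside [[0,1]] or [z] outside [(0,1)] are irrelevant, which is why
    continuity is relative to [[0,1]]. *)
Definition is_green (beta : R) (s : bool) (m : nat) (eps y0 : R)
    (G : R -> R -> C) : Prop :=
  forall z : R, 0 < z < 1 ->
    (forall y : R, 0 <= y <= 1 ->
       filterlim (fun t => G t z) (within unit_interval (locally y))
         (locally (G y z))) /\
    G 0 z = RtoC 0 /\ G 1 z = RtoC 0 /\
    (forall phi : R -> R, test_function phi ->
       is_RInt (V := C_R_NormedModule)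
         (fun y => (G y z * TG beta s m eps y0 phi y)%C) 0 1 (RtoC (phi z))).

(** Derivative at [y] of a function on [[0,1]]: two-sided at interior points,
    one-sided at [0] and [1]. *)
Definition is_derive_unit (f : R -> C) (y : R) (l : C) : Prop :=
  filterlim (fun t => ((f t - f y) / RtoC (t - y))%C)
    (within unit_interval (locally' y)) (locally l).

Definition square_integrable (f : R -> C) : Prop :=
  ex_RInt (fun z => Cmod (f z) ^ 2) 0 1.

(** The [L^2(0,1)] norm; only meaningful together with [square_integrable].
    Riemann integrals are enough here: for fixed [y] the functions of [z]
    concerned are bounded with at most one interior discontinuity, at [z = y]. *)
Definition L2norm (f : R -> C) : R :=
  sqrt (RInt (fun z => Cmod (f z) ^ 2) 0 1).

(* Main.v *)
Require Import Defs.
From Stdlib Require Import Reals Factorial Lra.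
From Coquelicot Require Import Coquelicot.
Open Scope R_scope.

(** Put [w = m (y - y0 ± i eps)] and write a homogeneous solution as [sqrt w f(w)].  For
    [beta^2 = 1/4] the equation becomes the system [f' = g / w], [g' = w f].  The Dirichlet
    solutions [f_l], [f_u] at the two ends are controlled by three identities along the line
    [w = t + i e], [N = |w|^2]:
    [(g conj f)' = w (|f|^2 + |g|^2 / N)], whose imaginary part is a flux which is monotone
    and picks up a fixed amount of [|g|^2] near [t = 0];
    [(|g|^2 - N |f|^2)' = - 2 t |f|^2], which bounds the mass of [sqrt w f_u] by [|g_u|^2];
    and [(|f|^2)' = 2 Re (conj w g conj f) / N], which gives
    [|f_u| <= C (1 + |log |w||) |g_u|].
    For [t >= 0] the flux identity bounds the Wronskian [f_l g_u - f_u g_l] from below by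
    [|g_l| |g_u|], uniformly in [m], and the estimate follows from
    [G = phi_l(min) phi_u(max) / W]; the case [t <= 0] is symmetric.
    That [G] has this form uses that weak solutions are classical, and the existence of
    [phi_l] and [phi_u] is Picard iteration. *)

(** * Monotone quantities along the line *)

(** At [beta^2 = 1/4] the indicial equation has the double root 1/2, so the second solution behaves
    like [sqrt w log w]; this is where the logarithm comes from. The obstacle is the Wronskian:
    bounds on the size of the two solutions do not keep [f_l / g_l] and [f_u / g_u] apart as [eps]
    tends to 0. The flux does, because it vanishes at each Dirichlet end and therefore has opposite
    signs for the two solutions. After rescaling, the interval is [[- m y0, m (1 - y0)]], of length
    [m >= 1], and [m] enters only through this interval and [e = m eps]. The choice
    [eps0 = 1 / (2 m)] gives [e <= 1/2], so that on at least one side of the origin the zone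
    [|t| <= e], where the flux grows, fits into the interval. Only [|f|^2], [|g|^2] and [g conj f]
    occur, so no branch of [sqrt w] or [log w] is ever chosen. The numerical constants are crude;
    what matters is that they do not depend on [m], [eps], [y0]. *)

Lemma derive_nonneg_le (f f' : R -> R) (a b : R) :
  a <= b -> (forall t, a <= t <= b -> is_derive f t (f' t)) ->
  (forall t, a <= t <= b -> 0 <= f' t) -> f a <= f b.
Proof.
intros Hab Hd Hp.
destruct (MVT_gen f a b f') as [c [Hc E]].
- intros t Ht. rewrite Rmin_left, Rmax_right in Ht by lra. apply Hd; lra.
- intros t Ht. rewrite Rmin_left, Rmax_right in Ht by lra.
  apply continuity_pt_filterlim, (ex_derive_continuous f).
  exists (f' t); apply Hd; lra.
- rewrite Rmin_left, Rmax_right in Hc by lra.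
  assert (0 <= f' c) by (apply Hp; lra). nra.
Qed.

Lemma is_derive_Rmult (f g : R -> R) (x df dg : R) :
  is_derive f x df -> is_derive g x dg ->
  is_derive (fun t => f t * g t) x (df * g x + f x * dg).
Proof.
intros Hf%is_derive_Reals Hg%is_derive_Reals.
apply is_derive_Reals. now apply (derivable_pt_lim_mult f g).
Qed.

Lemma exp_le (t k : R) : t <= k -> exp t <= exp k.
Proof. intros [H | ->]; [left; now apply exp_increasing | right; reflexivity]. Qed.

(** With [w = t + i e], [N = |w|^2], [f' = g / w] and [g' = w f], the quantities are
    [A = |f|^2], [B = |g|^2] and [P + i Q = g conj(f)]; then [sqrt w f] solves the
    equation with [m = 1]. *)
Definition flow (e lo hi : R) (A B P Q : R -> R) : Prop :=
  forall t, lo <= t <= hi ->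
    is_derive A t (2 * (t * P t + e * Q t) / (t ^ 2 + e ^ 2)) /\
    is_derive B t (2 * (t * P t + e * Q t)) /\
    is_derive P t (t * (A t + B t / (t ^ 2 + e ^ 2))) /\
    is_derive Q t (e * (A t + B t / (t ^ 2 + e ^ 2))) /\
    0 <= A t /\ 0 <= B t /\ P t ^ 2 + Q t ^ 2 = A t * B t.

(** Since [- t + i e] is minus the conjugate of [t + i e], the conjugates of [f (- t)] and [g (- t)]
    satisfy the same system. Conjugation changes the sign of [Q] only. *)
Lemma flow_reflect (e lo hi : R) (A B P Q : R -> R) :
  flow e lo hi A B P Q ->
  flow e (- hi) (- lo) (fun t => A (- t)) (fun t => B (- t))
    (fun t => P (- t)) (fun t => - Q (- t)).
Proof.
intros H t Ht.
destruct (H (- t)) as (HA & HB & HP & HQ & A0 & B0 & E); [lra|].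
assert (Hn : forall (F : R -> R) l, is_derive F (- t) l ->
   is_derive (fun s => F (- s)) t (- l)).
{ intros F l HF. replace (- l) with (scal (-1) l) by (unfold scal; simpl; unfold mult; simpl; ring).
  apply (is_derive_comp F Ropp); [exact HF|]. auto_derive; [easy|ring]. }
replace ((- t) ^ 2) with (t ^ 2) in * by ring.
split; [|split; [|split; [|split; [|split; [|split]]]]]; try assumption.
- replace (2 * (t * P (- t) + e * - Q (- t)) / (t ^ 2 + e ^ 2))
    with (- (2 * (- t * P (- t) + e * Q (- t)) / (t ^ 2 + e ^ 2)))
    by (unfold Rdiv; ring). now apply Hn.
- replace (2 * (t * P (- t) + e * - Q (- t)))
    with (- (2 * (- t * P (- t) + e * Q (- t)))) by ring. now apply Hn.
- replace (t * (A (- t) + B (- t) / (t ^ 2 + e ^ 2)))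
    with (- (- t * (A (- t) + B (- t) / (t ^ 2 + e ^ 2)))) by ring. now apply Hn.
- replace (e * (A (- t) + B (- t) / (t ^ 2 + e ^ 2)))
    with (- - (e * (A (- t) + B (- t) / (t ^ 2 + e ^ 2)))) by ring.
  apply (is_derive_opp (fun s => Q (- s))). now apply Hn.
- rewrite <- E; ring.
Qed.

Lemma sqr_add_pos (e t : R) : 0 < e -> 0 < t ^ 2 + e ^ 2.
Proof. intros; nra. Qed.

Lemma flow_rate_nonneg (e lo hi : R) (A B P Q : R -> R) (t : R) :
  0 < e -> flow e lo hi A B P Q -> lo <= t <= hi ->
  0 <= A t + B t / (t ^ 2 + e ^ 2).
Proof.
intros He H Ht. destruct (H t Ht) as (_ & _ & _ & _ & A0 & B0 & _).
assert (H1 := sqr_add_pos e t He).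
assert (0 <= B t / (t ^ 2 + e ^ 2)) by (apply Rdiv_le_0_compat; lra). lra.
Qed.

Lemma flow_Q_incr (e lo hi : R) (A B P Q : R -> R) (s t : R) :
  0 < e -> flow e lo hi A B P Q -> lo <= s -> s <= t -> t <= hi -> Q s <= Q t.
Proof.
intros He H H1 H2 H3.
apply (derive_nonneg_le Q (fun t => e * (A t + B t / (t ^ 2 + e ^ 2)))); [lra| |].
- intros r Hr. apply H; lra.
- intros r Hr. apply Rmult_le_pos; [lra|].
  apply (flow_rate_nonneg e lo hi A B P Q); auto; lra.
Qed.

Lemma flow_P_incr (e lo hi : R) (A B P Q : R -> R) (s t : R) :
  0 < e -> flow e lo hi A B P Q -> lo <= s -> 0 <= s -> s <= t -> t <= hi -> P s <= P t.
Proof.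
intros He H H0 H1 H2 H3.
apply (derive_nonneg_le P (fun t => t * (A t + B t / (t ^ 2 + e ^ 2)))); [lra| |].
- intros r Hr. apply H; lra.
- intros r Hr. apply Rmult_le_pos; [lra|].
  apply (flow_rate_nonneg e lo hi A B P Q); auto; lra.
Qed.

(** [B' = N A'], so only [- N' A] survives. *)
Lemma flow_virial (e lo hi : R) (A B P Q : R -> R) (t : R) :
  0 < e -> flow e lo hi A B P Q -> lo <= t <= hi ->
  is_derive (fun t => B t - (t ^ 2 + e ^ 2) * A t) t (- (2 * t * A t)).
Proof.
intros He H Ht. destruct (H t Ht) as (HA & HB & _).
assert (H1 := sqr_add_pos e t He).
evar_last.
- apply (is_derive_minus B (fun t => (t ^ 2 + e ^ 2) * A t)); [exact HB|].
  apply (is_derive_Rmult (fun t => t ^ 2 + e ^ 2) A);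
    [auto_derive; [easy|reflexivity] | exact HA].
- unfold minus, plus, opp; simpl. field. nra.
Qed.

Lemma flow_virial_decr (e lo hi : R) (A B P Q : R -> R) (s t : R) :
  0 < e -> flow e lo hi A B P Q -> lo <= s -> 0 <= s -> s <= t -> t <= hi ->
  B t - (t ^ 2 + e ^ 2) * A t <= B s - (s ^ 2 + e ^ 2) * A s.
Proof.
intros He H H0 H1 H2 H3.
apply Ropp_le_cancel.
apply (derive_nonneg_le (fun t => - (B t - (t ^ 2 + e ^ 2) * A t)) (fun t => - - (2 * t * A t))); [lra| |].
- intros r Hr. apply (is_derive_opp (fun t => B t - (t ^ 2 + e ^ 2) * A t)).
  apply (flow_virial e lo hi A B P Q); auto; lra.
- intros r Hr. destruct (H r) as (_ & _ & _ & _ & A0 & _); [lra|]. nra.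
Qed.

(** Cauchy-Schwarz for [t P + e Q], the real part of [conj w g conj f]; the defect is
    [(t Q - e P)^2]. *)
Lemma flow_cauchy (e lo hi : R) (A B P Q : R -> R) (t : R) :
  flow e lo hi A B P Q -> lo <= t <= hi ->
  (t * P t + e * Q t) ^ 2 <= (t ^ 2 + e ^ 2) * (A t * B t).
Proof.
intros H Ht. destruct (H t Ht) as (_ & _ & _ & _ & _ & _ & E). rewrite <- E.
assert (0 <= (t * Q t - e * P t) ^ 2) by apply pow2_ge_0. nra.
Qed.

Lemma sqr_le_neg (x y : R) : 0 <= y -> x ^ 2 <= y ^ 2 -> - y <= x.
Proof. intros; nra. Qed.

(** * One solution vanishing at the right end *)

Section Decaying.

Variables (e lo hi : R) (A B P Q : R -> R).
Hypotheses (He : 0 < e) (Hlo : lo <= 0) (Hhi : 0 <= hi).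
Hypothesis H : flow e lo hi A B P Q.
Hypotheses (A1 : A hi = 0) (P1 : P hi = 0) (Q1 : Q hi = 0).

Lemma decaying_Q_nonpos (t : R) : lo <= t <= hi -> Q t <= 0.
Proof. intros Ht. rewrite <- Q1. apply (flow_Q_incr e lo hi A B P Q); auto; lra. Qed.

Lemma decaying_P_nonpos (t : R) : 0 <= t <= hi -> P t <= 0.
Proof. intros Ht. rewrite <- P1. apply (flow_P_incr e lo hi A B P Q); auto; lra. Qed.

(** For [t >= 0] both [P] and [Q] increase to their value 0 at [hi], hence [t P + e Q <= 0]. *)
Lemma decaying_B_decr (s t : R) : 0 <= s -> s <= t -> t <= hi -> B t <= B s.
Proof.
intros H1 H2 H3. apply Ropp_le_cancel.
apply (derive_nonneg_le (fun t => - B t) (fun t => - (2 * (t * P t + e * Q t)))); [lra| |].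
- intros r Hr. apply (is_derive_opp B). apply H; lra.
- intros r Hr. assert (P r <= 0) by (apply decaying_P_nonpos; lra).
  assert (Q r <= 0) by (apply decaying_Q_nonpos; lra). nra.
Qed.

Lemma decaying_A_decr (s t : R) : 0 <= s -> s <= t -> t <= hi -> A t <= A s.
Proof.
intros H1 H2 H3. apply Ropp_le_cancel.
apply (derive_nonneg_le (fun t => - A t)
  (fun t => - (2 * (t * P t + e * Q t) / (t ^ 2 + e ^ 2)))); [lra| |].
- intros r Hr. apply (is_derive_opp A). apply H; lra.
- intros r Hr. assert (P r <= 0) by (apply decaying_P_nonpos; lra).
  assert (Q r <= 0) by (apply decaying_Q_nonpos; lra).
  replace (- (2 * (r * P r + e * Q r) / (r ^ 2 + e ^ 2)))
    with ((2 * (r * - P r + e * - Q r)) / (r ^ 2 + e ^ 2)) by (unfold Rdiv; ring).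
  apply Rdiv_le_0_compat; [nra | now apply sqr_add_pos].
Qed.

(** [B - N A] decreases for [t >= 0] and ends at [B hi >= 0], as the Dirichlet condition removes the
    term in [A]. *)
Lemma decaying_A_le (t : R) : 0 <= t <= hi -> (t ^ 2 + e ^ 2) * A t <= B t.
Proof.
intros Ht.
assert (B hi - (hi ^ 2 + e ^ 2) * A hi <= B t - (t ^ 2 + e ^ 2) * A t)
  by (apply (flow_virial_decr e lo hi A B P Q); auto; lra).
destruct (H hi) as (_ & _ & _ & _ & _ & B0 & _); [lra|].
rewrite A1 in *. lra.
Qed.

(** Cauchy-Schwarz together with [N A <= B] gives [|t P + e Q| <= B], hence [B' >= - 2 B]. *)
Lemma decaying_B_slow (s t : R) : 0 <= s -> s <= t -> t <= hi ->
  B s <= exp (2 * (t - s)) * B t.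
Proof.
intros H1 H2 H3.
assert (Hm : exp (2 * (s - s)) * B s <= exp (2 * (t - s)) * B t).
{ apply (derive_nonneg_le (fun t => exp (2 * (t - s)) * B t)
    (fun t => exp (2 * (t - s)) * (2 * B t + 2 * (t * P t + e * Q t)))); [lra| |].
  - intros r Hr. evar_last.
    + apply (is_derive_Rmult (fun t => exp (2 * (t - s))) B);
        [auto_derive; [easy|reflexivity] | exact (proj1 (proj2 (H r ltac:(lra))))].
    + simpl. unfold Rminus. ring.
  - intros r Hr. apply Rmult_le_pos; [left; apply exp_pos|].
    assert (C := flow_cauchy e lo hi A B P Q r H ltac:(lra)).
    assert (L := decaying_A_le r ltac:(lra)).
    destruct (H r) as (_ & _ & _ & _ & A0 & B0 & _); [lra|].
    assert (- B r <= r * P r + e * Q r) by (apply sqr_le_neg; nra). lra. }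
replace (2 * (s - s)) with 0 in Hm by ring. rewrite exp_0 in Hm. lra.
Qed.

(** Either [B - N A] is already large at [2], or [N A] is, and then [A], being
    decreasing, contributes on [[3/2, 2]] to the integral of [2 t A]. *)
Lemma decaying_gap (x : R) : e <= 1 / 2 -> 0 <= x <= 3 / 2 -> x <= hi ->
  / 500 * B x <= B x - (x ^ 2 + e ^ 2) * A x.
Proof.
intros He2 Hx Hxb.
(* [81 = 3 ^ 4] dominates [exp 4], the largest loss of [B] within [[0, 2]]. *)
assert (H81 : forall t, x <= t <= 2 -> t <= hi -> B x <= 81 * B t).
{ intros t Ht Hth. assert (S := decaying_B_slow x t ltac:(lra) ltac:(lra) Hth).
  destruct (H t) as (_ & _ & _ & _ & _ & B0 & _); [lra|].
  assert (exp (2 * (t - x)) <= 81).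
  { apply Rle_trans with (exp 4); [apply exp_le; lra|].
    replace 4 with (1 + 1 + 1 + 1) by ring. rewrite !exp_plus.
    assert (E := exp_le_3). assert (E0 := exp_pos 1).
    assert (exp 1 * exp 1 <= 9) by nra.
    replace (exp 1 * exp 1 * exp 1 * exp 1) with ((exp 1 * exp 1) * (exp 1 * exp 1)) by ring.
    nra. }
  nra. }
destruct (Rle_lt_dec hi 2) as [Hb | Hb].
- assert (V : B hi - (hi ^ 2 + e ^ 2) * A hi <= B x - (x ^ 2 + e ^ 2) * A x)
    by (apply (flow_virial_decr e lo hi A B P Q); auto; lra).
  assert (B x <= 81 * B hi) by (apply H81; lra).
  destruct (H hi) as (_ & _ & _ & _ & _ & B0 & _); [lra|].
  rewrite A1 in V. lra.
- assert (V1 : B (3/2) - ((3/2) ^ 2 + e ^ 2) * A (3/2) <= B x - (x ^ 2 + e ^ 2) * A x)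
    by (apply (flow_virial_decr e lo hi A B P Q); auto; lra).
  assert (B2 : B x <= 81 * B 2) by (apply H81; lra).
  (* On [[3/2, 2]] the rate [2 t A] is at least [2 t A 2], a gain of [(4 - 9/4) A 2]. *)
  assert (V2 : - (B (3/2) - ((3/2) ^ 2 + e ^ 2) * A (3/2)) - (3/2)^2 * A 2
     <= - (B 2 - (2 ^ 2 + e ^ 2) * A 2) - 2 ^ 2 * A 2).
  { apply (derive_nonneg_le (fun t => - (B t - (t ^ 2 + e ^ 2) * A t) - t ^ 2 * A 2)
      (fun t => - - (2 * t * A t) - 2 * t * A 2)); [lra| |].
    - intros t Ht. apply (is_derive_minus (fun t => - (B t - (t ^ 2 + e ^ 2) * A t)) (fun t => t ^ 2 * A 2)).
      + apply (is_derive_opp (fun t => B t - (t ^ 2 + e ^ 2) * A t)).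
        apply (flow_virial e lo hi A B P Q); auto; lra.
      + auto_derive; [easy|ring].
    - intros t Ht. assert (A 2 <= A t) by (apply decaying_A_decr; lra). nra. }
  assert (L2 := decaying_A_le 2 ltac:(lra)).
  destruct (H 2) as (_ & _ & _ & _ & A0 & B0 & _); [lra|].
  assert (e ^ 2 <= 1) by nra.
  assert (e ^ 2 * A 2 <= A 2) by nra.
  lra.
Qed.

(** [(A / La - B x * La)' >= 0] for a positive [La] with [La' = - 1 / sqrt N]. *)
Lemma decaying_A_log (x : R) : e <= 1 / 2 -> 0 <= x -> x <= hi ->
  A x <= 9 * (1 + Rabs (ln (sqrt (x ^ 2 + e ^ 2)))) ^ 2 * B x.
Proof.
intros He2 Hx Hxb.
destruct (H x) as (_ & _ & _ & _ & Ax & Bx & _); [lra|].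
set (l := Rabs (ln (sqrt (x ^ 2 + e ^ 2)))).
assert (l0 : 0 <= l) by apply Rabs_pos.
assert (Nx := sqr_add_pos e x He).
destruct (Rle_lt_dec 1 x) as [H1 | H1].
{ assert (L := decaying_A_le x ltac:(lra)).
  assert (1 * A x <= (x ^ 2 + e ^ 2) * A x) by (apply Rmult_le_compat_r; nra).
  assert (1 <= (1 + l) ^ 2) by nra. nra. }
(* An antiderivative of [- 1 / sqrt N] (an inverse hyperbolic sine) normalised by [La 1 = 1]; on
   [[0, 1]] it is at least 1, and at [x] it is at most [3 (1 + l)]. *)
set (La := fun t => 1 + ln (1 + sqrt (1 + e ^ 2)) - ln (t + sqrt (t ^ 2 + e ^ 2))).
assert (Hs : forall t, 0 <= t -> 0 < sqrt (t ^ 2 + e ^ 2)).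
{ intros t _. apply sqrt_lt_R0, sqr_add_pos, He. }
assert (La1 : forall t, 0 <= t <= 1 -> 1 <= La t).
{ intros t Ht. unfold La.
  assert (ln (t + sqrt (t ^ 2 + e ^ 2)) <= ln (1 + sqrt (1 + e ^ 2))).
  { apply ln_le; [specialize (Hs t); lra|].
    assert (sqrt (t ^ 2 + e ^ 2) <= sqrt (1 + e ^ 2)) by (apply sqrt_le_1_alt; nra). lra. }
  lra. }
assert (dLa : forall t, 0 <= t -> is_derive La t (- / sqrt (t ^ 2 + e ^ 2))).
{ intros t Ht. specialize (Hs t Ht). unfold La. auto_derive.
  - replace (t * (t * 1) + e * (e * 1)) with (t ^ 2 + e ^ 2) by ring.
    repeat split; try lra. now apply sqr_add_pos.
  - replace (t * (t * 1) + e * (e * 1)) with (t ^ 2 + e ^ 2) by ring. field. lra. }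
(* The comparison is anchored at [h]: if [h = hi] then [A] vanishes there; if [h = 1] then
   [A 1 <= B 1 <= B x] and [La 1 = 1]. *)
set (h := Rmin 1 hi).
assert (Hh : x <= h <= 1 /\ h <= hi) by (unfold h, Rmin; destruct (Rle_dec 1 hi); lra).
assert (M : A x / La x - B x * La x <= A h / La h - B x * La h).
{ apply (derive_nonneg_le (fun t => A t / La t - B x * La t)
    (fun t => (2 * (t * P t + e * Q t) / (t ^ 2 + e ^ 2) * La t
        - A t * - / sqrt (t ^ 2 + e ^ 2)) / La t ^ 2 - B x * - / sqrt (t ^ 2 + e ^ 2))); [lra| |].
  - intros t Ht. specialize (La1 t ltac:(lra)).
    apply (is_derive_minus (fun t => A t / La t) (fun t => B x * La t)).
    + apply is_derive_div; [apply H; lra | apply dLa; lra | lra].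
    + apply is_derive_scal, dLa; lra.
  - intros t Ht. specialize (La1 t ltac:(lra)). specialize (Hs t ltac:(lra)).
    assert (C := flow_cauchy e lo hi A B P Q t H ltac:(lra)).
    assert (BB := decaying_B_decr x t ltac:(lra) ltac:(lra) ltac:(lra)).
    destruct (H t) as (_ & _ & _ & _ & A0 & B0 & _); [lra|].
    assert (Nt := sqr_add_pos e t He).
    set (r := sqrt (t ^ 2 + e ^ 2)) in *.
    assert (Er : t ^ 2 + e ^ 2 = r ^ 2) by (unfold r; rewrite pow2_sqrt; lra).
    rewrite Er in *.
    set (k := t * P t + e * Q t) in *. set (a := La t) in *.
    (* AM-GM: [2 |k| <= r (A / a + a B)] *)
    assert (G : - (r * (A t + a ^ 2 * B t)) <= 2 * k * a).
    { assert (0 <= a ^ 2 * B t) by (apply Rmult_le_pos; nra).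
      apply sqr_le_neg; [apply Rmult_le_pos; lra|].
      assert (0 <= (A t - a ^ 2 * B t) ^ 2) by apply pow2_ge_0.
      assert (k ^ 2 * (4 * a ^ 2) <= r ^ 2 * (A t * B t) * (4 * a ^ 2))
        by (apply Rmult_le_compat_r; [nra|lra]).
      assert (0 <= r ^ 2 * (A t - a ^ 2 * B t) ^ 2) by (apply Rmult_le_pos; [nra|lra]).
      replace ((2 * k * a) ^ 2) with (k ^ 2 * (4 * a ^ 2)) by ring. lra. }
    replace ((2 * k / r ^ 2 * a - A t * - / r) / a ^ 2 - B x * - / r)
      with ((2 * k * a + r * (A t + a ^ 2 * B x)) / (r ^ 2 * a ^ 2)) by (field; lra).
    apply Rdiv_le_0_compat; [|apply Rmult_lt_0_compat; nra].
    assert (r * (a ^ 2 * B t) <= r * (a ^ 2 * B x))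
      by (apply Rmult_le_compat_l; [lra|apply Rmult_le_compat_l; [nra|lra]]).
    lra. }
assert (Eh : A h / La h - B x * La h <= 0).
{ assert (L1 := La1 h ltac:(lra)). unfold h, Rmin in *. destruct (Rle_dec 1 hi).
  - assert (E : La 1 = 1) by (unfold La; replace (1 ^ 2) with 1 by ring; ring).
    rewrite E. assert (L := decaying_A_le 1 ltac:(lra)).
    assert (B 1 <= B x) by (apply decaying_B_decr; lra).
    destruct (H 1) as (_ & _ & _ & _ & A0 & B0 & _); [lra|]. nra.
  - rewrite A1. unfold Rdiv. nra. }
assert (Lx := La1 x ltac:(lra)).
assert (A x <= B x * La x ^ 2).
{ replace (A x) with (A x / La x * La x) by (field; lra).
  assert (A x / La x <= B x * La x) by lra. nra. }
assert (La x <= 3 * (1 + l)).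
{ unfold La.
  assert (sqrt (1 + e ^ 2) <= 2).
  { replace 2 with (sqrt (2 ^ 2)) by (rewrite sqrt_pow2; lra). apply sqrt_le_1_alt; nra. }
  assert (ln (1 + sqrt (1 + e ^ 2)) <= 2).
  { assert (0 <= sqrt (1 + e ^ 2)) by apply sqrt_pos.
    apply Rle_trans with (ln 3); [apply ln_le; lra|].
    rewrite <- (ln_exp 2). apply ln_le; [lra|]. assert (X := exp_ineq1_le 2). lra. }
  specialize (Hs x Hx).
  assert (ln (sqrt (x ^ 2 + e ^ 2)) <= ln (x + sqrt (x ^ 2 + e ^ 2))) by (apply ln_le; lra).
  assert (- l <= ln (sqrt (x ^ 2 + e ^ 2))).
  { unfold l. generalize (Rle_abs (- ln (sqrt (x ^ 2 + e ^ 2)))). rewrite Rabs_Ropp. lra. }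
  lra. }
assert (La x ^ 2 <= (3 * (1 + l)) ^ 2) by nra.
nra.
Qed.

(** Splits the weight of the mass. The virial identity integrates [2 t A] exactly; the remainder
    matters where [t < e], and against [A] it integrates to an arctangent. *)
Lemma sqrt_sqr_add_le (t : R) : 0 <= t ->
  sqrt (t ^ 2 + e ^ 2) <= 2 * t + 2 * (e ^ 3 / (t ^ 2 + e ^ 2)).
Proof.
intros Ht. assert (Nt := sqr_add_pos e t He).
apply Rle_trans with (t + e).
{ rewrite <- (sqrt_pow2 (t + e)) by lra. apply sqrt_le_1_alt; nra. }
assert (e <= t + 2 * (e ^ 3 / (t ^ 2 + e ^ 2))); [|lra].
apply Rmult_le_reg_r with (t ^ 2 + e ^ 2); [lra|].
replace ((t + 2 * (e ^ 3 / (t ^ 2 + e ^ 2))) * (t ^ 2 + e ^ 2))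
  with (t * (t ^ 2 + e ^ 2) + 2 * e ^ 3) by (field; lra).
assert (0 <= e ^ 3) by (apply pow_le; lra).
destruct (Rle_lt_dec e t).
- assert (e * (t ^ 2 + e ^ 2) <= t * (t ^ 2 + e ^ 2)) by (apply Rmult_le_compat_r; lra). lra.
- assert (e * t ^ 2 <= e * e ^ 2) by (apply Rmult_le_compat_l; nra).
  assert (0 <= t * (t ^ 2 + e ^ 2)) by (apply Rmult_le_pos; lra).
  replace (e ^ 3) with (e * e ^ 2) by ring. lra.
Qed.

End Decaying.

(** [S] is a primitive of [|w| |f|^2], the mass of [sqrt w f]. The part [2 t A] of the weight yields
    the decrease of [B - N A]. In the remainder [e ^ 3 A / N <= k e / N], which integrates to [k]
    times a difference of arctangents; with its factor 2 it costs at most [PI k <= 4 k]. *)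
Lemma flow_mass_le (e lo hi : R) (A B P Q S : R -> R) (s t k : R) :
  0 < e -> flow e lo hi A B P Q -> lo <= s -> 0 <= s -> s <= t -> t <= hi ->
  (forall r, s <= r <= t -> is_derive S r (sqrt (r ^ 2 + e ^ 2) * A r)) ->
  (forall r, s <= r <= t -> (r ^ 2 + e ^ 2) * A r <= k) ->
  S t - S s <= (B s - (s ^ 2 + e ^ 2) * A s) - (B t - (t ^ 2 + e ^ 2) * A t) + 4 * k.
Proof.
intros He H Hs0 Hs Hst Ht HS Hk.
assert (k0 : 0 <= k).
{ apply Rle_trans with ((s ^ 2 + e ^ 2) * A s); [|apply Hk; lra].
  destruct (H s) as (_ & _ & _ & _ & A0 & _); [lra|]. nra. }
assert (M : - (S s + (B s - (s ^ 2 + e ^ 2) * A s) - 2 * k * atan (s / e))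
   <= - (S t + (B t - (t ^ 2 + e ^ 2) * A t) - 2 * k * atan (t / e))).
{ apply (derive_nonneg_le (fun t => - (S t + (B t - (t ^ 2 + e ^ 2) * A t) - 2 * k * atan (t / e)))
   (fun t => - (sqrt (t ^ 2 + e ^ 2) * A t + - (2 * t * A t) - 2 * k * (e / (t ^ 2 + e ^ 2)))));
   [lra| |].
  - intros r Hr.
    apply (is_derive_opp (fun t => S t + (B t - (t ^ 2 + e ^ 2) * A t) - 2 * k * atan (t / e))).
    apply (is_derive_minus (fun t => S t + (B t - (t ^ 2 + e ^ 2) * A t)) (fun t => 2 * k * atan (t / e))).
    + apply (is_derive_plus S (fun t => B t - (t ^ 2 + e ^ 2) * A t)).
      * now apply HS.
      * apply (flow_virial e lo hi A B P Q); auto; lra.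
    + auto_derive; [easy|]. field. assert (X := sqr_add_pos e r He).
      split; lra.
  - intros r Hr.
    destruct (H r) as (_ & _ & _ & _ & A0 & _); [lra|].
    assert (Nr := sqr_add_pos e r He).
    assert (R1 := sqrt_sqr_add_le e He r ltac:(lra)).
    assert (R2 : sqrt (r ^ 2 + e ^ 2) * A r <= (2 * r + 2 * (e ^ 3 / (r ^ 2 + e ^ 2))) * A r)
      by (apply Rmult_le_compat_r; lra).
    assert (R3 : e ^ 3 / (r ^ 2 + e ^ 2) * A r <= k * (e / (r ^ 2 + e ^ 2))); [|lra].
    replace (e ^ 3 / (r ^ 2 + e ^ 2) * A r) with ((e ^ 2 * A r) * (e / (r ^ 2 + e ^ 2)))
      by (field; lra).
    apply Rmult_le_compat_r; [apply Rdiv_le_0_compat; lra|].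
    specialize (Hk r Hr). nra. }
assert (T1 := atan_bound (t / e)). assert (T2 := atan_bound (s / e)).
assert (X : 0 <= atan (s / e)).
{ rewrite <- atan_0. destruct Hs as [Hs | <-].
  - left. apply atan_increasing. apply Rdiv_lt_0_compat; lra.
  - right. unfold Rdiv. now rewrite Rmult_0_l. }
assert (Pi := PI_4).
assert (2 * k * atan (t / e) - 2 * k * atan (s / e) <= 4 * k) by nra.
lra.
Qed.

(** To the right of [x] one has [N A <= B <= B x], so [k = B x] is admissible; [5 = 1 + 4]. *)
Lemma decaying_mass_le (e lo hi : R) (A B P Q S : R -> R) (x : R) :
  0 < e -> lo <= 0 -> flow e lo hi A B P Q -> A hi = 0 -> P hi = 0 -> Q hi = 0 ->
  0 <= x <= hi ->
  (forall r, x <= r <= hi -> is_derive S r (sqrt (r ^ 2 + e ^ 2) * A r)) ->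
  S hi - S x <= 5 * B x.
Proof.
intros He Hlo H A1 P1 Q1 Hx HS.
assert (M := flow_mass_le e lo hi A B P Q S x hi (B x) He H ltac:(lra) ltac:(lra) ltac:(lra) ltac:(lra) HS).
destruct (H hi) as (_ & _ & _ & _ & _ & B0 & _); [lra|].
destruct (H x) as (_ & _ & _ & _ & Ax & _ & _); [lra|].
rewrite A1 in M.
assert (0 <= (x ^ 2 + e ^ 2) * A x) by nra.
assert (S hi - S x <= B x - (x ^ 2 + e ^ 2) * A x - (B hi - (hi ^ 2 + e ^ 2) * 0) + 4 * B x); [|lra].
apply M. intros r Hr.
apply Rle_trans with (B r).
- apply (decaying_A_le e lo hi A B P Q); auto; lra.
- apply (decaying_B_decr e lo hi A B P Q); auto; lra.
Qed.

(** For [|t| <= e] the rate [Q' = e (A + B / N)] is at least [B / (2 e)]. *)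
Lemma flow_Q_window (e lo hi : R) (A B P Q : R -> R) (s t k : R) :
  0 < e -> flow e lo hi A B P Q -> lo <= s -> t <= hi -> - e <= s -> t <= e ->
  s + e / 2 <= t -> (forall r, s <= r <= t -> k <= B r) -> k / 4 <= Q t - Q s.
Proof.
intros He H Hs Ht Hse Hte Hst Hk.
assert (M : Q s - k / (2 * e) * s <= Q t - k / (2 * e) * t).
{ apply (derive_nonneg_le (fun r => Q r - k / (2 * e) * r)
    (fun r => e * (A r + B r / (r ^ 2 + e ^ 2)) - k / (2 * e))); [lra| |].
  - intros r Hr. apply (is_derive_minus Q (fun r => k / (2 * e) * r)).
    + exact (proj1 (proj2 (proj2 (proj2 (H r ltac:(lra)))))).
    + auto_derive; [easy|ring].
  - intros r Hr. destruct (H r) as (_ & _ & _ & _ & A0 & B0 & _); [lra|].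
    assert (Nr := sqr_add_pos e r He).
    specialize (Hk r Hr).
    assert (N2 : r ^ 2 + e ^ 2 <= 2 * e ^ 2) by nra.
    assert (I : / (2 * e ^ 2) <= / (r ^ 2 + e ^ 2)) by (apply Rinv_le_contravar; lra).
    assert (B r * / (2 * e ^ 2) <= B r * / (r ^ 2 + e ^ 2)) by (apply Rmult_le_compat_l; lra).
    assert (k * / (2 * e ^ 2) <= B r * / (2 * e ^ 2)).
    { apply Rmult_le_compat_r; [|lra]. left. apply Rinv_0_lt_compat. nra. }
    assert (e * (k * / (2 * e ^ 2)) <= e * (A r + B r / (r ^ 2 + e ^ 2)))
      by (apply Rmult_le_compat_l; unfold Rdiv; lra).
    replace (k / (2 * e)) with (e * (k * / (2 * e ^ 2))) by (field; lra). lra. }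
destruct (Rle_lt_dec 0 k) as [K | K].
- replace (k / 4) with (k / (2 * e) * (e / 2)) by (field; lra).
  assert (0 <= k / (2 * e)) by (apply Rdiv_le_0_compat; lra). nra.
- assert (Q s <= Q t) by (apply (flow_Q_incr e lo hi A B P Q); auto; lra). lra.
Qed.

(** The squared modulus of [f_l g_u - f_u g_l]. *)
Definition wronskian_sq (Al Bl Pl Ql Au Bu Pu Qu : R) : R :=
  Al * Bu + Au * Bl - 2 * (Pl * Pu + Ql * Qu).

(** The right side is the squared modulus of [g_l g_u conj (f_l g_u - f_u g_l)]. Its imaginary part
    is [Ql Bu - Qu Bl], in which fluxes of opposite signs add up instead of cancelling. *)
Lemma wronskian_sq_mult (Al Bl Pl Ql Au Bu Pu Qu : R) :
  Pl ^ 2 + Ql ^ 2 = Al * Bl -> Pu ^ 2 + Qu ^ 2 = Au * Bu ->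
  Bl * Bu * wronskian_sq Al Bl Pl Ql Au Bu Pu Qu
  = (Pl * Bu - Pu * Bl) ^ 2 + (Ql * Bu - Qu * Bl) ^ 2.
Proof.
intros El Eu. unfold wronskian_sq.
replace (Bl * Bu * (Al * Bu + Au * Bl - 2 * (Pl * Pu + Ql * Qu)))
  with ((Al * Bl) * Bu ^ 2 + (Au * Bu) * Bl ^ 2 - 2 * (Pl * Pu + Ql * Qu) * Bl * Bu) by ring.
rewrite <- El, <- Eu. ring.
Qed.

(** Young's inequality with weight [k] for the cross term of [|f_l g_u - f_u g_l|^2]. With [k] close
    to 1 it says that a small Wronskian lets [|f_l g_u|] exceed [|f_u g_l|] only slightly. *)
Lemma wronskian_sq_lower (Al Bl Pl Ql Au Bu Pu Qu k : R) : 0 < k ->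
  0 <= Al -> 0 <= Bl -> 0 <= Au -> 0 <= Bu ->
  Pl ^ 2 + Ql ^ 2 = Al * Bl -> Pu ^ 2 + Qu ^ 2 = Au * Bu ->
  Al * Bu * (1 - k) <= wronskian_sq Al Bl Pl Ql Au Bu Pu Qu + Au * Bl * (/ k - 1).
Proof.
intros K Al0 Bl0 Au0 Bu0 El Eu. unfold wronskian_sq.
assert (C : (Pl * Pu + Ql * Qu) ^ 2 <= (Al * Bl) * (Au * Bu)).
{ rewrite <- El, <- Eu. assert (0 <= (Pl * Qu - Ql * Pu) ^ 2) by apply pow2_ge_0. nra. }
assert (k0 : 0 < / k) by (apply Rinv_0_lt_compat; lra).
assert (U : 0 <= Al * Bu) by nra. assert (V : 0 <= Au * Bl) by nra.
assert (G : - (k * (Al * Bu) + / k * (Au * Bl)) <= - (2 * (Pl * Pu + Ql * Qu))).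
{ apply sqr_le_neg; [nra|].
  assert (0 <= (k * (Al * Bu) - / k * (Au * Bl)) ^ 2) by apply pow2_ge_0.
  replace ((k * (Al * Bu) + / k * (Au * Bl)) ^ 2)
    with ((k * (Al * Bu) - / k * (Au * Bl)) ^ 2 + 4 * (Al * Bl * (Au * Bu))) by (field; lra).
  nra. }
lra.
Qed.

Lemma exp_2e_le (e t : R) : e <= 1 / 2 -> t <= e -> exp (2 * t) <= 3.
Proof.
intros. apply Rle_trans with (exp 1); [apply exp_le; lra | apply exp_le_3].
Qed.

(** * The left and the right solution together: Wronskian and masses *)

Section Pair.

Variables (e a b : R) (Al Bl Pl Ql Au Bu Pu Qu : R -> R).
Hypotheses (He : 0 < e) (He2 : e <= 1 / 2).
Hypotheses (Ha : 0 <= a) (Hb : 0 <= b) (Hab : 1 <= a + b).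
Hypothesis Hl : flow e (- a) b Al Bl Pl Ql.
Hypothesis Hu : flow e (- a) b Au Bu Pu Qu.
Hypotheses (Al1 : Al (- a) = 0) (Pl1 : Pl (- a) = 0) (Ql1 : Ql (- a) = 0).
Hypotheses (Au1 : Au b = 0) (Pu1 : Pu b = 0) (Qu1 : Qu b = 0).

Let D (x : R) := wronskian_sq (Al x) (Bl x) (Pl x) (Ql x) (Au x) (Bu x) (Pu x) (Qu x).

Lemma pair_reflect : flow e (- b) a (fun t => Al (- t)) (fun t => Bl (- t))
    (fun t => Pl (- t)) (fun t => - Ql (- t)).
Proof. rewrite <- (Ropp_involutive a). now apply flow_reflect. Qed.

Lemma pair_Ql_nonneg (t : R) : - a <= t <= b -> 0 <= Ql t.
Proof. intros Ht. rewrite <- Ql1. apply (flow_Q_incr e (- a) b Al Bl Pl Ql); auto; lra. Qed.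

Lemma pair_Bl_slow (t : R) : 0 <= t <= a -> Bl 0 <= exp (2 * t) * Bl (- t).
Proof.
intros Ht.
assert (S := decaying_B_slow e (- b) a _ _ _ _ He ltac:(lra) Ha pair_reflect
  Al1 0 t ltac:(lra) ltac:(lra) ltac:(lra)).
simpl in S. rewrite Ropp_0, Rminus_0_r in S. exact S.
Qed.

(** If the Wronskian is small, then [f_l / g_l] is close to [f_u / g_u], so
    [decaying_gap] carries over to the left solution; since [B - N A] decreases on
    [[0, x]], [B] stays large down to the origin, where [Q] must then grow. *)
Lemma pair_wronskian (x : R) : 0 <= x <= 3 / 2 -> x <= b ->
  Bl x * Bu x <= 144000000 * D x.
Proof.
intros Hx Hxb.
destruct (Hl x) as (_ & _ & _ & _ & Al0 & Bl0 & El); [lra|].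
destruct (Hu x) as (_ & _ & _ & _ & Au0 & Bu0 & Eu); [lra|].
assert (M := wronskian_sq_mult _ _ _ _ _ _ _ _ El Eu). fold (D x) in M.
assert (Qu0 : Qu x <= 0) by (apply (decaying_Q_nonpos e (- a) b Au Bu Pu Qu); auto; lra).
assert (Ql0 : 0 <= Ql x) by (apply pair_Ql_nonneg; lra).
(* The degenerate case only asks for [0 <= D x], which is the Young bound at [k = 1]. *)
destruct (Rle_lt_dec (Bl x * Bu x) 0) as [Z | Z].
{ unfold D, wronskian_sq.
  assert (L := wronskian_sq_lower _ _ _ _ _ _ _ _ 1 Rlt_0_1 Al0 Bl0 Au0 Bu0 El Eu).
  unfold wronskian_sq in L. rewrite Rinv_1 in L. lra. }
assert (Bl1 : 0 < Bl x) by nra. assert (Bu1 : 0 < Bu x) by nra.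
(* A flux difference of relative size [c] bounds [D] from below by [c ^ 2]. It is used with
   [c = 1/12] and [c = 1/12000], and [144000000 = 12000 ^ 2]. *)
assert (Dgap : forall c, 0 < c -> c * (Bl x * Bu x) <= Ql x * Bu x - Qu x * Bl x ->
  c ^ 2 * (Bl x * Bu x) <= D x).
{ intros c c0 Hc.
  apply Rmult_le_reg_l with (Bl x * Bu x); [lra|]. rewrite M.
  assert (0 <= (Pl x * Bu x - Pu x * Bl x) ^ 2) by apply pow2_ge_0.
  assert ((c * (Bl x * Bu x)) ^ 2 <= (Ql x * Bu x - Qu x * Bl x) ^ 2)
    by (apply pow_incr; split; [apply Rmult_le_pos; lra | exact Hc]).
  nra. }
(* As [a + b >= 1] and [e <= 1/2], one side reaches distance [e] from the origin. This leaves room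
   for one of the windows [[x, e]] for the right solution, [[- e, 0]] or [[0, e / 2]] for the left
   one, each of length at least [e / 2]. *)
assert (Main : (1/2 <= b /\ x <= e / 2) \/ (1/2 <= a \/ (1/2 <= b /\ e / 2 <= x))) by lra.
destruct Main as [[Hb2 Hxe] | Main].
- (* the window [[x, e]] for the solution on the right *)
  assert (W := flow_Q_window e (- a) b Au Bu Pu Qu x e (Bu x / 3) He Hu
    ltac:(lra) ltac:(lra) ltac:(lra) ltac:(lra) ltac:(lra)).
  assert (Qu e <= 0) by (apply (decaying_Q_nonpos e (- a) b Au Bu Pu Qu); auto; lra).
  assert (Bu x / 3 / 4 <= Qu e - Qu x).
  { apply W. intros r Hr.
    assert (S := decaying_B_slow e (- a) b _ _ _ _ He ltac:(lra) Hb Hu Au1 x r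
      ltac:(lra) ltac:(lra) ltac:(lra)).
    assert (exp (2 * (r - x)) <= 3) by (apply (exp_2e_le e); lra).
    destruct (Hu r) as (_ & _ & _ & _ & _ & Br & _); [lra|]. nra. }
  assert ((/ 12) ^ 2 * (Bl x * Bu x) <= D x); [|lra].
  apply Dgap; [lra|].
  assert (0 <= Ql x * Bu x) by (apply Rmult_le_pos; lra).
  assert (Bu x / 12 * Bl x <= - Qu x * Bl x) by (apply Rmult_le_compat_r; lra). lra.
- destruct (Rle_lt_dec (/ 144000000 * (Bl x * Bu x)) (D x)) as [| HD]; [lra|].
  assert (G := decaying_gap e (- a) b Au Bu Pu Qu He ltac:(lra) Hb Hu Au1 Pu1 Qu1 x He2 Hx Hxb).
  set (N := x ^ 2 + e ^ 2) in *.
  assert (N0 : 0 < N) by (apply sqr_add_pos, He).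
  assert (N1 : N <= 5 / 2) by (unfold N; nra).
  (* This [k] makes [1 / k - 1 = 1 / 2000], a loss well below the gap [1 / 500] of the right
     solution; half of that gap survives for the left one. *)
  assert (L := wronskian_sq_lower _ _ _ _ _ _ _ _ (2000 / 2001) ltac:(lra) Al0 Bl0 Au0 Bu0 El Eu).
  fold (D x) in L.
  replace (/ (2000 / 2001) - 1) with (/ 2000) in L by (field; lra).
  assert (Gl : / 1000 * Bl x <= Bl x - N * Al x).
  { apply Rmult_le_reg_r with (Bu x); [lra|].
    assert (G1 : N * Au x * Bl x <= 499 / 500 * Bu x * Bl x) by (apply Rmult_le_compat_r; lra).
    assert (N * (Al x * Bu x * (1 - 2000 / 2001)) <= N * (D x + Au x * Bl x * / 2000))
      by (apply Rmult_le_compat_l; lra).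
    assert (N * D x <= 5 / 2 * (/ 144000000 * (Bl x * Bu x))).
    { apply Rle_trans with (N * (/ 144000000 * (Bl x * Bu x))).
      - apply Rmult_le_compat_l; lra.
      - apply Rmult_le_compat_r; lra. }
    replace ((Bl x - N * Al x) * Bu x) with (Bl x * Bu x - N * (Al x * Bu x)) by ring.
    lra. }
  assert (Blt : forall t, 0 <= t <= x -> Bl x / 1000 <= Bl t).
  { intros t Ht.
    assert (V := flow_virial_decr e (- a) b Al Bl Pl Ql t x He Hl
      ltac:(lra) ltac:(lra) ltac:(lra) ltac:(lra)).
    destruct (Hl t) as (_ & _ & _ & _ & Alt & _ & _); [lra|].
    assert (Nt := sqr_add_pos e t He).
    assert (0 <= (t ^ 2 + e ^ 2) * Al t) by (apply Rmult_le_pos; lra).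
    fold N in V. lra. }
  assert (QW : Bl x / 3000 / 4 <= Ql x).
  { destruct Main as [Ha2 | [_ Hex]].
    - assert (Bl x / 3000 / 4 <= Ql 0 - Ql (- e)).
      { apply (flow_Q_window e (- a) b Al Bl Pl Ql); auto; try lra.
        intros r Hr. assert (S := pair_Bl_slow (- r) ltac:(lra)).
        rewrite Ropp_involutive in S.
        assert (exp (2 * - r) <= 3) by (apply (exp_2e_le e); lra).
        destruct (Hl r) as (_ & _ & _ & _ & _ & Br & _); [lra|].
        specialize (Blt 0 ltac:(lra)).
        assert (exp (2 * - r) * Bl r <= 3 * Bl r) by (apply Rmult_le_compat_r; lra). lra. }
      assert (0 <= Ql (- e)) by (apply pair_Ql_nonneg; lra).
      assert (Ql 0 <= Ql x) by (apply (flow_Q_incr e (- a) b Al Bl Pl Ql); auto; lra). lra.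
    - assert (Bl x / 3000 / 4 <= Ql (e / 2) - Ql 0).
      { apply (flow_Q_window e (- a) b Al Bl Pl Ql); auto; try lra.
        intros r Hr. specialize (Blt r ltac:(lra)). lra. }
      assert (0 <= Ql 0) by (apply pair_Ql_nonneg; lra).
      assert (Ql (e / 2) <= Ql x) by (apply (flow_Q_incr e (- a) b Al Bl Pl Ql); auto; lra). lra. }
  assert ((/ 12000) ^ 2 * (Bl x * Bu x) <= D x); [|lra].
  apply Dgap; [lra|].
  assert (0 <= - Qu x * Bl x) by (apply Rmult_le_pos; lra).
  assert (Bl x / 12000 * Bu x <= Ql x * Bu x) by (apply Rmult_le_compat_r; lra). lra.
Qed.

(** [A + B] at [x] stands for the dependence of the Green's function on [y], the increments of [Su]
    and [Sl] for its [L^2] norm in [z] on either side of [y]. The mass of the left solution is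
    compared with [Rx = Bl + N Al], because for that solution [N A <= B] is available only to the
    left of the origin. *)
Lemma pair_core (x : R) (Sl Su : R -> R) : 0 <= x <= 3 / 2 -> x <= b ->
  (forall r, - a <= r <= b -> is_derive Sl r (sqrt (r ^ 2 + e ^ 2) * Al r)) ->
  (forall r, - a <= r <= b -> is_derive Su r (sqrt (r ^ 2 + e ^ 2) * Au r)) ->
  let L := 1 + Rabs (ln (sqrt (x ^ 2 + e ^ 2))) in
  (Al x + Bl x) * (Su b - Su x) <= 10 ^ 15 * L ^ 2 * D x /\
  (Au x + Bu x) * (Sl x - Sl (- a)) <= 10 ^ 15 * L ^ 2 * D x.
Proof.
intros Hx Hxb HSl HSu L.
assert (L1 : 1 <= L) by (unfold L; assert (X := Rabs_pos (ln (sqrt (x ^ 2 + e ^ 2)))); lra).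
assert (W := pair_wronskian x Hx Hxb).
destruct (Hl x) as (_ & _ & _ & _ & Al0 & Bl0 & El); [lra|].
destruct (Hu x) as (_ & _ & _ & _ & Au0 & Bu0 & Eu); [lra|].
assert (AuL := decaying_A_log e (- a) b Au Bu Pu Qu He ltac:(lra) Hb Hu Au1 Pu1 Qu1 x He2 ltac:(lra) Hxb).
fold L in AuL.
assert (Mu : Su b - Su x <= 5 * Bu x).
{ apply (decaying_mass_le e (- a) b Au Bu Pu Qu); auto; try lra. intros; apply HSu; lra. }
set (N := x ^ 2 + e ^ 2) in *.
assert (N0 : 0 < N) by (apply sqr_add_pos, He).
assert (N1 : N <= 5 / 2) by (unfold N; nra).
assert (NA : 0 <= N * Al x) by (apply Rmult_le_pos; lra).
set (Rx := Bl x + N * Al x).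
(* [R = B + N A] satisfies [R' >= - 2 R] *)
assert (HR : forall t, 0 <= t <= x -> Bl t + (t ^ 2 + e ^ 2) * Al t <= 27 * Rx).
{ intros t Ht.
  assert (M : exp (2 * t) * (Bl t + (t ^ 2 + e ^ 2) * Al t) <= exp (2 * x) * Rx).
  { apply (derive_nonneg_le (fun t => exp (2 * t) * (Bl t + (t ^ 2 + e ^ 2) * Al t))
      (fun t => 2 * exp (2 * t) * (Bl t + (t ^ 2 + e ^ 2) * Al t)
         + exp (2 * t) * (2 * (t * Pl t + e * Ql t)
            + (2 * t * Al t + (t ^ 2 + e ^ 2) * (2 * (t * Pl t + e * Ql t) / (t ^ 2 + e ^ 2))))));
      [lra| |].
    - intros r Hr. destruct (Hl r) as (dA & dB & _); [lra|].
      apply (is_derive_Rmult (fun t => exp (2 * t)) (fun t => Bl t + (t ^ 2 + e ^ 2) * Al t)); [auto_derive; [easy|ring]|].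
      apply (is_derive_plus Bl (fun t => (t ^ 2 + e ^ 2) * Al t)); [exact dB|].
      apply (is_derive_Rmult (fun t => t ^ 2 + e ^ 2) Al); [auto_derive; [easy|ring] | exact dA].
    - intros r Hr. destruct (Hl r) as (_ & _ & _ & _ & Ar & Br & _); [lra|].
      assert (C := flow_cauchy e (- a) b Al Bl Pl Ql r Hl ltac:(lra)).
      assert (Nr := sqr_add_pos e r He).
      assert (Er := exp_pos (2 * r)).
      assert (C2 : - (Bl r + (r ^ 2 + e ^ 2) * Al r) <= 2 * (r * Pl r + e * Ql r)).
      { assert (0 <= (r ^ 2 + e ^ 2) * Al r) by (apply Rmult_le_pos; lra).
        apply sqr_le_neg; [lra|].
        assert (0 <= (Bl r - (r ^ 2 + e ^ 2) * Al r) ^ 2) by apply pow2_ge_0. nra. }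
      replace (2 * exp (2 * r) * (Bl r + (r ^ 2 + e ^ 2) * Al r) +
        exp (2 * r) * (2 * (r * Pl r + e * Ql r) +
         (2 * r * Al r + (r ^ 2 + e ^ 2) * (2 * (r * Pl r + e * Ql r) / (r ^ 2 + e ^ 2)))))
       with (exp (2 * r) * (2 * (Bl r + (r ^ 2 + e ^ 2) * Al r + 2 * (r * Pl r + e * Ql r))
           + 2 * (r * Al r))) by (field; lra).
      assert (0 <= r * Al r) by (apply Rmult_le_pos; lra).
      apply Rmult_le_pos; lra. }
  destruct (Hl t) as (_ & _ & _ & _ & At & Bt & _); [lra|].
  assert (Nt := sqr_add_pos e t He).
  assert (0 <= (t ^ 2 + e ^ 2) * Al t) by (apply Rmult_le_pos; lra).
  assert (1 <= exp (2 * t)) by (rewrite <- exp_0; apply exp_le; lra).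
  assert (exp (2 * x) <= 27).
  { apply Rle_trans with (exp 3); [apply exp_le; lra|].
    replace 3 with (1 + 1 + 1) by ring. rewrite !exp_plus.
    assert (E := exp_le_3). assert (E0 := exp_pos 1).
    assert (exp 1 * exp 1 <= 9) by nra. nra. }
  assert (exp (2 * x) * Rx <= 27 * Rx) by (apply Rmult_le_compat_r; unfold Rx; lra).
  nra. }
(* On [[- a, 0]] the reflected left solution is a decaying one; on [[0, x]] the mass bound applies
   with [k = 27 Rx]. *)
assert (Ml : Sl x - Sl (- a) <= 400 * Rx).
{ assert (M0 := decaying_mass_le e (- b) a _ _ _ _ (fun t => - Sl (- t)) 0 He ltac:(lra)
    pair_reflect Al1 Pl1 ltac:(simpl; rewrite Ql1; ring) ltac:(lra)).
  simpl in M0. rewrite Ropp_0 in M0.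
  assert (M2 : - Sl (- a) - - Sl 0 <= 5 * Bl 0).
  { apply M0. intros r Hr.
    replace (sqrt (r * (r * 1) + e * (e * 1)) * Al (- r))
      with (- (-1 * (sqrt ((- r) ^ 2 + e ^ 2) * Al (- r))))
      by (replace ((- r) ^ 2 + e ^ 2) with (r * (r * 1) + e * (e * 1)) by ring; ring).
    apply (is_derive_opp (fun t => Sl (- t))).
    apply (is_derive_comp Sl Ropp); [apply HSl; lra | auto_derive; [easy|ring]]. }
  assert (M1 := flow_mass_le e (- a) b Al Bl Pl Ql Sl 0 x (27 * Rx) He Hl
    ltac:(lra) ltac:(lra) ltac:(lra) ltac:(lra)).
  assert (M3 : Sl x - Sl 0 <= Bl 0 - (0 ^ 2 + e ^ 2) * Al 0 - (Bl x - (x ^ 2 + e ^ 2) * Al x) + 4 * (27 * Rx)).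
  { apply M1; [intros; apply HSl; lra|]. intros r Hr. specialize (HR r Hr).
    destruct (Hl r) as (_ & _ & _ & _ & _ & Br & _); [lra|]. lra. }
  assert (HR0 := HR 0 ltac:(lra)).
  destruct (Hl 0) as (_ & _ & _ & _ & A00 & B00 & _); [lra|].
  assert (N00 := sqr_add_pos e 0 He).
  assert (0 <= (0 ^ 2 + e ^ 2) * Al 0) by (apply Rmult_le_pos; lra).
  fold N in M3. unfold Rx in *. lra. }
assert (D0 : 0 <= D x) by (assert (0 <= Bl x * Bu x) by (apply Rmult_le_pos; lra); lra).
assert (L2 : 1 <= L ^ 2) by nra.
assert (LD : D x <= L ^ 2 * D x) by nra.
assert (AuBl : Au x * Bl x <= 9 * 144000000 * (L ^ 2 * D x)).
{ assert (Au x * Bl x <= 9 * L ^ 2 * Bu x * Bl x) by (apply Rmult_le_compat_r; lra).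
  assert (L ^ 2 * (Bl x * Bu x) <= L ^ 2 * (144000000 * D x)) by (apply Rmult_le_compat_l; lra).
  lra. }
assert (AlBu : Al x * Bu x <= 20 * 144000000 * (L ^ 2 * D x)).
{ assert (W2 := wronskian_sq_lower _ _ _ _ _ _ _ _ (1 / 2) ltac:(lra) Al0 Bl0 Au0 Bu0 El Eu).
  fold (D x) in W2. replace (/ (1 / 2) - 1) with 1 in W2 by field. lra. }
(* In [(Au + Bu) Rx] both [Au] and [Al Bu] cost a factor [L ^ 2]. The weight [N] of [Al] in [Rx]
   absorbs one of them, as [r (1 + |ln r|)] is bounded for [r = sqrt N] in this range; otherwise the
   final bound would contain the square of the logarithm. *)
assert (NL : N * L ^ 2 <= 7).
{ set (r := sqrt N) in *.
  assert (r0 : 0 < r) by (apply sqrt_lt_R0, N0).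
  assert (Er : N = r ^ 2) by (unfold r; rewrite pow2_sqrt; lra).
  rewrite Er. replace (r ^ 2 * L ^ 2) with ((r * L) ^ 2) by ring.
  assert (ln1 : forall s, 0 < s -> ln s <= s - 1).
  { intros s Hs. assert (X := exp_ineq1_le (ln s)). rewrite exp_ln in X; lra. }
  assert (RL : r * L <= 5 / 2).
  { unfold L. destruct (Rle_lt_dec r 1) as [R1 | R1].
    - rewrite Rabs_left1 by (rewrite <- ln_1; apply ln_le; lra).
      rewrite <- ln_Rinv by lra.
      assert (X := ln1 (/ r) ltac:(apply Rinv_0_lt_compat; lra)).
      assert (Y : r * (1 + ln (/ r)) <= r * (1 + (/ r - 1))) by (apply Rmult_le_compat_l; lra).
      replace (r * (1 + (/ r - 1))) with 1 in Y by (field; lra). lra.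
    - rewrite Rabs_pos_eq by (rewrite <- ln_1; apply ln_le; lra).
      assert (X := ln1 r r0).
      assert (r * (1 + ln r) <= r * (1 + (r - 1))) by (apply Rmult_le_compat_l; lra). nra. }
  assert (0 <= r * L) by (apply Rmult_le_pos; lra). nra. }
replace (10 ^ 15) with 1000000000000000 by ring.
split.
- apply Rle_trans with ((Al x + Bl x) * (5 * Bu x)); [apply Rmult_le_compat_l; lra | lra].
- assert (BuR : L ^ 2 * Bu x * Rx <= 141 * 144000000 * (L ^ 2 * D x)).
  { unfold Rx.
    assert (N * L ^ 2 * (Al x * Bu x) <= 7 * (20 * 144000000 * (L ^ 2 * D x))).
    { apply Rle_trans with (7 * (Al x * Bu x)); [|lra].
      apply Rmult_le_compat_r; [apply Rmult_le_pos; lra | lra]. }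
    assert (L ^ 2 * (Bl x * Bu x) <= L ^ 2 * (144000000 * D x)) by (apply Rmult_le_compat_l; lra).
    lra. }
  assert (Au x + Bu x <= 10 * L ^ 2 * Bu x).
  { assert (Bu x <= L ^ 2 * Bu x) by nra. lra. }
  apply Rle_trans with ((Au x + Bu x) * (400 * Rx)); [apply Rmult_le_compat_l; lra|].
  assert (0 <= Rx) by (unfold Rx; lra).
  assert ((Au x + Bu x) * Rx <= 10 * L ^ 2 * Bu x * Rx) by (apply Rmult_le_compat_r; lra).
  lra.
Qed.

End Pair.

(** From the origin to its own Dirichlet end each [B] decreases, and it is still positive there; so
    [Bl 0 * Bu 0 > 0]. *)
Lemma pair_wronskian_pos (e a b : R) (Al Bl Pl Ql Au Bu Pu Qu : R -> R) :
  0 < e <= 1 / 2 -> 0 <= a -> 0 <= b -> 1 <= a + b ->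
  flow e (- a) b Al Bl Pl Ql -> flow e (- a) b Au Bu Pu Qu ->
  Al (- a) = 0 -> Pl (- a) = 0 -> Ql (- a) = 0 -> Au b = 0 -> Pu b = 0 -> Qu b = 0 ->
  0 < Bl (- a) -> 0 < Bu b ->
  0 < wronskian_sq (Al 0) (Bl 0) (Pl 0) (Ql 0) (Au 0) (Bu 0) (Pu 0) (Qu 0).
Proof.
intros [He He2] Ha Hb Hab Hl Hu Al1 Pl1 Ql1 Au1 Pu1 Qu1 Bl1 Bu1.
assert (W := pair_wronskian e a b Al Bl Pl Ql Au Bu Pu Qu He He2 Ha Hb Hab Hl Hu
  Al1 Ql1 Au1 Pu1 Qu1 0 ltac:(lra) Hb).
assert (Bu b <= Bu 0) by (apply (decaying_B_decr e (- a) b Au Bu Pu Qu); auto; lra).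
assert (G := decaying_B_decr e (- b) a _ _ _ _ He ltac:(lra)
  (pair_reflect e a b Al Bl Pl Ql Hl) Pl1 ltac:(simpl; rewrite Ql1; ring) 0 a
  ltac:(lra) Ha ltac:(lra)).
simpl in G. rewrite Ropp_0 in G.
assert (0 < Bl 0 * Bu 0) by (apply Rmult_lt_0_compat; lra). lra.
Qed.

(** For [x < 0] the reflection exchanges the two ends, and with them the two solutions; both [Q]
    change sign, which leaves the Wronskian unchanged. *)
Lemma pair_estimate (e a b : R) (Al Bl Pl Ql Au Bu Pu Qu Sl Su : R -> R) (x : R) :
  0 < e <= 1 / 2 -> 0 <= a -> 0 <= b -> 1 <= a + b ->
  flow e (- a) b Al Bl Pl Ql -> flow e (- a) b Au Bu Pu Qu ->
  Al (- a) = 0 -> Pl (- a) = 0 -> Ql (- a) = 0 -> Au b = 0 -> Pu b = 0 -> Qu b = 0 ->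
  (forall r, - a <= r <= b -> is_derive Sl r (sqrt (r ^ 2 + e ^ 2) * Al r)) ->
  (forall r, - a <= r <= b -> is_derive Su r (sqrt (r ^ 2 + e ^ 2) * Au r)) ->
  - a <= x <= b -> Rabs x <= 3 / 2 ->
  let L := 1 + Rabs (ln (sqrt (x ^ 2 + e ^ 2))) in
  let D := wronskian_sq (Al x) (Bl x) (Pl x) (Ql x) (Au x) (Bu x) (Pu x) (Qu x) in
  (Al x + Bl x) * (Su b - Su x) <= 10 ^ 15 * L ^ 2 * D /\
  (Au x + Bu x) * (Sl x - Sl (- a)) <= 10 ^ 15 * L ^ 2 * D.
Proof.
intros [He He2] Ha Hb Hab Hl Hu Al1 Pl1 Ql1 Au1 Pu1 Qu1 HSl HSu Hx Hx2.
destruct (Rle_lt_dec 0 x) as [H0 | H0].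
- rewrite Rabs_pos_eq in Hx2 by lra.
  apply (pair_core e a b Al Bl Pl Ql Au Bu Pu Qu); auto; lra.
- rewrite Rabs_left in Hx2 by lra.
  assert (Sr : forall S A, (forall r, - a <= r <= b -> is_derive S r (sqrt (r ^ 2 + e ^ 2) * A r)) ->
    forall r, - b <= r <= a ->
    is_derive (fun t => - S (- t)) r (sqrt (r ^ 2 + e ^ 2) * A (- r))).
  { intros S A HS r Hr.
    replace (sqrt (r ^ 2 + e ^ 2) * A (- r)) with (- (-1 * (sqrt ((- r) ^ 2 + e ^ 2) * A (- r))))
      by (replace ((- r) ^ 2) with (r ^ 2) by ring; ring).
    apply (is_derive_opp (fun t => S (- t))).
    apply (is_derive_comp S Ropp); [apply HS; lra | auto_derive; [easy|ring]]. }
  assert (C := pair_core e b a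
    (fun t => Au (- t)) (fun t => Bu (- t)) (fun t => Pu (- t)) (fun t => - Qu (- t))
    (fun t => Al (- t)) (fun t => Bl (- t)) (fun t => Pl (- t)) (fun t => - Ql (- t))
    He He2 Hb Ha ltac:(lra)
    (pair_reflect e a b Au Bu Pu Qu Hu) (pair_reflect e a b Al Bl Pl Ql Hl)).
  cbv beta in C. rewrite Ropp_involutive in C.
  specialize (C Au1 Pu1 ltac:(rewrite Qu1; ring) Al1 Pl1 ltac:(rewrite Ql1; ring) (- x)
    (fun t => - Su (- t)) (fun t => - Sl (- t)) ltac:(lra) ltac:(lra) (Sr Su Au HSu) (Sr Sl Al HSl)).
  cbv beta zeta in C. rewrite !Ropp_involutive in C.
  replace ((- x) ^ 2) with (x ^ 2) in C by ring.
  replace (wronskian_sq (Au x) (Bu x) (Pu x) (- Qu x) (Al x) (Bl x) (Pl x) (- Ql x))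
    with (wronskian_sq (Al x) (Bl x) (Pl x) (Ql x) (Au x) (Bu x) (Pu x) (Qu x)) in C
    by (unfold wronskian_sq; ring).
  cbv zeta. destruct C as [C1 C2].
  replace (Su b - Su x) with (- Su x - - Su b) by ring.
  replace (Sl x - Sl (- a)) with (- Sl (- a) - - Sl x) by ring.
  split; assumption.
Qed.

(** * From the Taylor-Goldstein equation to the flow *)

(** Real part of [m^2 - 1 / (4 w^2)] with [w = y - y0 + i eta], from [1 / w^2 = (conj w)^2 / |w|^4];
    [pot_im] is the imaginary part. The choice of sign sits in [eta]. *)
Definition pot_re (m y0 eta y : R) : R :=
  m ^ 2 - ((y - y0) ^ 2 - eta ^ 2) / (4 * ((y - y0) ^ 2 + eta ^ 2) ^ 2).

Definition pot_im (y0 eta y : R) : R :=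
  2 * (y - y0) * eta / (4 * ((y - y0) ^ 2 + eta ^ 2) ^ 2).

(** [u1 + i u2] solves [u'' = (pot_re + i pot_im) u] and has derivative [v1 + i v2]. *)
Definition solution (V1 V2 u1 u2 v1 v2 : R -> R) : Prop :=
  forall y, is_derive u1 y (v1 y) /\ is_derive u2 y (v2 y) /\
    is_derive v1 y (V1 y * u1 y - V2 y * u2 y) /\
    is_derive v2 y (V2 y * u1 y + V1 y * u2 y).

Definition dist (y0 eta y : R) : R := sqrt ((y - y0) ^ 2 + eta ^ 2).

(** [is_derive_unique] in the eta-expanded form left by [auto_derive]. *)
Lemma Derive_eta (f : R -> R) (y l : R) : is_derive f y l -> Derive (fun x : R => f x) y = l.
Proof. exact (is_derive_unique f y l). Qed.

Section Moments.

Variables (m y0 eps sg : R) (u1 u2 v1 v2 : R -> R).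
Hypotheses (Hm : 0 < m) (Heps : 0 < eps) (Hsg : sg ^ 2 = 1).
Let eta := sg * eps.
Hypothesis Hsol : solution (pot_re m y0 eta) (pot_im y0 eta) u1 u2 v1 v2.

(** The solution is [sqrt w f] with [w = y - y0 + i sg eps] and [g = w f'], so that
    [imp_re + i imp_im = w u' - u / 2 = sqrt w g]. *)
Definition imp_re (y : R) : R := (y - y0) * v1 y - sg * eps * v2 y - u1 y / 2.
Definition imp_im (y : R) : R := (y - y0) * v2 y + sg * eps * v1 y - u2 y / 2.
(** The four moments are [|f|^2], [|g|^2] and the parts of [g conj f]. Each carries
    [|sqrt w|^2 = |w|], so dividing by [dist] replaces a choice of [sqrt w]. *)
Definition momA (y : R) : R := (u1 y ^ 2 + u2 y ^ 2) / dist y0 eps y.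
Definition momB (y : R) : R := (imp_re y ^ 2 + imp_im y ^ 2) / dist y0 eps y.
Definition momP (y : R) : R := (imp_re y * u1 y + imp_im y * u2 y) / dist y0 eps y.
(** The factor [sg] conjugates in the case of the minus sign, so that both signs lead to the same
    flow with [e > 0]. *)
Definition momQ (y : R) : R := sg * (imp_im y * u1 y - imp_re y * u2 y) / dist y0 eps y.

Lemma is_derive_div_dist (f : R -> R) (y df : R) : is_derive f y df ->
  is_derive (fun y => f y / dist y0 eps y) y
   ((df - f y * (y - y0) / ((y - y0) ^ 2 + eps ^ 2)) / dist y0 eps y).
Proof.
intros Hf.
assert (N0 : 0 < (y - y0) ^ 2 + eps ^ 2) by (apply sqr_add_pos, Heps).
assert (r0 : 0 < dist y0 eps y) by (apply sqrt_lt_R0, N0).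
assert (Er : dist y0 eps y ^ 2 = (y - y0) ^ 2 + eps ^ 2) by (apply pow2_sqrt; lra).
assert (Hr : is_derive (dist y0 eps) y ((y - y0) / dist y0 eps y)).
{ unfold dist. evar_last.
  - apply (is_derive_sqrt (fun y => (y - y0) ^ 2 + eps ^ 2)); [auto_derive; [easy|reflexivity] | exact N0].
  - fold (dist y0 eps y). simpl. unfold Rminus. field. unfold Rminus in r0. lra. }
evar_last.
- apply (is_derive_div f (dist y0 eps)); [exact Hf | exact Hr | lra].
- rewrite <- Er. field. lra.
Qed.

Lemma imp_re_derive (y : R) : is_derive imp_re y
  (v1 y / 2 + (y - y0) * (pot_re m y0 eta y * u1 y - pot_im y0 eta y * u2 y)
    - sg * eps * (pot_im y0 eta y * u1 y + pot_re m y0 eta y * u2 y)).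
Proof.
destruct (Hsol y) as (d1 & d2 & d3 & d4). unfold imp_re. auto_derive.
- repeat split; eexists; eassumption.
- rewrite (Derive_eta v1 y _ d3), (Derive_eta v2 y _ d4),
    (Derive_eta u1 y _ d1). field.
Qed.

Lemma imp_im_derive (y : R) : is_derive imp_im y
  (v2 y / 2 + (y - y0) * (pot_im y0 eta y * u1 y + pot_re m y0 eta y * u2 y)
    + sg * eps * (pot_re m y0 eta y * u1 y - pot_im y0 eta y * u2 y)).
Proof.
destruct (Hsol y) as (d1 & d2 & d3 & d4). unfold imp_im. auto_derive.
- repeat split; eexists; eassumption.
- rewrite (Derive_eta v1 y _ d3), (Derive_eta v2 y _ d4),
    (Derive_eta u2 y _ d2). field.
Qed.

Ltac mom_derive f y :=
  evar_last;
  [ apply (is_derive_div_dist f);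
    assert (i1 := imp_re_derive y); assert (i2 := imp_im_derive y);
    destruct (Hsol y) as (d1 & d2 & d3 & d4);
    auto_derive;
    [ repeat split; eexists; eassumption
    | rewrite ?(Derive_eta u1 y _ d1), ?(Derive_eta u2 y _ d2),
        ?(Derive_eta imp_re y _ i1), ?(Derive_eta imp_im y _ i2);
      reflexivity ]
  | ].

Lemma dist_pos (y : R) : 0 < dist y0 eps y.
Proof. apply sqrt_lt_R0, sqr_add_pos, Heps. Qed.

Lemma eta_sqr : eta ^ 2 = eps ^ 2.
Proof. unfold eta. rewrite Rpow_mult_distr, Hsg. ring. Qed.

(** Regrouping [sg * eps] into [eta] leaves rational identities in [eta] alone, which [field] proves
    without using [sg ^ 2 = 1]. *)
Lemma momP_momQ (y : R) : (y - y0) * momP y + eps * momQ y =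
  ((y - y0) * (imp_re y * u1 y + imp_im y * u2 y)
    + eta * (imp_im y * u1 y - imp_re y * u2 y)) / dist y0 eps y.
Proof.
assert (r0 := dist_pos y). unfold momP, momQ, eta. field. lra.
Qed.

Lemma sum_sqr_pos (y : R) : 0 < (y - y0) ^ 2 + eta ^ 2.
Proof. rewrite eta_sqr. apply sqr_add_pos, Heps. Qed.

Ltac mom_finish y :=
  rewrite <- eta_sqr; assert (N0 := sum_sqr_pos y); assert (r0 := dist_pos y);
  unfold pot_re, pot_im, imp_re, imp_im; fold eta;
  generalize dependent eta; intros; field; lra.

Lemma momA_derive (y : R) : is_derive momA y
  (2 * ((y - y0) * momP y + eps * momQ y) / ((y - y0) ^ 2 + eps ^ 2)).
Proof.
mom_derive (fun y => u1 y ^ 2 + u2 y ^ 2) y.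
rewrite momP_momQ. mom_finish y.
Qed.

Lemma momB_derive (y : R) : is_derive momB y
  (2 * m ^ 2 * ((y - y0) * momP y + eps * momQ y)).
Proof.
mom_derive (fun y => imp_re y ^ 2 + imp_im y ^ 2) y.
rewrite momP_momQ. mom_finish y.
Qed.

Lemma momP_derive (y : R) : is_derive momP y
  ((y - y0) * (m ^ 2 * momA y + momB y / ((y - y0) ^ 2 + eps ^ 2))).
Proof.
mom_derive (fun y => imp_re y * u1 y + imp_im y * u2 y) y.
unfold momA, momB. mom_finish y.
Qed.

Lemma momQ_derive (y : R) : is_derive momQ y
  (eps * (m ^ 2 * momA y + momB y / ((y - y0) ^ 2 + eps ^ 2))).
Proof.
assert (E : eps = sg * eta) by (unfold eta; rewrite <- Rmult_assoc; replace (sg * sg) with (sg ^ 2) by ring; rewrite Hsg; ring).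
mom_derive (fun y => sg * (imp_im y * u1 y - imp_re y * u2 y)) y.
unfold momA, momB.
replace (eps * _) with (sg * eta * (m ^ 2 * ((u1 y ^ 2 + u2 y ^ 2) / dist y0 eps y) +
     (imp_re y ^ 2 + imp_im y ^ 2) / dist y0 eps y / ((y - y0) ^ 2 + eps ^ 2)))
  by (now rewrite <- E).
mom_finish y.
Qed.

Lemma mom_identity (y : R) : momP y ^ 2 + momQ y ^ 2 = momA y * momB y.
Proof.
assert (r0 := dist_pos y). unfold momP, momQ, momA, momB.
replace ((sg * (imp_im y * u1 y - imp_re y * u2 y) / dist y0 eps y) ^ 2)
  with (sg ^ 2 * (imp_im y * u1 y - imp_re y * u2 y) ^ 2 / dist y0 eps y ^ 2) by (field; lra).
rewrite Hsg. field. lra.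
Qed.

Lemma momA_nonneg (y : R) : 0 <= momA y.
Proof. apply Rdiv_le_0_compat; [nra | apply dist_pos]. Qed.

Lemma momB_nonneg (y : R) : 0 <= momB y.
Proof. apply Rdiv_le_0_compat; [nra | apply dist_pos]. Qed.

Lemma is_derive_rescale (f : R -> R) (t df : R) :
  is_derive f (y0 + t / m) df -> is_derive (fun t => f (y0 + t / m)) t (df / m).
Proof.
intros Hf. replace (df / m) with (scal (/ m) df) by (unfold scal; simpl; unfold mult; simpl; field; lra).
apply (is_derive_comp f (fun t => y0 + t / m)); [exact Hf|].
auto_derive; [easy | field; lra].
Qed.

(** The rescaling [t = m (y - y0)] turns the factor [m ^ 2] of the moment equations into 1. *)
Lemma mom_flow (lo hi : R) : flow (m * eps) lo hi
  (fun t => momA (y0 + t / m)) (fun t => momB (y0 + t / m))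
  (fun t => momP (y0 + t / m)) (fun t => momQ (y0 + t / m)).
Proof.
intros t _. set (y := y0 + t / m).
assert (Et : t = m * (y - y0)) by (unfold y; field; lra).
assert (N0 := sqr_add_pos eps (y - y0) Heps).
replace (t ^ 2 + (m * eps) ^ 2) with (m ^ 2 * ((y - y0) ^ 2 + eps ^ 2)) by (rewrite Et; ring).
split; [|split; [|split; [|split; [|split; [|split]]]]].
- evar_last; [apply is_derive_rescale, momA_derive | fold y; rewrite Et; field; split; lra].
- evar_last; [apply is_derive_rescale, momB_derive | fold y; rewrite Et; field; lra].
- evar_last; [apply is_derive_rescale, momP_derive | fold y; rewrite Et; field; split; lra].
- evar_last; [apply is_derive_rescale, momQ_derive | fold y; field; split; lra].
- apply momA_nonneg.
- apply momB_nonneg.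
- apply mom_identity.
Qed.

(** In the variable [t], [m ^ 2] times a primitive of [|u|^2] has derivative [m |u|^2], and
    [|u|^2 = |w| momA] while [sqrt N = m |w|]. *)
Lemma mass_derive (F : R -> R) (t : R) :
  is_derive F (y0 + t / m) (u1 (y0 + t / m) ^ 2 + u2 (y0 + t / m) ^ 2) ->
  is_derive (fun t => m ^ 2 * F (y0 + t / m)) t
   (sqrt (t ^ 2 + (m * eps) ^ 2) * momA (y0 + t / m)).
Proof.
intros HF. set (y := y0 + t / m) in *.
assert (Et : t = m * (y - y0)) by (unfold y; field; lra).
assert (r0 := dist_pos y).
replace (sqrt (t ^ 2 + (m * eps) ^ 2)) with (m * dist y0 eps y).
- evar_last; [apply is_derive_scal, is_derive_rescale, HF|].
  unfold momA. simpl. field. split; lra.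
- replace (t ^ 2 + (m * eps) ^ 2) with (m ^ 2 * ((y - y0) ^ 2 + eps ^ 2)) by (rewrite Et; ring).
  rewrite sqrt_mult_alt by nra. rewrite sqrt_pow2 by lra. reflexivity.
Qed.

Lemma mom_vanish (y : R) : u1 y = 0 -> u2 y = 0 -> momA y = 0 /\ momP y = 0 /\ momQ y = 0.
Proof.
intros E1 E2. unfold momA, momP, momQ. rewrite E1, E2.
assert (r0 := dist_pos y). repeat split; field; lra.
Qed.

Lemma momB_pos (y : R) : u1 y = 0 -> u2 y = 0 -> v1 y = 1 -> v2 y = 0 -> 0 < momB y.
Proof.
intros E1 E2 E3 E4. unfold momB, imp_re, imp_im. rewrite E1, E2, E3, E4.
apply Rdiv_lt_0_compat; [|apply dist_pos].
replace (((y - y0) * 1 - sg * eps * 0 - 0 / 2) ^ 2 + ((y - y0) * 0 + sg * eps * 1 - 0 / 2) ^ 2)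
  with ((y - y0) ^ 2 + sg ^ 2 * eps ^ 2) by field.
rewrite Hsg, Rmult_1_l. now apply sqr_add_pos.
Qed.

(** [w u' = sqrt w g + u / 2], so the derivative is recovered from both moments. *)
Lemma mom_derivative_le (y : R) :
  dist y0 eps y * (v1 y ^ 2 + v2 y ^ 2) <= 2 * (momA y + momB y).
Proof.
assert (r0 := dist_pos y).
assert (Er : dist y0 eps y ^ 2 = (y - y0) ^ 2 + sg ^ 2 * eps ^ 2).
{ rewrite Hsg, Rmult_1_l. apply pow2_sqrt. left. now apply sqr_add_pos. }
assert (E : dist y0 eps y * (v1 y ^ 2 + v2 y ^ 2)
  = ((imp_re y + u1 y / 2) ^ 2 + (imp_im y + u2 y / 2) ^ 2) / dist y0 eps y).
{ apply Rmult_eq_reg_r with (dist y0 eps y); [|lra].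
  replace (dist y0 eps y * (v1 y ^ 2 + v2 y ^ 2) * dist y0 eps y)
   with (dist y0 eps y ^ 2 * (v1 y ^ 2 + v2 y ^ 2)) by ring.
  rewrite Er. unfold imp_re, imp_im. field. lra. }
rewrite E. unfold momA, momB.
replace (2 * ((u1 y ^ 2 + u2 y ^ 2) / dist y0 eps y + (imp_re y ^ 2 + imp_im y ^ 2) / dist y0 eps y))
 with ((2 * (u1 y ^ 2 + u2 y ^ 2 + imp_re y ^ 2 + imp_im y ^ 2)) / dist y0 eps y) by (field; lra).
apply Rmult_le_compat_r; [left; now apply Rinv_0_lt_compat|].
generalize (imp_re y) (imp_im y). intros p q.
assert (0 <= (p - u1 y / 2) ^ 2) by apply pow2_ge_0.
assert (0 <= (q - u2 y / 2) ^ 2) by apply pow2_ge_0.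
nra.
Qed.

End Moments.

(** In the antisymmetric combination the halves of the solutions cancel and the remaining factor
    [y - y0 + i sg eps] divides out: [f_l g_u - f_u g_l] has the modulus of the Wronskian of the
    original solutions. *)
Lemma wronskian_sq_mom (y0 eps sg : R) (u1 u2 v1 v2 w1 w2 z1 z2 : R -> R) (y : R) :
  0 < eps -> sg ^ 2 = 1 ->
  wronskian_sq (momA y0 eps u1 u2 y) (momB y0 eps sg u1 u2 v1 v2 y)
    (momP y0 eps sg u1 u2 v1 v2 y) (momQ y0 eps sg u1 u2 v1 v2 y)
    (momA y0 eps w1 w2 y) (momB y0 eps sg w1 w2 z1 z2 y)
    (momP y0 eps sg w1 w2 z1 z2 y) (momQ y0 eps sg w1 w2 z1 z2 y)
  = (u1 y * z1 y - u2 y * z2 y - (v1 y * w1 y - v2 y * w2 y)) ^ 2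
    + (u1 y * z2 y + u2 y * z1 y - (v1 y * w2 y + v2 y * w1 y)) ^ 2.
Proof.
intros Heps Hsg.
assert (r0 : 0 < dist y0 eps y) by (apply sqrt_lt_R0, sqr_add_pos, Heps).
assert (Er : dist y0 eps y ^ 2 = (y - y0) ^ 2 + (sg * eps) ^ 2).
{ rewrite Rpow_mult_distr, Hsg, Rmult_1_l. apply pow2_sqrt. left. now apply sqr_add_pos. }
unfold wronskian_sq, momQ.
match goal with |- ?a + ?b - 2 * (?c + sg * ?q / ?d * (sg * ?q' / ?d)) = _ =>
  replace (sg * q / d * (sg * q' / d)) with (sg ^ 2 * (q / d * (q' / d))) by (field; lra) end.
rewrite Hsg. unfold momA, momB, momP.
set (p1 := imp_re y0 eps sg u1 v1 v2 y). set (p2 := imp_im y0 eps sg u2 v1 v2 y).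
set (q1 := imp_re y0 eps sg w1 z1 z2 y). set (q2 := imp_im y0 eps sg w2 z1 z2 y).
transitivity (((u1 y * q1 - u2 y * q2 - (p1 * w1 y - p2 * w2 y)) ^ 2
  + (u1 y * q2 + u2 y * q1 - (p1 * w2 y + p2 * w1 y)) ^ 2) / dist y0 eps y ^ 2);
  [field; lra|].
apply Rmult_eq_reg_r with (dist y0 eps y ^ 2); [|nra].
transitivity ((u1 y * q1 - u2 y * q2 - (p1 * w1 y - p2 * w2 y)) ^ 2
  + (u1 y * q2 + u2 y * q1 - (p1 * w2 y + p2 * w1 y)) ^ 2); [field; lra|].
rewrite Er. unfold p1, p2, q1, q2, imp_re, imp_im. field.
Qed.

Definition wr_re (u1 u2 v1 v2 w1 w2 z1 z2 : R -> R) (y : R) : R :=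
  u1 y * z1 y - u2 y * z2 y - (v1 y * w1 y - v2 y * w2 y).
Definition wr_im (u1 u2 v1 v2 w1 w2 z1 z2 : R -> R) (y : R) : R :=
  u1 y * z2 y + u2 y * z1 y - (v1 y * w2 y + v2 y * w1 y).

(** * The Dirichlet solutions in the original variable *)

Section Estimate.

Variables (m y0 eps sg : R) (u1 u2 v1 v2 w1 w2 z1 z2 : R -> R).
Hypotheses (Hm : 1 <= m) (Heps : 0 < eps) (Hme : m * eps <= 1 / 2) (Hsg : sg ^ 2 = 1).
Hypothesis (Hy0 : 0 <= y0 <= 1).
Hypothesis Hl : solution (pot_re m y0 (sg * eps)) (pot_im y0 (sg * eps)) u1 u2 v1 v2.
Hypothesis Hu : solution (pot_re m y0 (sg * eps)) (pot_im y0 (sg * eps)) w1 w2 z1 z2.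
Hypotheses (l1 : u1 0 = 0) (l2 : u2 0 = 0) (l3 : v1 0 = 1) (l4 : v2 0 = 0).
Hypotheses (r1 : w1 1 = 0) (r2 : w2 1 = 0) (r3 : z1 1 = 1) (r4 : z2 1 = 0).

Let D (y : R) := wr_re u1 u2 v1 v2 w1 w2 z1 z2 y ^ 2 + wr_im u1 u2 v1 v2 w1 w2 z1 z2 y ^ 2.

Lemma wronskian_pos : 0 < D y0.
Proof.
assert (E0 : y0 + - (m * y0) / m = 0) by (field; lra).
assert (E1 : y0 + m * (1 - y0) / m = 1) by (field; lra).
assert (Ey : y0 + 0 / m = y0) by (field; lra).
destruct (mom_vanish y0 eps sg u1 u2 v1 v2 Heps 0 l1 l2) as (a1 & a2 & a3).
destruct (mom_vanish y0 eps sg w1 w2 z1 z2 Heps 1 r1 r2) as (b1 & b2 & b3).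
assert (W := pair_wronskian_pos (m * eps) (m * y0) (m * (1 - y0))
  _ _ _ _ _ _ _ _ ltac:(nra) ltac:(nra) ltac:(nra) ltac:(nra)
  (mom_flow m y0 eps sg u1 u2 v1 v2 ltac:(lra) Heps Hsg Hl _ _)
  (mom_flow m y0 eps sg w1 w2 z1 z2 ltac:(lra) Heps Hsg Hu _ _)).
cbv beta in W. rewrite E0, E1, Ey in W.
rewrite wronskian_sq_mom in W by auto.
apply W; auto; apply momB_pos; auto.
Qed.

(** [r |u'|^2 <= 2 (A + B)] brings in the derivative, at the cost of the factor [3 = 1 + 2]. *)
Lemma solutions_estimate (y : R) (Fl Fu : R -> R) :
  0 <= y <= 1 -> m * Rabs (y - y0) <= 3 / 2 ->
  (forall t, is_derive Fl t (u1 t ^ 2 + u2 t ^ 2)) ->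
  (forall t, is_derive Fu t (w1 t ^ 2 + w2 t ^ 2)) ->
  let L := 1 + Rabs (ln (m * dist y0 eps y)) in
  let r := dist y0 eps y in
  m ^ 2 * ((u1 y ^ 2 + u2 y ^ 2) / r + r * (v1 y ^ 2 + v2 y ^ 2)) * (Fu 1 - Fu y)
    <= 3 * 10 ^ 15 * L ^ 2 * D y /\
  m ^ 2 * ((w1 y ^ 2 + w2 y ^ 2) / r + r * (z1 y ^ 2 + z2 y ^ 2)) * (Fl y - Fl 0)
    <= 3 * 10 ^ 15 * L ^ 2 * D y.
Proof.
intros Hy Hyy HFl HFu L r.
assert (E0 : y0 + - (m * y0) / m = 0) by (field; lra).
assert (E1 : y0 + m * (1 - y0) / m = 1) by (field; lra).
assert (Ey : y0 + m * (y - y0) / m = y) by (field; lra).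
destruct (mom_vanish y0 eps sg u1 u2 v1 v2 Heps 0 l1 l2) as (a1 & a2 & a3).
destruct (mom_vanish y0 eps sg w1 w2 z1 z2 Heps 1 r1 r2) as (b1 & b2 & b3).
assert (W := pair_estimate (m * eps) (m * y0) (m * (1 - y0))
  _ _ _ _ _ _ _ _ (fun t => m ^ 2 * Fl (y0 + t / m)) (fun t => m ^ 2 * Fu (y0 + t / m)) (m * (y - y0))
  ltac:(nra) ltac:(nra) ltac:(nra) ltac:(nra)
  (mom_flow m y0 eps sg u1 u2 v1 v2 ltac:(lra) Heps Hsg Hl _ _)
  (mom_flow m y0 eps sg w1 w2 z1 z2 ltac:(lra) Heps Hsg Hu _ _)).
cbv beta in W. rewrite E0, E1, Ey in W.
specialize (W a1 a2 a3 b1 b2 b3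
  (fun t _ => mass_derive m y0 eps u1 u2 ltac:(lra) Heps Fl t (HFl _))
  (fun t _ => mass_derive m y0 eps w1 w2 ltac:(lra) Heps Fu t (HFu _))
  ltac:(nra)).
rewrite wronskian_sq_mom in W by auto. fold (wr_re u1 u2 v1 v2 w1 w2 z1 z2 y) in W.
fold (wr_im u1 u2 v1 v2 w1 w2 z1 z2 y) in W. fold (D y) in W.
replace (sqrt ((m * (y - y0)) ^ 2 + (m * eps) ^ 2)) with (m * dist y0 eps y) in W.
2:{ unfold dist. rewrite <- (sqrt_pow2 m) at 1 by lra. rewrite <- sqrt_mult_alt by nra.
    f_equal. ring. }
cbv zeta in W. fold L in W.
rewrite Rabs_mult, (Rabs_pos_eq m) in W by lra. specialize (W Hyy). destruct W as [Wl Wu].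
assert (mono : forall F f1 f2, (forall t, is_derive F t (f1 t ^ 2 + f2 t ^ 2)) ->
   forall s t, s <= t -> F s <= F t).
{ intros F f1 f2 HF s t Hst. apply (derive_nonneg_le F (fun t => f1 t ^ 2 + f2 t ^ 2)); auto.
  intros; nra. }
assert (M1 := mono Fl u1 u2 HFl 0 y ltac:(lra)).
assert (M2 := mono Fu w1 w2 HFu y 1 ltac:(lra)).
assert (T1 := mom_derivative_le y0 eps sg u1 u2 v1 v2 Heps Hsg y).
assert (T2 := mom_derivative_le y0 eps sg w1 w2 z1 z2 Heps Hsg y).
assert (B1 := momB_nonneg y0 eps sg u1 u2 v1 v2 Heps y).
assert (B2 := momB_nonneg y0 eps sg w1 w2 z1 z2 Heps y).
assert (Q1 : 0 <= m ^ 2 * (Fu 1 - Fu y)) by (apply Rmult_le_pos; nra).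
assert (Q2 : 0 <= m ^ 2 * (Fl y - Fl 0)) by (apply Rmult_le_pos; nra).
fold r in T1, T2.
change ((u1 y ^ 2 + u2 y ^ 2) / r) with (momA y0 eps u1 u2 y).
change ((w1 y ^ 2 + w2 y ^ 2) / r) with (momA y0 eps w1 w2 y).
set (Al := momA y0 eps u1 u2 y) in *. set (Au := momA y0 eps w1 w2 y) in *.
set (Bl := momB y0 eps sg u1 u2 v1 v2 y) in *. set (Bu := momB y0 eps sg w1 w2 z1 z2 y) in *.
split.
- apply Rle_trans with (3 * ((Al + Bl) * (m ^ 2 * Fu 1 - m ^ 2 * Fu y))); [|lra].
  assert ((Al + r * (v1 y ^ 2 + v2 y ^ 2)) * (m ^ 2 * (Fu 1 - Fu y))
    <= 3 * (Al + Bl) * (m ^ 2 * (Fu 1 - Fu y))) by (apply Rmult_le_compat_r; lra).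
  lra.
- apply Rle_trans with (3 * ((Au + Bu) * (m ^ 2 * Fl y - m ^ 2 * Fl 0))); [|lra].
  assert ((Au + r * (z1 y ^ 2 + z2 y ^ 2)) * (m ^ 2 * (Fl y - Fl 0))
    <= 3 * (Au + Bu) * (m ^ 2 * (Fl y - Fl 0))) by (apply Rmult_le_compat_r; lra).
  lra.
Qed.

End Estimate.

(** * Linear second-order equations *)

Lemma is_derive_RInt_continuous (f : R -> R) (x0 x : R) :
  (forall t, continuous f t) -> is_derive (fun x => RInt f x0 x) x (f x).
Proof.
intros Hf. apply (is_derive_RInt f _ x0); [|apply Hf].
apply filter_forall. intros y. apply (RInt_correct f x0 y).
apply ex_RInt_continuous. intros; apply Hf.
Qed.

(** The weight [exp (k |t - x0|)] makes integration a contraction on the whole line. *)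
Lemma RInt_exp_weight (f : R -> R) (x0 c k : R) : 0 < k -> 0 <= c ->
  (forall t, continuous f t) ->
  (forall t, Rabs (f t) <= c * exp (k * Rabs (t - x0))) ->
  forall x, Rabs (RInt f x0 x) <= c / k * exp (k * Rabs (x - x0)).
Proof.
intros Hk Hc Hf Hb x.
assert (ck : 0 <= c / k) by (apply Rdiv_le_0_compat; lra).
assert (Main : forall s, s ^ 2 = 1 -> s * RInt f x0 x <= c / k * exp (k * Rabs (x - x0))).
{ intros s Hs.
  assert (Hs2 : forall t, - (c * exp (k * Rabs (t - x0))) <= s * f t <= c * exp (k * Rabs (t - x0))).
  { intros t. specialize (Hb t). apply Rabs_le_between.
    rewrite Rabs_mult. assert (E : Rabs s = 1).
    { assert (s = 1 \/ s = -1) as [-> | ->] by (destruct (Rle_lt_dec 0 s); [left|right]; nra).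
      apply Rabs_R1. rewrite Rabs_left; lra. }
    rewrite E. lra. }
  destruct (Rle_lt_dec x0 x) as [Hx | Hx].
  - assert (M : c / k * exp (k * (x0 - x0)) - s * RInt f x0 x0
       <= c / k * exp (k * (x - x0)) - s * RInt f x0 x).
    { apply (derive_nonneg_le (fun x => c / k * exp (k * (x - x0)) - s * RInt f x0 x)
        (fun x => c * exp (k * (x - x0)) - s * f x)); [lra| |].
      - intros t Ht. apply (is_derive_minus (fun x => c / k * exp (k * (x - x0))) (fun x => s * RInt f x0 x)).
        + auto_derive; [easy|]. unfold Rminus. field. lra.
        + apply is_derive_scal. now apply is_derive_RInt_continuous.
      - intros t Ht. specialize (Hs2 t). rewrite Rabs_pos_eq in Hs2 by lra. lra. }
    rewrite RInt_point in M. unfold zero in M; simpl in M.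
    assert (E := exp_pos (k * (x0 - x0))). rewrite Rabs_pos_eq by lra. nra.
  - assert (M : - (c / k * exp (k * (x0 - x)) - s * RInt f x0 x)
       <= - (c / k * exp (k * (x0 - x0)) - s * RInt f x0 x0)).
    { apply (derive_nonneg_le (fun x => - (c / k * exp (k * (x0 - x)) - s * RInt f x0 x))
        (fun x => - (- (c * exp (k * (x0 - x))) - s * f x))); [lra| |].
      - intros t Ht. apply (is_derive_opp (fun x => c / k * exp (k * (x0 - x)) - s * RInt f x0 x)).
        apply (is_derive_minus (fun x => c / k * exp (k * (x0 - x))) (fun x => s * RInt f x0 x)).
        + auto_derive; [easy|]. unfold Rminus. field. lra.
        + apply is_derive_scal. now apply is_derive_RInt_continuous.
      - intros t Ht. specialize (Hs2 t). rewrite Rabs_left1 in Hs2 by lra.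
        replace (- (t - x0)) with (x0 - t) in Hs2 by ring. lra. }
    rewrite RInt_point in M. unfold zero in M; simpl in M.
    assert (E := exp_pos (k * (x0 - x0))). rewrite Rabs_left by lra.
    replace (- (x - x0)) with (x0 - x) by ring. nra. }
apply Rabs_le.
assert (M1 := Main 1 ltac:(ring)). assert (M2 := Main (-1) ltac:(ring)). lra.
Qed.

Lemma Series_geom_tail (a : nat -> R) (c : R) :
  (forall n, Rabs (a n) <= c * (1 / 2) ^ n) ->
  ex_series a /\ forall n, Rabs (Series a - sum_f_R0 a n) <= c * (1 / 2) ^ n.
Proof.
intros Ha.
assert (Hg : Rabs (1 / 2) < 1) by (rewrite Rabs_pos_eq; lra).
assert (Eg : forall N, ex_series (fun n => c * (1 / 2) ^ (N + n))).
{ intros N. apply (ex_series_ext (fun n => c * (1 / 2) ^ N * (1 / 2) ^ n)).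
  - intros n. rewrite pow_add. simpl. ring.
  - apply (ex_series_scal_l (c * (1 / 2) ^ N) (fun n => (1 / 2) ^ n)). now apply ex_series_geom. }
assert (E : ex_series a).
{ apply (ex_series_le a (fun n => c * (1 / 2) ^ n)); [exact Ha | exact (Eg 0%nat)]. }
split; [exact E|]. intros n.
rewrite (Series_incr_n a (S n)) by (auto with arith; exact E). simpl pred.
replace (sum_f_R0 a n + Series (fun k => a (S n + k)%nat) - sum_f_R0 a n)
  with (Series (fun k => a (S n + k)%nat)) by ring.
assert (L : ex_series (fun k => Rabs (a (S n + k)%nat))).
{ apply (ex_series_le (fun k => Rabs (a (S n + k)%nat)) (fun k => c * (1 / 2) ^ (S n + k))); [|apply Eg].
  intros k. unfold norm; simpl. unfold abs; simpl. rewrite Rabs_Rabsolu. apply Ha. }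
eapply Rle_trans; [now apply Series_Rabs|].
eapply Rle_trans.
{ apply (Series_le _ (fun k => c * (1 / 2) ^ (S n + k))); [|apply Eg].
  intros k; split; [apply Rabs_pos | apply Ha]. }
rewrite (Series_ext _ (fun k => c * (1 / 2) ^ (S n) * (1 / 2) ^ k)) by (intros; rewrite pow_add; ring).
rewrite Series_scal_l, Series_geom by exact Hg. right. simpl. field.
Qed.

Lemma Series_zero : Series (fun _ : nat => 0) = 0.
Proof.
rewrite (Series_ext _ (fun n => 0 * 0)) by (intros; ring).
rewrite (Series_scal_l 0 (fun _ => 0)). ring.
Qed.

(** * Picard iteration *)

Section Picard.

Variables (V1 V2 : R -> R) (M x0 : R).
Hypotheses (C1 : forall x, continuous V1 x) (C2 : forall x, continuous V2 x).
Hypotheses (M1 : forall x, Rabs (V1 x) <= M) (M2 : forall x, Rabs (V2 x) <= M).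

Let I (f : R -> R) (x : R) := RInt f x0 x.
Let F1 (p1 p2 : R -> R) (x : R) := V1 x * p1 x - V2 x * p2 x.
Let F2 (p1 p2 : R -> R) (x : R) := V2 x * p1 x + V1 x * p2 x.

(** The terms of a series for the derivative [v]; their integrals are the terms for [u]. This solves
    [v' = V u], [u = I v], with initial slope 1, the pair carrying real and imaginary parts. *)
Fixpoint picard (n : nat) : (R -> R) * (R -> R) :=
  match n with
  | O => (fun _ => 1, fun _ => 0)
  | S n => let s := picard n in
      (I (F1 (I (fst s)) (I (snd s))), I (F2 (I (fst s)) (I (snd s))))
  end.

Let s1 n := fst (picard n).
Let s2 n := snd (picard n).
Let p1 n := I (s1 n).
Let p2 n := I (s2 n).
(** Two potential terms bounded by [M] give the contraction factor [2 M / k <= 1/2]; and [k >= 1]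
    lets a plain integration keep the bound [g n]. *)
Let k := 1 + 4 * M.
Let g n x := (1 / 2) ^ n * exp (k * Rabs (x - x0)).

Lemma M_nonneg : 0 <= M.
Proof. eapply Rle_trans; [apply Rabs_pos | apply (M1 0)]. Qed.

Lemma continuous_I (f : R -> R) : (forall x, continuous f x) -> forall x, continuous (I f) x.
Proof.
intros Hf x. apply (ex_derive_continuous (I f)). eexists. now apply is_derive_RInt_continuous.
Qed.

Lemma continuous_F1 (q1 q2 : R -> R) : (forall x, continuous q1 x) -> (forall x, continuous q2 x) ->
  forall x, continuous (F1 q1 q2) x.
Proof.
intros H1 H2 x. apply (continuous_minus (fun x => V1 x * q1 x) (fun x => V2 x * q2 x));
  [apply (continuous_mult V1 q1) | apply (continuous_mult V2 q2)]; auto.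
Qed.

Lemma continuous_F2 (q1 q2 : R -> R) : (forall x, continuous q1 x) -> (forall x, continuous q2 x) ->
  forall x, continuous (F2 q1 q2) x.
Proof.
intros H1 H2 x. apply (continuous_plus (fun x => V2 x * q1 x) (fun x => V1 x * q2 x));
  [apply (continuous_mult V2 q1) | apply (continuous_mult V1 q2)]; auto.
Qed.

Lemma picard_continuous (n : nat) :
  (forall x, continuous (s1 n) x) /\ (forall x, continuous (s2 n) x).
Proof.
induction n as [|n [IH1 IH2]].
- split; intros x; apply continuous_const.
- split; intros x; [apply (continuous_I (F1 (p1 n) (p2 n))), continuous_F1
    | apply (continuous_I (F2 (p1 n) (p2 n))), continuous_F2]; intros; now apply continuous_I.
Qed.

Lemma I_bound (f : R -> R) (n : nat) : (forall x, continuous f x) ->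
  (forall x, Rabs (f x) <= g n x) -> forall x, Rabs (I f x) <= g n x.
Proof.
intros Hf Hb x. assert (M0 := M_nonneg).
eapply Rle_trans; [apply (RInt_exp_weight f x0 ((1/2) ^ n) k); auto; [unfold k; lra | apply pow_le; lra]|].
apply Rmult_le_compat_r; [left; apply exp_pos|].
assert (0 <= (1 / 2) ^ n) by (apply pow_le; lra).
rewrite <- (Rdiv_1_r ((1 / 2) ^ n)) at 2.
apply Rmult_le_compat_l; [lra|]. apply Rinv_le_contravar; unfold k; lra.
Qed.

Lemma F_bound (q1 q2 : R -> R) (n : nat) :
  (forall x, Rabs (q1 x) <= g n x) -> (forall x, Rabs (q2 x) <= g n x) ->
  forall x, Rabs (F1 q1 q2 x) <= 2 * M * (1 / 2) ^ n * exp (k * Rabs (x - x0)) /\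
    Rabs (F2 q1 q2 x) <= 2 * M * (1 / 2) ^ n * exp (k * Rabs (x - x0)).
Proof.
intros H1 H2 x. specialize (H1 x). specialize (H2 x). specialize (M1 x). specialize (M2 x).
assert (P : forall a b, Rabs a <= M -> Rabs b <= g n x -> Rabs (a * b) <= M * g n x).
{ intros a b Ha Hb. rewrite Rabs_mult. apply Rmult_le_compat; auto using Rabs_pos. }
unfold F1, F2. replace (2 * M * (1 / 2) ^ n * exp (k * Rabs (x - x0))) with (M * g n x + M * g n x)
  by (unfold g; ring).
split.
- eapply Rle_trans; [apply Rabs_triang|]. rewrite Rabs_Ropp. apply Rplus_le_compat; apply P; auto.
- eapply Rle_trans; [apply Rabs_triang|]. apply Rplus_le_compat; apply P; auto.
Qed.

Lemma picard_bound (n : nat) :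
  (forall x, Rabs (s1 n x) <= g n x) /\ (forall x, Rabs (s2 n x) <= g n x).
Proof.
assert (M0 := M_nonneg).
induction n as [|n [IH1 IH2]].
- assert (E : forall x, 1 <= g 0 x).
  { intros x. unfold g. simpl. rewrite Rmult_1_l, <- exp_0. apply exp_le.
    apply Rmult_le_pos; [unfold k; lra | apply Rabs_pos]. }
  split; intros x; specialize (E x); simpl; rewrite ?Rabs_R1, ?Rabs_R0; unfold s1, s2; simpl;
    rewrite ?Rabs_R1, ?Rabs_R0; lra.
- destruct (picard_continuous n) as [K1 K2].
  assert (B := F_bound (p1 n) (p2 n) n (I_bound (s1 n) n K1 IH1) (I_bound (s2 n) n K2 IH2)).
  assert (S : forall f, (forall x, continuous f x) ->
    (forall x, Rabs (f x) <= 2 * M * (1 / 2) ^ n * exp (k * Rabs (x - x0))) ->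
    forall x, Rabs (I f x) <= g (S n) x).
  { intros f Hf Hb x.
    assert (P0 : 0 <= (1 / 2) ^ n) by (apply pow_le; lra).
    eapply Rle_trans; [apply (RInt_exp_weight f x0 (2 * M * (1/2) ^ n) k); auto; [unfold k; lra | nra]|].
    apply Rmult_le_compat_r; [left; apply exp_pos|].
    apply Rmult_le_reg_r with k; [unfold k; lra|].
    replace (2 * M * (1 / 2) ^ n / k * k) with (2 * M * (1 / 2) ^ n) by (field; unfold k; lra).
    simpl. unfold k. nra. }
  split; intros x; [apply (S (F1 (p1 n) (p2 n))) | apply (S (F2 (p1 n) (p2 n)))];
    try (intros; apply B); intros; [apply continuous_F1 | apply continuous_F2];
    intros; now apply continuous_I.
Qed.

Let U1 x := Series (fun n => p1 n x).
Let U2 x := Series (fun n => p2 n x).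
Let W1 x := Series (fun n => s1 n x).
Let W2 x := Series (fun n => s2 n x).

Lemma tail_bound (q : nat -> R -> R) : (forall n x, Rabs (q n x) <= g n x) ->
  forall n x, Rabs (Series (fun n => q n x) - sum_f_R0 (fun n => q n x) n) <= g n x.
Proof.
intros Hq n x. unfold g. rewrite Rmult_comm.
apply (Series_geom_tail (fun n => q n x)). intros m. rewrite Rmult_comm. apply Hq.
Qed.

Lemma g_small (eps : R) (d : R) : 0 < eps -> exists N, forall n x,
  (N <= n)%nat -> Rabs (x - x0) <= d -> g n x < eps.
Proof.
intros He. assert (M0 := M_nonneg).
assert (E := exp_pos (k * d)).
destruct (pow_lt_1_zero (1 / 2) ltac:(rewrite Rabs_pos_eq; lra) (eps / exp (k * d))
  ltac:(apply Rdiv_lt_0_compat; lra)) as [N HN].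
exists N. intros n x Hn Hx. specialize (HN n Hn).
rewrite Rabs_pos_eq in HN by (apply pow_le; lra).
unfold g. apply Rle_lt_trans with ((1 / 2) ^ n * exp (k * d)).
- apply Rmult_le_compat_l; [apply pow_le; lra|]. apply exp_le. apply Rmult_le_compat_l; [unfold k; lra|exact Hx].
- apply Rlt_le_trans with (eps / exp (k * d) * exp (k * d)); [apply Rmult_lt_compat_r; lra|].
  right. field. lra.
Qed.

(** [g n] tends to 0 uniformly on bounded sets, so near each point functions and derivatives both
    converge uniformly. *)
Lemma series_derive (q dq : nat -> R -> R) (f df : R -> R) (a : R) :
  0 <= a ->
  (forall n x, is_derive (q n) x (dq n x)) ->
  (forall n x, Rabs (f x - q n x) <= a * g n x) ->
  (forall n x, Rabs (df x - dq n x) <= a * g n x) ->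
  forall x, is_derive f x (df x).
Proof.
intros Ha Hd Hf Hdf x. apply is_derive_Reals.
set (d := Rabs (x - x0) + 1).
assert (Small : forall eps, 0 < eps -> exists N, forall n y,
  (N <= n)%nat -> Rabs (y - x0) <= d -> a * g n y < eps).
{ intros eps He. destruct (g_small (eps / (a + 1)) d) as [N HN]; [apply Rdiv_lt_0_compat; lra|].
  exists N. intros n y Hn Hy. specialize (HN n y Hn Hy).
  assert (0 <= g n y) by (apply Rmult_le_pos; [apply pow_le; lra | left; apply exp_pos]).
  apply Rle_lt_trans with ((a + 1) * g n y); [nra|].
  apply Rlt_le_trans with ((a + 1) * (eps / (a + 1))); [apply Rmult_lt_compat_l; lra | right; field; lra]. }
assert (B : forall y, Boule x (mkposreal 1 Rlt_0_1) y -> Rabs (y - x0) <= d).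
{ intros y Hy. unfold Boule in Hy. simpl in Hy. unfold d.
  replace (y - x0) with ((y - x) + (x - x0)) by ring.
  eapply Rle_trans; [apply Rabs_triang|]. lra. }
apply (CVU_derivable q dq f df x (mkposreal 1 Rlt_0_1)).
- intros eps He. destruct (Small eps He) as [N HN]. exists N. intros n y Hn Hy.
  eapply Rle_lt_trans; [apply Hdf|]. apply HN; auto.
- intros y Hy eps He. destruct (Small eps He) as [N HN]. exists N. intros n Hn.
  unfold Rdist. rewrite Rabs_minus_sym. eapply Rle_lt_trans; [apply Hf|]. apply HN; auto.
- intros n y _. apply is_derive_Reals, Hd.
- unfold Boule. simpl. rewrite Rminus_diag, Rabs_R0. lra.
Qed.

Lemma is_derive_sum_f_R0 (q dq : nat -> R -> R) (x : R) (n : nat) :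
  (forall n, is_derive (q n) x (dq n x)) ->
  is_derive (fun x => sum_f_R0 (fun n => q n x) n) x (sum_f_R0 (fun n => dq n x) n).
Proof.
intros H. induction n as [|n IH]; simpl; [apply H|].
apply (is_derive_plus (fun x => sum_f_R0 (fun n => q n x) n) (q (S n))); auto.
Qed.

Theorem linear_ode : exists u1 u2 v1 v2 : R -> R, solution V1 V2 u1 u2 v1 v2 /\
  u1 x0 = 0 /\ u2 x0 = 0 /\ v1 x0 = 1 /\ v2 x0 = 0.
Proof.
assert (Bs1 : forall n x, Rabs (s1 n x) <= g n x) by (intros; apply picard_bound).
assert (Bs2 : forall n x, Rabs (s2 n x) <= g n x) by (intros; apply picard_bound).
assert (Bp1 : forall n x, Rabs (p1 n x) <= g n x)
  by (intros; apply I_bound; [apply picard_continuous | apply Bs1]).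
assert (Bp2 : forall n x, Rabs (p2 n x) <= g n x)
  by (intros; apply I_bound; [apply picard_continuous | apply Bs2]).
assert (Cp1 : forall n x, continuous (p1 n) x) by (intros; apply continuous_I, picard_continuous).
assert (Cp2 : forall n x, continuous (p2 n) x) by (intros; apply continuous_I, picard_continuous).
assert (M0 := M_nonneg).
assert (gS : forall n x, g (S n) x <= (1 + 2 * M) * g n x).
{ intros n x. assert (0 <= g n x) by (apply Rmult_le_pos; [apply pow_le; lra | left; apply exp_pos]).
  replace (g (S n) x) with (1 / 2 * g n x) by (unfold g; simpl; ring). nra. }
assert (g0 : forall n x, 0 <= g n x) by (intros; apply Rmult_le_pos; [apply pow_le; lra | left; apply exp_pos]).
exists U1, U2, W1, W2. split; [|split; [|split; [|split]]].
- intros y. split; [|split; [|split]].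
  + apply (series_derive (fun n x => sum_f_R0 (fun n => p1 n x) n)
      (fun n x => sum_f_R0 (fun n => s1 n x) n) U1 W1 1); try lra.
    * intros n x. apply is_derive_sum_f_R0. intros j. apply is_derive_RInt_continuous, picard_continuous.
    * intros n x. rewrite Rmult_1_l. now apply tail_bound.
    * intros n x. rewrite Rmult_1_l. now apply tail_bound.
  + apply (series_derive (fun n x => sum_f_R0 (fun n => p2 n x) n)
      (fun n x => sum_f_R0 (fun n => s2 n x) n) U2 W2 1); try lra.
    * intros n x. apply is_derive_sum_f_R0. intros j. apply is_derive_RInt_continuous, picard_continuous.
    * intros n x. rewrite Rmult_1_l. now apply tail_bound.
    * intros n x. rewrite Rmult_1_l. now apply tail_bound.
  (* The sums are shifted by one: the sum of the [s] terms up to [S n] differentiates to the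
     potential applied to the sum of the [p] terms up to [n]. The factor [1 + 2 * M] covers both
     errors. *)
  + apply (series_derive (fun n x => sum_f_R0 (fun n => s1 n x) (S n))
      (fun n x => V1 x * sum_f_R0 (fun n => p1 n x) n - V2 x * sum_f_R0 (fun n => p2 n x) n)
      W1 (fun y => V1 y * U1 y - V2 y * U2 y) (1 + 2 * M)); try lra.
    * intros n x. evar_last.
      -- apply (is_derive_sum_f_R0 s1 (fun n => match n with O => fun _ => 0 | S n => F1 (p1 n) (p2 n) end)).
         intros [|j]; [apply (is_derive_const 1)|].
         apply (is_derive_RInt_continuous (F1 (p1 j) (p2 j))), continuous_F1; auto.
      -- induction n as [|n IH]; [simpl; unfold F1; ring|].
         rewrite tech5, IH. simpl sum_f_R0. unfold F1. ring.
    * intros n x. eapply Rle_trans; [now apply tail_bound | apply gS].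
    * intros n x.
      replace (V1 x * U1 x - V2 x * U2 x - (V1 x * sum_f_R0 (fun n => p1 n x) n - V2 x * sum_f_R0 (fun n => p2 n x) n))
        with (V1 x * (U1 x - sum_f_R0 (fun n => p1 n x) n) + - (V2 x * (U2 x - sum_f_R0 (fun n => p2 n x) n))) by ring.
      assert (T1 := tail_bound p1 Bp1 n x). assert (T2 := tail_bound p2 Bp2 n x).
      eapply Rle_trans; [apply Rabs_triang|]. rewrite Rabs_Ropp, !Rabs_mult.
      assert (Rabs (V1 x) * Rabs (U1 x - sum_f_R0 (fun n => p1 n x) n) <= M * g n x)
        by (apply Rmult_le_compat; auto using Rabs_pos).
      assert (Rabs (V2 x) * Rabs (U2 x - sum_f_R0 (fun n => p2 n x) n) <= M * g n x)
        by (apply Rmult_le_compat; auto using Rabs_pos).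
      specialize (g0 n x). lra.
  + apply (series_derive (fun n x => sum_f_R0 (fun n => s2 n x) (S n))
      (fun n x => V2 x * sum_f_R0 (fun n => p1 n x) n + V1 x * sum_f_R0 (fun n => p2 n x) n)
      W2 (fun y => V2 y * U1 y + V1 y * U2 y) (1 + 2 * M)); try lra.
    * intros n x. evar_last.
      -- apply (is_derive_sum_f_R0 s2 (fun n => match n with O => fun _ => 0 | S n => F2 (p1 n) (p2 n) end)).
         intros [|j]; [apply (is_derive_const 0)|].
         apply (is_derive_RInt_continuous (F2 (p1 j) (p2 j))), continuous_F2; auto.
      -- induction n as [|n IH]; [simpl; unfold F2; ring|].
         rewrite tech5, IH. simpl sum_f_R0. unfold F2. ring.
    * intros n x. eapply Rle_trans; [now apply tail_bound | apply gS].
    * intros n x.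
      replace (V2 x * U1 x + V1 x * U2 x - (V2 x * sum_f_R0 (fun n => p1 n x) n + V1 x * sum_f_R0 (fun n => p2 n x) n))
        with (V2 x * (U1 x - sum_f_R0 (fun n => p1 n x) n) + V1 x * (U2 x - sum_f_R0 (fun n => p2 n x) n)) by ring.
      assert (T1 := tail_bound p1 Bp1 n x). assert (T2 := tail_bound p2 Bp2 n x).
      eapply Rle_trans; [apply Rabs_triang|]. rewrite !Rabs_mult.
      assert (Rabs (V2 x) * Rabs (U1 x - sum_f_R0 (fun n => p1 n x) n) <= M * g n x)
        by (apply Rmult_le_compat; auto using Rabs_pos).
      assert (Rabs (V1 x) * Rabs (U2 x - sum_f_R0 (fun n => p2 n x) n) <= M * g n x)
        by (apply Rmult_le_compat; auto using Rabs_pos).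
      specialize (g0 n x). lra.
- unfold U1. rewrite (Series_ext _ (fun _ => 0)); [apply Series_zero|].
  intros n. unfold p1, I. now rewrite RInt_point.
- unfold U2. rewrite (Series_ext _ (fun _ => 0)); [apply Series_zero|].
  intros n. unfold p2, I. now rewrite RInt_point.
- unfold W1. rewrite Series_incr_1 by (apply (Series_geom_tail (fun n => s1 n x0) (exp (k * Rabs (x0 - x0)))); intros; rewrite Rmult_comm; apply Bs1).
  rewrite (Series_ext _ (fun _ => 0)).
  + rewrite Series_zero. unfold s1; simpl. ring.
  + intros n. unfold s1; simpl. unfold I. now rewrite RInt_point.
- unfold W2. rewrite Series_incr_1 by (apply (Series_geom_tail (fun n => s2 n x0) (exp (k * Rabs (x0 - x0)))); intros; rewrite Rmult_comm; apply Bs2).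
  rewrite (Series_ext _ (fun _ => 0)).
  + rewrite Series_zero. unfold s2; simpl. ring.
  + intros n. unfold s2; simpl. unfold I. now rewrite RInt_point.
Qed.

End Picard.

(** * Weak solutions *)

(** [ring] on an equation between reals typed as elements of a Coquelicot structure on [R]. *)
Ltac ring_real := match goal with |- @eq _ ?a ?b => change (@eq R a b); ring end.

(** Derivatives are given as explicit functions on the whole line rather than through [Derive_n], so
    that closure under sums, products and affine changes of variable is a plain induction. *)
Fixpoint differentiable_n (n : nat) (f : R -> R) : Prop :=
  match n with
  | O => True
  | S n => exists f', (forall x, is_derive f x (f' x)) /\ differentiable_n n f'
  end.

Lemma differentiable_n_pred (n : nat) : forall f, differentiable_n (S n) f -> differentiable_n n f.
Proof.
induction n as [|n IH]; intros f; [easy|].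
intros (f' & Hf & H). exists f'. split; [exact Hf|]. now apply IH.
Qed.

Lemma differentiable_n_plus (n : nat) : forall f g, differentiable_n n f -> differentiable_n n g -> differentiable_n n (fun x => f x + g x).
Proof.
induction n as [|n IH]; intros f g; [easy|].
intros (f' & Hf & H) (g' & Hg & H'). exists (fun x => f' x + g' x). split; [|now apply IH].
intros x. now apply (is_derive_plus f g).
Qed.

Lemma differentiable_n_scal (n : nat) (c : R) : forall f, differentiable_n n f -> differentiable_n n (fun x => c * f x).
Proof.
induction n as [|n IH]; intros f; [easy|].
intros (f' & Hf & H). exists (fun x => c * f' x). split; [|now apply IH].
intros x. now apply is_derive_scal.
Qed.

Lemma differentiable_n_mult (n : nat) : forall f g, differentiable_n n f -> differentiable_n n g -> differentiable_n n (fun x => f x * g x).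
Proof.
induction n as [|n IH]; intros f g; [easy|].
intros Hf Hg. assert (Hf0 := differentiable_n_pred _ _ Hf). assert (Hg0 := differentiable_n_pred _ _ Hg).
destruct Hf as (f' & Hf & H), Hg as (g' & Hg & H').
exists (fun x => f' x * g x + f x * g' x). split.
- intros x. now apply is_derive_Rmult.
- apply (differentiable_n_plus n (fun x => f' x * g x) (fun x => f x * g' x)); now apply IH.
Qed.

Lemma is_derive_affine (f : R -> R) (a b x l : R) :
  is_derive f (a * x + b) l -> is_derive (fun x => f (a * x + b)) x (a * l).
Proof.
intros Hf. apply (is_derive_comp f (fun x => a * x + b)); [exact Hf|].
auto_derive; [easy|ring].
Qed.

Lemma differentiable_n_affine (n : nat) (a b : R) : forall f, differentiable_n n f -> differentiable_n n (fun x => f (a * x + b)).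
Proof.
induction n as [|n IH]; intros f; [easy|].
intros (f' & Hf & H). exists (fun x => a * f' (a * x + b)). split.
- intros x. now apply is_derive_affine.
- apply (differentiable_n_scal n a (fun x => f' (a * x + b))). now apply IH.
Qed.

Lemma differentiable_n_ex_derive_n (n : nat) : forall f, differentiable_n n f -> forall x, ex_derive_n f n x.
Proof.
induction n as [|n IH]; intros f; [easy|].
intros (f' & Hf & H) x.
assert (E : forall j y, Derive_n f (S j) y = Derive_n f' j y).
{ intros j y. rewrite <- Nat.add_1_r, <- (Derive_n_comp f j 1). apply Derive_n_ext.
  intros t. simpl. now apply is_derive_unique. }
destruct n as [|n].
- exists (f' x). apply Hf.
- specialize (IH f' H x). simpl in IH |- *.
  eapply ex_derive_ext; [|exact IH]. intros t. symmetry. apply (E n t).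
Qed.

(** * A smooth bump and the ramp built from it *)

Lemma pow_le_exp (n : nat) : forall y, 0 <= y -> y ^ n <= INR (fact n) * exp y.
Proof.
induction n as [|n IH]; intros y Hy.
- simpl. rewrite Rmult_1_l, <- exp_0. now apply exp_le.
- assert (M : INR (fact (S n)) * exp 0 - 0 ^ S n <= INR (fact (S n)) * exp y - y ^ S n).
  { apply (derive_nonneg_le (fun y => INR (fact (S n)) * exp y - y ^ S n)
      (fun y => INR (fact (S n)) * exp y - INR (S n) * y ^ n)); [lra| |].
    - intros t Ht. apply (is_derive_minus (fun y => INR (fact (S n)) * exp y) (fun y => y ^ S n)).
      + apply is_derive_scal, is_derive_exp.
      + evar_last; [apply (is_derive_pow (fun y => y) (S n) t 1), (is_derive_id t)|].
        cbv beta. change (pred (S n)) with n. rewrite Rmult_1_r. reflexivity.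
    - intros t Ht. specialize (IH t ltac:(lra)).
      replace (INR (fact (S n))) with (INR (S n) * INR (fact n)) by (rewrite <- mult_INR; reflexivity).
      assert (0 <= INR (S n)) by apply pos_INR. nra. }
  rewrite exp_0 in M. assert (0 <= INR (fact (S n))) by apply pos_INR.
  replace (0 ^ S n) with 0 in M by (simpl; ring). lra.
Qed.

(** The powers in front of the classical flat function make the family closed under linear
    combinations of derivatives: one induction, over all [k] at once, gives smoothness. *)
Definition flat (k : nat) (x : R) : R :=
  if Rle_dec x 0 then 0 else / x ^ k * exp (- / x).

Lemma flat_neg (k : nat) (x : R) : x <= 0 -> flat k x = 0.
Proof. intros H. unfold flat. now destruct (Rle_dec x 0). Qed.

Lemma flat_pos_eq (k : nat) (x : R) : 0 < x -> flat k x = / x ^ k * exp (- / x).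
Proof. intros H. unfold flat. destruct (Rle_dec x 0); [lra|easy]. Qed.

(** This is [pow_le_exp] at [1 / x] with exponent [k + 2]; the surplus 2 makes the derivative at 0
    vanish. *)
Lemma flat_bound (k : nat) (x : R) : Rabs (flat k x) <= INR (fact (k + 2)) * x ^ 2.
Proof.
assert (F0 : 0 <= INR (fact (k + 2))) by apply pos_INR.
destruct (Rle_lt_dec x 0) as [H | H].
- rewrite flat_neg, Rabs_R0 by easy. apply Rmult_le_pos; nra.
- rewrite flat_pos_eq by easy.
  assert (X := pow_le_exp (k + 2) (/ x) ltac:(left; now apply Rinv_0_lt_compat)).
  assert (P : 0 < x ^ k) by now apply pow_lt.
  assert (E := exp_pos (- / x)).
  rewrite Rabs_pos_eq by (apply Rmult_le_pos; [left; now apply Rinv_0_lt_compat | lra]).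
  apply Rmult_le_reg_r with (exp (/ x) * / x ^ 2).
  { apply Rmult_lt_0_compat; [apply exp_pos | apply Rinv_0_lt_compat; nra]. }
  replace (/ x ^ k * exp (- / x) * (exp (/ x) * / x ^ 2)) with ((/ x) ^ (k + 2)).
  + replace (INR (fact (k + 2)) * x ^ 2 * (exp (/ x) * / x ^ 2)) with (INR (fact (k + 2)) * exp (/ x))
      by (field; lra). exact X.
  + rewrite exp_Ropp, pow_inv, pow_add. field. split; [lra|]. split; [|lra].
    apply Rgt_not_eq, exp_pos.
Qed.

Lemma flat_derive (k : nat) (x : R) :
  is_derive (flat k) x (flat (k + 2) x - INR k * flat (k + 1) x).
Proof.
destruct (Rtotal_order x 0) as [H | [-> | H]].
- rewrite !flat_neg by lra. replace (0 - INR k * 0) with 0 by ring.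
  apply (is_derive_ext_loc (fun _ => 0)); [|apply (is_derive_const 0)].
  apply (locally_interval _ x m_infty 0); simpl; auto. intros y _ Hy. now rewrite flat_neg by lra.
- rewrite !flat_neg by lra. replace (0 - INR k * 0) with 0 by ring.
  apply is_derive_Reals. intros eps He.
  assert (F0 : 0 <= INR (fact (k + 2))) by apply pos_INR.
  assert (D0 : 0 < eps / (INR (fact (k + 2)) + 1)) by (apply Rdiv_lt_0_compat; lra).
  exists (mkposreal _ D0). simpl. intros h Hh Hd.
  rewrite (flat_neg k 0), Rplus_0_l, !Rminus_0_r by lra.
  unfold Rdiv. rewrite Rabs_mult, Rabs_inv.
  assert (h0 : 0 < Rabs h) by now apply Rabs_pos_lt.
  apply Rle_lt_trans with (INR (fact (k + 2)) * h ^ 2 * / Rabs h).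
  { apply Rmult_le_compat_r; [left; now apply Rinv_0_lt_compat | apply flat_bound]. }
  rewrite <- (pow2_abs h).
  replace (INR (fact (k + 2)) * Rabs h ^ 2 * / Rabs h) with (INR (fact (k + 2)) * Rabs h) by (field; lra).
  apply Rle_lt_trans with ((INR (fact (k + 2)) + 1) * Rabs h); [nra|].
  apply Rlt_le_trans with ((INR (fact (k + 2)) + 1) * (eps / (INR (fact (k + 2)) + 1)));
    [apply Rmult_lt_compat_l; lra | right; field; lra].
- rewrite !flat_pos_eq by lra.
  apply (is_derive_ext_loc (fun x => / x ^ k * exp (- / x))).
  { apply (locally_interval _ x 0 p_infty); simpl; auto. intros y Hy _. now rewrite flat_pos_eq by lra. }
  assert (P : 0 < x ^ k) by now apply pow_lt.
  auto_derive; [repeat split; lra|].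
  rewrite !pow_add. destruct k as [|k].
  + simpl. field. lra.
  + change (pred (S k)) with k. rewrite <- !tech_pow_Rmult. simpl in P.
    assert (0 < x ^ k) by now apply pow_lt. field. split; lra.
Qed.

Lemma flat_differentiable_n (n : nat) : forall k, differentiable_n n (flat k).
Proof.
induction n as [|n IH]; intros k; [easy|].
exists (fun x => flat (k + 2) x + - INR k * flat (k + 1) x). split.
- intros x. replace (flat (k + 2) x + - INR k * flat (k + 1) x)
    with (flat (k + 2) x - INR k * flat (k + 1) x) by ring. apply flat_derive.
- apply (differentiable_n_plus n (flat (k + 2)) (fun x => - INR k * flat (k + 1) x)); [apply IH | apply differentiable_n_scal, IH].
Qed.

Definition bump (x : R) : R := flat 0 (1 * x + 1) * flat 0 (-1 * x + 1).

Lemma bump_differentiable_n (n : nat) : differentiable_n n bump.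
Proof. apply differentiable_n_mult; apply differentiable_n_affine, flat_differentiable_n. Qed.

Lemma flat_nonneg (x : R) : 0 <= flat 0 x.
Proof.
destruct (Rle_lt_dec x 0); [rewrite flat_neg; lra|].
rewrite flat_pos_eq by easy. simpl. rewrite Rinv_1, Rmult_1_l. left; apply exp_pos.
Qed.

Lemma flat_pos (x : R) : 0 < x -> 0 < flat 0 x.
Proof. intros. rewrite flat_pos_eq by easy. simpl. rewrite Rinv_1, Rmult_1_l. apply exp_pos. Qed.

Lemma bump_nonneg (x : R) : 0 <= bump x.
Proof. apply Rmult_le_pos; apply flat_nonneg. Qed.

Lemma bump_out (x : R) : x <= -1 \/ 1 <= x -> bump x = 0.
Proof.
unfold bump. intros [H | H].
- rewrite (flat_neg 0 (1 * x + 1)) by lra. ring.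
- rewrite (flat_neg 0 (-1 * x + 1)) by lra. ring.
Qed.

Lemma differentiable_1_continuous (f : R -> R) : differentiable_n 1 f -> forall x, continuous f x.
Proof. intros (f' & Hf & _) x. apply (ex_derive_continuous f). exists (f' x). apply Hf. Qed.

Lemma bump_continuous (x : R) : continuous bump x.
Proof. apply differentiable_1_continuous, (bump_differentiable_n 1). Qed.

Lemma ex_RInt_cont (f : R -> R) (a b : R) : (forall x, continuous f x) -> ex_RInt f a b.
Proof. intros H. apply (ex_RInt_continuous (V := R_CompleteNormedModule)). intros; apply H. Qed.

Lemma RInt_zero (f : R -> R) (a b : R) :
  (forall x, Rmin a b <= x <= Rmax a b -> f x = 0) -> RInt f a b = 0.
Proof.
intros H. rewrite (RInt_ext f (fun _ => 0)) by (intros; apply H; lra).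
rewrite RInt_const. unfold scal; simpl; unfold mult; simpl. ring.
Qed.

(** A smoothed positive part: the double primitive of a bump of mass 1, rescaled to width [d]. The
    outer factor [d] keeps the slope 1 on the right. *)
Lemma smooth_ramp (d : R) : 0 < d -> exists (r r1 r2 : R -> R) (c : R),
  (forall n, differentiable_n n r) /\ (forall x, is_derive r x (r1 x)) /\
  (forall x, is_derive r1 x (r2 x)) /\ (forall x, continuous r2 x) /\
  (forall x, 0 <= r2 x) /\ (forall x, x <= - d -> r x = 0 /\ r1 x = 0 /\ r2 x = 0) /\
  (forall x, d <= x -> r x = x + c /\ r1 x = 1 /\ r2 x = 0).
Proof.
intros Hd.
set (J := RInt bump (-1) 1).
assert (J0 : 0 < J).
{ apply RInt_gt_0; [lra| |intros; apply bump_continuous].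
  intros x Hx. apply Rmult_lt_0_compat; apply flat_pos; lra. }
set (q2 := fun x => / J * bump x).
assert (Dq2 : forall n, differentiable_n n q2) by (intros n; apply differentiable_n_scal, bump_differentiable_n).
assert (Cq2 : forall x, continuous q2 x) by apply differentiable_1_continuous, (Dq2 1%nat).
set (q1 := RInt q2 (-1)).
assert (dq1 : forall x, is_derive q1 x (q2 x)) by (intros; now apply is_derive_RInt_continuous).
assert (Cq1 : forall x, continuous q1 x) by (intros x; apply (ex_derive_continuous q1); eexists; apply dq1).
set (q := RInt q1 (-1)).
assert (dq : forall x, is_derive q x (q1 x)) by (intros; now apply is_derive_RInt_continuous).
assert (q2out : forall x, x <= -1 \/ 1 <= x -> q2 x = 0) by (intros x Hx; unfold q2; rewrite bump_out by easy; ring).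
assert (q1l : forall x, x <= -1 -> q1 x = 0).
{ intros x Hx. apply RInt_zero. intros y. rewrite Rmin_right, Rmax_left by lra. intros; apply q2out; lra. }
assert (q1r : forall x, 1 <= x -> q1 x = 1).
{ intros x Hx. unfold q1. rewrite <- (RInt_Chasles q2 (-1) 1 x) by now apply ex_RInt_cont.
  rewrite (RInt_zero q2 1 x) by (intros y; rewrite Rmin_left, Rmax_right by lra; intros; apply q2out; lra).
  assert (E : RInt q2 (-1) 1 = / J * J)
    by exact (RInt_scal bump (-1) 1 (/ J) (ex_RInt_cont bump (-1) 1 bump_continuous)).
  rewrite E. unfold plus; simpl. field. lra. }
assert (ql : forall x, x <= -1 -> q x = 0).
{ intros x Hx. apply RInt_zero. intros y. rewrite Rmin_right, Rmax_left by lra. intros; apply q1l; lra. }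
assert (qr : forall x, 1 <= x -> q x = x + (q 1 - 1)).
{ intros x Hx. unfold q at 1. rewrite <- (RInt_Chasles q1 (-1) 1 x) by now apply ex_RInt_cont.
  rewrite (RInt_ext q1 (fun _ => 1) 1 x).
  - rewrite RInt_const. fold (q 1). unfold plus, scal; simpl; unfold mult; simpl. ring.
  - rewrite Rmin_left, Rmax_right by lra. intros; apply q1r; lra. }
exists (fun x => d * q (/ d * x + 0)), (fun x => q1 (/ d * x + 0)), (fun x => / d * q2 (/ d * x + 0)), (d * (q 1 - 1)).
assert (id0 : 0 < / d) by now apply Rinv_0_lt_compat.
split; [|split; [|split; [|split; [|split; [|split]]]]].
- intros n. apply (differentiable_n_scal n d (fun x => q (/ d * x + 0))), differentiable_n_affine.
  destruct n as [|[|n]]; [easy|exists q1; easy|]. exists q1. split; [exact dq|]. exists q2. split; [exact dq1|apply Dq2].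
- intros x. replace (q1 (/ d * x + 0)) with (d * (/ d * q1 (/ d * x + 0))) by (field; lra).
  apply is_derive_scal, is_derive_affine, dq.
- intros x. apply is_derive_affine, dq1.
- apply differentiable_1_continuous, (differentiable_n_scal 1 (/ d) (fun x => q2 (/ d * x + 0))), differentiable_n_affine, Dq2.
- intros x. apply Rmult_le_pos; [lra|]. apply Rmult_le_pos; [left; now apply Rinv_0_lt_compat | apply bump_nonneg].
- intros x Hx.
  assert (/ d * x <= -1) by (apply Rmult_le_reg_l with d; [lra|]; rewrite <- Rmult_assoc, Rinv_r; lra).
  rewrite ql, q1l, q2out by lra. rewrite !Rmult_0_r. easy.
- intros x Hx.
  assert (1 <= / d * x) by (apply Rmult_le_reg_l with d; [lra|]; rewrite <- Rmult_assoc, Rinv_r; lra).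
  rewrite qr, q1r, q2out by lra. split; [field; lra|]. split; [easy|apply Rmult_0_r].
Qed.

(** * From distributional to classical second derivatives *)

Definition second_derive_test (phi phi1 phi2 : R -> R) : Prop :=
  (forall x, is_derive phi x (phi1 x)) /\ (forall x, is_derive phi1 x (phi2 x)) /\
  (forall x, continuous phi2 x) /\ test_function phi.

(** The shifted [r2] is nonnegative, has integral [r1 (1 - a) - r1 (- a) = 1] over [[0, 1]] and
    vanishes where [|x - a| > d]; the difference is thus an average of [H - H a] near [a]. *)
Lemma RInt_mollifier (H r1 r2 : R -> R) (a d eta : R) :
  0 <= eta -> 0 < d -> d < a -> a < 1 - d -> (forall x, continuous H x) ->
  (forall x, is_derive r1 x (r2 x)) -> (forall x, continuous r2 x) -> (forall x, 0 <= r2 x) ->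
  (forall x, x <= - d -> r1 x = 0 /\ r2 x = 0) -> (forall x, d <= x -> r1 x = 1 /\ r2 x = 0) ->
  (forall x, Rabs (x - a) <= d -> Rabs (H x - H a) <= eta) ->
  Rabs (RInt (fun x => H x * r2 (1 * x + - a)) 0 1 - H a) <= eta.
Proof.
intros He Hd Ha1 Ha2 CH Dr1 Cr2 Pos L0 R0 Hc.
set (k := fun x => r2 (1 * x + - a)).
assert (Dk : forall x, is_derive (fun x => r1 (1 * x + - a)) x (k x)).
{ intros x. unfold k. rewrite <- (Rmult_1_l (r2 _)). apply is_derive_affine, Dr1. }
assert (Ck : forall x, continuous k x).
{ intros x. apply (continuous_comp (fun x => 1 * x + - a) r2); [|apply Cr2].
  apply (ex_derive_continuous (fun x => 1 * x + - a)). auto_derive; easy. }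
assert (I1 : is_RInt k 0 1 1).
{ replace 1 with (minus (r1 (1 * 1 + - a)) (r1 (1 * 0 + - a))) at 2.
  - apply (is_RInt_derive (fun x => r1 (1 * x + - a)) k); intros; [apply Dk | apply Ck].
  - destruct (R0 (1 * 1 + - a)) as [-> _]; [lra|]. destruct (L0 (1 * 0 + - a)) as [-> _]; [lra|].
    unfold minus, plus, opp; simpl. ring. }
assert (CHk : forall x, continuous (fun x => H x * k x) x) by (intros x; apply (continuous_mult H k); auto).
assert (E : RInt (fun x => H x * k x) 0 1 - H a = RInt (fun x => (H x - H a) * k x) 0 1).
{ symmetry. apply is_RInt_unique.
  apply (is_RInt_ext (fun x => minus (H x * k x) (scal (H a) (k x)))).
  - intros x _. unfold minus, plus, opp, scal; simpl; unfold mult; simpl. ring.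
  - replace (RInt (fun x => H x * k x) 0 1 - H a) with (minus (RInt (fun x => H x * k x) 0 1) (scal (H a) 1))
      by (unfold minus, plus, opp, scal; simpl; unfold mult; simpl; ring).
    apply (is_RInt_minus (fun x => H x * k x) (fun x => scal (H a) (k x))).
    + apply (RInt_correct (fun x => H x * k x)), ex_RInt_cont, CHk.
    + now apply (is_RInt_scal k). }
change (Rabs (RInt (fun x => H x * k x) 0 1 - H a) <= eta). rewrite E.
assert (CHk2 : forall x, continuous (fun x => (H x - H a) * k x) x).
{ intros x. apply (continuous_mult (fun x => H x - H a) k); auto.
  apply (continuous_minus H (fun _ => H a)); auto. apply continuous_const. }
eapply Rle_trans; [apply abs_RInt_le; [lra | now apply ex_RInt_cont]|].
replace eta with (RInt (fun x => eta * k x) 0 1).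
2:{ apply is_RInt_unique. evar_last; [exact (is_RInt_scal k 0 1 eta 1 I1) | apply Rmult_1_r]. }
apply RInt_le; [lra| | |].
- apply ex_RInt_cont. intros x. apply (continuous_comp (fun x => (H x - H a) * k x) Rabs); [apply CHk2|].
  apply continuous_Rabs.
- apply ex_RInt_cont. intros x. apply (continuous_scal_r eta k); auto.
- intros x _. rewrite Rabs_mult, (Rabs_pos_eq (k x)) by apply Pos.
  destruct (Rle_lt_dec (Rabs (x - a)) d) as [Hx | Hx].
  + apply Rmult_le_compat_r; [apply Pos | now apply Hc].
  + assert (k x = 0) as ->; [|lra]. unfold k.
    destruct (Rle_lt_dec 0 (x - a)) as [S | S].
    * rewrite Rabs_pos_eq in Hx by lra. apply R0; lra.
    * rewrite Rabs_left in Hx by lra. apply L0; lra.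
Qed.

Lemma zero_of_all_le (x k : R) : (forall eta, 0 < eta -> Rabs x <= k * eta) -> x = 0.
Proof.
intros H. destruct (Req_dec x 0) as [E | E]; [easy|].
assert (P := Rabs_pos_lt x E).
assert (0 < Rabs k + 1) by (assert (X := Rabs_pos k); lra).
specialize (H (Rabs x / (2 * (Rabs k + 1))) ltac:(apply Rdiv_lt_0_compat; lra)).
assert (k * (Rabs x / (2 * (Rabs k + 1))) <= (Rabs k + 1) * (Rabs x / (2 * (Rabs k + 1)))).
{ apply Rmult_le_compat_r; [apply Rdiv_le_0_compat; lra | generalize (Rle_abs k); lra]. }
replace ((Rabs k + 1) * (Rabs x / (2 * (Rabs k + 1)))) with (Rabs x / 2) in H1 by (field; lra).
lra.
Qed.

Lemma continuous_delta (H : R -> R) (a eta : R) : continuous H a -> 0 < eta ->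
  exists d, 0 < d /\ forall x, Rabs (x - a) <= d -> Rabs (H x - H a) <= eta.
Proof.
intros C He. destruct (C (ball (H a) (mkposreal eta He)) (locally_ball _ _)) as [d Hd].
exists (d / 2). split; [destruct d; simpl; lra|].
intros x Hx. left. apply (Hd x). change (Rabs (x - a) < d).
destruct d; simpl in *; lra.
Qed.

Lemma continuous_zero_closure (F : R -> R) : (forall x, continuous F x) ->
  (forall x, 0 < x < 1 -> F x = 0) -> forall x, 0 <= x <= 1 -> F x = 0.
Proof.
intros C H x Hx. apply (zero_of_all_le (F x) 1). intros eta He. rewrite Rmult_1_l.
destruct (continuous_delta F x eta (C x) He) as (d & Hd & Hc).
set (h := Rmin d (1 / 2)).
assert (Hh : 0 < h <= d /\ h <= 1 / 2) by (unfold h, Rmin; destruct (Rle_dec d (1/2)); lra).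
destruct (Rle_lt_dec x (1 / 2)).
- specialize (Hc (x + h / 2)). rewrite (H (x + h / 2)) in Hc by lra.
  replace (0 - F x) with (- F x) in Hc by ring. rewrite Rabs_Ropp in Hc.
  apply Hc. rewrite Rabs_pos_eq; lra.
- specialize (Hc (x - h / 2)). rewrite (H (x - h / 2)) in Hc by lra.
  replace (0 - F x) with (- F x) in Hc by ring. rewrite Rabs_Ropp in Hc.
  apply Hc. rewrite Rabs_left; lra.
Qed.

(** Testing with [phi = l r(x - a) - r(x - b) + (1 - l) r(x - c)], where [r] is a smooth ramp
    and [b = l a + (1 - l) c], whose second derivative approaches
    [l delta_a - delta_b + (1 - l) delta_c]. *)
Lemma du_bois_reymond_2 (H : R -> R) : (forall x, continuous H x) ->
  (forall phi phi1 phi2, second_derive_test phi phi1 phi2 ->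
     RInt (fun x => H x * phi2 x) 0 1 = 0) ->
  exists al be, forall x, 0 <= x <= 1 -> H x = al + be * x.
Proof.
intros CH HT. set (a := 1 / 3). set (c := 2 / 3).
(* [l = 2 - 3 b] solves [b = l a + (1 - l) c]. It may leave [[0, 1]], but [|l|] and [|1 - l|] are at
   most 2, so the three errors sum to at most [(2 + 1 + 2) eta], below [6 eta]. *)
assert (Main : forall b, 0 < b < 1 -> (2 - 3 * b) * H a - H b + (1 - (2 - 3 * b)) * H c = 0).
{ intros b Hb. set (l := 2 - 3 * b). apply (zero_of_all_le _ 6). intros eta He.
  destruct (continuous_delta H a eta (CH a) He) as (da & Hda & Ca).
  destruct (continuous_delta H b eta (CH b) He) as (db & Hdb & Cb).
  destruct (continuous_delta H c eta (CH c) He) as (dc & Hdc & Cc).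
  assert (Hd : exists d, 0 < d /\ d <= da /\ d <= db /\ d <= dc /\ d <= b / 2 /\ d <= (1 - b) / 2 /\ d <= 1 / 6).
  { exists (Rmin da (Rmin db (Rmin dc (Rmin (b / 2) (Rmin ((1 - b) / 2) (1 / 6)))))).
    unfold Rmin. repeat destruct (Rle_dec _ _); lra. }
  destruct Hd as (d & d0 & d1 & d2 & d3 & d4 & d5 & d6).
  destruct (smooth_ramp d d0) as (r & r1 & r2 & k & Dr & dr & dr1 & Cr2 & P2 & L0 & R0).
  assert (Ia := RInt_mollifier H r1 r2 a d eta ltac:(lra) d0 ltac:(unfold a; lra) ltac:(unfold a; lra) CH dr1 Cr2 P2
    (fun x h => proj2 (L0 x h)) (fun x h => proj2 (R0 x h)) ltac:(intros; apply Ca; lra)).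
  assert (Ib := RInt_mollifier H r1 r2 b d eta ltac:(lra) d0 ltac:(lra) ltac:(lra) CH dr1 Cr2 P2
    (fun x h => proj2 (L0 x h)) (fun x h => proj2 (R0 x h)) ltac:(intros; apply Cb; lra)).
  assert (Ic := RInt_mollifier H r1 r2 c d eta ltac:(lra) d0 ltac:(unfold c; lra) ltac:(unfold c; lra) CH dr1 Cr2 P2
    (fun x h => proj2 (L0 x h)) (fun x h => proj2 (R0 x h)) ltac:(intros; apply Cc; lra)).
  assert (Csh : forall (f : R -> R) (s x : R), (forall x, continuous f x) -> continuous (fun x => f (1 * x + - s)) x).
  { intros f s x Cf. apply (continuous_comp (fun x => 1 * x + - s) f); [|apply Cf].
    apply (ex_derive_continuous (fun x => 1 * x + - s)). auto_derive; easy. }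
  assert (Comb : forall (f g h : R -> R) (x df dg dh : R), is_derive f x df -> is_derive g x dg -> is_derive h x dh ->
    is_derive (fun x => (l * f x + -1 * g x) + (1 - l) * h x) x ((l * df + -1 * dg) + (1 - l) * dh)).
  { intros f g h x df dg dh Hf Hg Hh.
    apply (is_derive_plus (fun x => l * f x + -1 * g x) (fun x => (1 - l) * h x)).
    - apply (is_derive_plus (fun x => l * f x) (fun x => -1 * g x)); now apply is_derive_scal.
    - now apply is_derive_scal. }
  assert (Aff : forall (f df : R -> R) (s : R), (forall x, is_derive f x (df x)) ->
     forall x, is_derive (fun x => f (1 * x + - s)) x (df (1 * x + - s))).
  { intros f df s Hf x. rewrite <- (Rmult_1_l (df _)). apply is_derive_affine, Hf. }
  set (cb := fun f : R -> R => fun x => (l * f (1 * x + - a) + -1 * f (1 * x + - b)) + (1 - l) * f (1 * x + - c)).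
  assert (T : second_derive_test (cb r) (cb r1) (cb r2)).
  { split; [|split; [|split; [|split]]].
    - intros x. apply (Comb (fun x => r (1 * x + - a)) (fun x => r (1 * x + - b)) (fun x => r (1 * x + - c)));
        now apply Aff.
    - intros x. apply (Comb (fun x => r1 (1 * x + - a)) (fun x => r1 (1 * x + - b)) (fun x => r1 (1 * x + - c)));
        now apply Aff.
    - intros x. apply (continuous_plus (fun x => l * r2 (1 * x + - a) + -1 * r2 (1 * x + - b)) (fun x => (1 - l) * r2 (1 * x + - c))).
      + apply (continuous_plus (fun x => l * r2 (1 * x + - a)) (fun x => -1 * r2 (1 * x + - b))).
        * apply (continuous_scal_r l (fun x => r2 (1 * x + - a))); auto.
        * apply (continuous_scal_r (-1) (fun x => r2 (1 * x + - b))); auto.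
      + apply (continuous_scal_r (1 - l) (fun x => r2 (1 * x + - c))); auto.
    - intros n x. apply differentiable_n_ex_derive_n.
      apply (differentiable_n_plus n (fun x => l * r (1 * x + - a) + -1 * r (1 * x + - b)) (fun x => (1 - l) * r (1 * x + - c))).
      + apply (differentiable_n_plus n (fun x => l * r (1 * x + - a)) (fun x => -1 * r (1 * x + - b))).
        * apply (differentiable_n_scal n l (fun x => r (1 * x + - a))), differentiable_n_affine, Dr.
        * apply (differentiable_n_scal n (-1) (fun x => r (1 * x + - b))), differentiable_n_affine, Dr.
      + apply (differentiable_n_scal n (1 - l) (fun x => r (1 * x + - c))), differentiable_n_affine, Dr.
    - exists (Rmin (a - d) (b - d)), (Rmax (c + d) (b + d)).
      unfold a, c in *. unfold Rmin, Rmax.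
      split; [destruct (Rle_dec _ _); lra|]. split; [repeat destruct (Rle_dec _ _); lra|].
      split; [destruct (Rle_dec _ _); lra|]. unfold cb. intros x [Hx | Hx].
      + destruct (L0 (1 * x + - (1 / 3))) as (-> & _); [destruct (Rle_dec _ _); lra|].
        destruct (L0 (1 * x + - b)) as (-> & _); [destruct (Rle_dec _ _); lra|].
        destruct (L0 (1 * x + - (2 / 3))) as (-> & _); [destruct (Rle_dec _ _); lra|]. ring.
      (* To the right of the support all three ramps are affine, and their combination vanishes by
         the choice of [l]. *)
      + destruct (R0 (1 * x + - (1 / 3))) as (-> & _); [destruct (Rle_dec _ _); lra|].
        destruct (R0 (1 * x + - b)) as (-> & _); [destruct (Rle_dec _ _); lra|].
        destruct (R0 (1 * x + - (2 / 3))) as (-> & _); [destruct (Rle_dec _ _); lra|]. unfold l. field. }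
  assert (Z := HT _ _ _ T).
  set (J := fun s => RInt (fun x => H x * r2 (1 * x + - s)) 0 1) in *.
  assert (IJ : forall s, is_RInt (fun x => H x * r2 (1 * x + - s)) 0 1 (J s)).
  { intros s. apply (RInt_correct (fun x => H x * r2 (1 * x + - s))), ex_RInt_cont.
    intros x. apply (continuous_mult H (fun x => r2 (1 * x + - s))); auto. }
  assert (EJ : RInt (fun x => H x * cb r2 x) 0 1 = l * J a - J b + (1 - l) * J c).
  { apply is_RInt_unique.
    apply (is_RInt_ext (fun x => plus (plus (scal l (H x * r2 (1 * x + - a))) (scal (-1) (H x * r2 (1 * x + - b))))
       (scal (1 - l) (H x * r2 (1 * x + - c))))).
    - intros x _. unfold plus, scal; simpl; unfold mult, cb; simpl. ring.
    - replace (l * J a - J b + (1 - l) * J c) with (plus (plus (scal l (J a)) (scal (-1) (J b))) (scal (1 - l) (J c)))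
        by (unfold plus, scal; simpl; unfold mult; simpl; ring).
      apply @is_RInt_plus; [apply @is_RInt_plus|]; apply @is_RInt_scal; apply IJ. }
  rewrite EJ in Z. fold (J a) in Ia. fold (J b) in Ib. fold (J c) in Ic.
  replace (l * H a - H b + (1 - l) * H c)
    with (- (l * (J a - H a)) + (J b - H b) + - ((1 - l) * (J c - H c))) by lra.
  eapply Rle_trans; [apply Rabs_triang|]. rewrite Rabs_Ropp, Rabs_mult.
  assert (Rabs (- (l * (J a - H a)) + (J b - H b)) <= Rabs l * Rabs (J a - H a) + Rabs (J b - H b)).
  { eapply Rle_trans; [apply Rabs_triang|]. rewrite Rabs_Ropp, Rabs_mult. lra. }
  assert (Rabs l <= 2) by (apply Rabs_le; unfold l; lra).
  assert (Rabs (1 - l) <= 2) by (apply Rabs_le; unfold l; lra).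
  assert (Rabs l * Rabs (J a - H a) <= 2 * eta) by (apply Rmult_le_compat; auto using Rabs_pos).
  assert (Rabs (1 - l) * Rabs (J c - H c) <= 2 * eta) by (apply Rmult_le_compat; auto using Rabs_pos).
  lra. }
exists (2 * H a - H c), (3 * (H c - H a)). intros x Hx.
assert (Z : H x - (2 * H a - H c + 3 * (H c - H a) * x) = 0); [|lra].
apply (continuous_zero_closure (fun x => H x - (2 * H a - H c + 3 * (H c - H a) * x))); [| |exact Hx].
- intros y. apply (continuous_minus H (fun x => 2 * H a - H c + 3 * (H c - H a) * x)); [apply CH|].
  apply (ex_derive_continuous (fun x => 2 * H a - H c + 3 * (H c - H a) * x)). auto_derive; easy.
- intros y Hy. specialize (Main y Hy). lra.
Qed.

Lemma test_function_ends (phi phi1 : R -> R) : (forall x, is_derive phi x (phi1 x)) ->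
  test_function phi -> phi 0 = 0 /\ phi 1 = 0 /\ phi1 0 = 0 /\ phi1 1 = 0.
Proof.
intros D (_ & a & b & Ha & Hab & Hb & Z).
assert (E : forall (x : R) (lo hi : Rbar), Rbar_lt lo x -> Rbar_lt x hi ->
  (forall y : R, Rbar_lt lo y -> Rbar_lt y hi -> phi y = 0) -> phi1 x = 0).
{ intros x lo hi Hlo Hhi H. rewrite <- (is_derive_unique phi x _ (D x)).
  rewrite <- (Derive_const 0 x). apply Derive_ext_loc.
  apply (locally_interval _ x lo hi Hlo Hhi). exact H. }
repeat split; try (apply Z; lra).
- apply (E 0 m_infty a); [exact I | exact Ha | intros y _ Hy; apply Z; left; exact Hy].
- apply (E 1 b p_infty); [exact Hb | exact I | intros y Hy _; apply Z; right; exact Hy].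
Qed.

(** The hypothesis is [U'' = h + k delta_z] in the sense of distributions. *)
Lemma weak_solution (U h : R -> R) (z k : R) : 0 < z < 1 ->
  (forall x, continuous U x) -> (forall x, continuous h x) ->
  (forall phi, test_function phi ->
     is_RInt (fun y => U y * Derive_n phi 2 y - h y * phi y) 0 1 (k * phi z)) ->
  exists u v : R -> R, (forall x, is_derive u x (v x)) /\ (forall x, is_derive v x (h x)) /\
    forall x, 0 <= x <= 1 -> U x = u x + k * Rmax (x - z) 0.
Proof.
intros Hz CU Ch HW.
set (q := RInt h 0). set (p := RInt q 0).
assert (dq : forall x, is_derive q x (h x)) by (intros; now apply is_derive_RInt_continuous).
assert (Cq : forall x, continuous q x) by (intros x; apply (ex_derive_continuous q); eexists; apply dq).
assert (dp : forall x, is_derive p x (q x)) by (intros; now apply is_derive_RInt_continuous).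
assert (Cp : forall x, continuous p x) by (intros x; apply (ex_derive_continuous p); eexists; apply dp).
set (m := fun x => Rmax (x - z) 0).
assert (Cm : forall x, continuous m x).
{ assert (Em : forall y, (y - z + Rabs (y - z)) / 2 = m y).
  { intros y. unfold m, Rmax. destruct (Rle_dec (y - z) 0); [rewrite Rabs_left1 by lra | rewrite Rabs_pos_eq by lra]; field. }
  intros x. apply (continuous_ext (fun x => (x - z + Rabs (x - z)) / 2)).
  - exact Em.
  - apply (continuous_scal_l (fun x => x - z + Rabs (x - z)) (/ 2)).
    apply (continuous_plus (fun x => x - z) (fun x => Rabs (x - z))).
    + apply (ex_derive_continuous (fun x => x - z)). auto_derive; easy.
    + apply (continuous_comp (fun x => x - z) Rabs); [|apply continuous_Rabs].
      apply (ex_derive_continuous (fun x => x - z)). auto_derive; easy. }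
(* [p'' = h], and the positive part [m] of [x - z] satisfies [m'' = delta_z]; so [H''] vanishes as a
   distribution and [H] is affine. *)
set (H := fun x => U x - p x - k * m x).
assert (CH : forall x, continuous H x).
{ intros x. apply (continuous_minus (fun x => U x - p x) (fun x => k * m x)).
  - now apply (continuous_minus U p).
  - now apply (continuous_scal_r k m). }
destruct (du_bois_reymond_2 H CH) as (al & be & E).
{ intros phi phi1 phi2 (D1 & D2 & C2 & T).
  destruct (test_function_ends phi phi1 D1 T) as (e1 & e2 & e3 & e4).
  assert (Cphi : forall x, continuous phi x) by (intros x; apply (ex_derive_continuous phi); eexists; apply D1).
  assert (Cphi1 : forall x, continuous phi1 x) by (intros x; apply (ex_derive_continuous phi1); eexists; apply D2).
  assert (ED : forall y, Derive_n phi 2 y = phi2 y).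
  { intros y. simpl. rewrite <- (is_derive_unique phi1 y _ (D2 y)). apply Derive_ext.
    intros t. apply (is_derive_unique phi t _ (D1 t)). }
  assert (I1 : is_RInt (fun y => U y * phi2 y - h y * phi y) 0 1 (k * phi z)).
  { apply (is_RInt_ext (fun y => U y * Derive_n phi 2 y - h y * phi y)); [|now apply HW].
    intros y _. now rewrite ED. }
  assert (I2 : is_RInt (fun y => p y * phi2 y - h y * phi y) 0 1 0).
  { replace 0 with (minus (p 1 * phi1 1 - q 1 * phi 1) (p 0 * phi1 0 - q 0 * phi 0)) at 2
      by (rewrite e1, e2, e3, e4; unfold minus, plus, opp; simpl; ring).
    apply (is_RInt_derive (fun y => p y * phi1 y - q y * phi y)).
    - intros y _. replace (p y * phi2 y - h y * phi y)
        with ((q y * phi1 y + p y * phi2 y) - (h y * phi y + q y * phi1 y)) by ring.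
      apply (is_derive_minus (fun y => p y * phi1 y) (fun y => q y * phi y)); now apply is_derive_Rmult.
    - intros y _. apply (continuous_minus (fun y => p y * phi2 y) (fun y => h y * phi y));
        [apply (continuous_mult p phi2) | apply (continuous_mult h phi)]; auto. }
  assert (I3 : is_RInt (fun y => m y * phi2 y) 0 1 (phi z)).
  { evar_last; [apply (is_RInt_Chasles (fun y => m y * phi2 y) 0 z 1 0 (phi z)) | apply Rplus_0_l].
    - apply (is_RInt_ext (fun _ => 0)).
      + intros y. rewrite Rmin_left, Rmax_right by lra. intros Hy. unfold m. rewrite Rmax_right by lra. ring_real.
      + evar_last; [apply (is_RInt_const 0 z 0) | apply Rmult_0_r].
    - apply (is_RInt_ext (fun y => (y - z) * phi2 y)).
      + intros y. rewrite Rmin_left, Rmax_right by lra. intros Hy. unfold m. rewrite Rmax_left by lra. ring_real.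
      + evar_last; [apply (is_RInt_derive (fun y => (y - z) * phi1 y - phi y))|];
          [| |rewrite e2, e4; unfold minus, plus, opp; simpl; ring_real].
        * intros y _. replace ((y - z) * phi2 y) with ((1 * phi1 y + (y - z) * phi2 y) - phi1 y) by ring.
          apply (is_derive_minus (fun y => (y - z) * phi1 y) phi); [|apply D1].
          apply (is_derive_Rmult (fun y => y - z) phi1); [auto_derive; [easy|ring] | apply D2].
        * intros y _. apply (continuous_mult (fun y => y - z) phi2); [|apply C2].
          apply (ex_derive_continuous (fun x => x - z)). auto_derive; easy. }
  apply is_RInt_unique.
  apply (is_RInt_ext (fun y => minus (minus (U y * phi2 y - h y * phi y) (p y * phi2 y - h y * phi y))
     (scal k (m y * phi2 y)))).
  - intros y _. unfold H, minus, plus, opp, scal; simpl; unfold mult; simpl. ring.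
  - evar_last.
    + apply (is_RInt_minus (V := R_NormedModule)); [apply (is_RInt_minus (V := R_NormedModule)); [exact I1|exact I2]|].
      apply (is_RInt_scal (V := R_NormedModule)). exact I3.
    + unfold minus, plus, opp, scal; simpl; unfold mult; simpl; ring_real. }
exists (fun x => al + be * x + p x), (fun x => be + q x). split; [|split].
- intros x. apply (is_derive_plus (fun x => al + be * x) p); [|apply dp].
  auto_derive; [easy|ring].
- intros x. replace (h x) with (0 + h x) by ring.
  apply (is_derive_plus (fun _ => be) q); [apply (is_derive_const be)|apply dq].
- intros x Hx. specialize (E x Hx). unfold H, m in E. lra.
Qed.

(** * The Green's function *)

Lemma C_eq (a b : C) : fst a = fst b -> snd a = snd b -> a = b.
Proof. destruct a, b; simpl; congruence. Qed.

Lemma sum_sqr_neq_0 (x eta : R) : eta <> 0 -> x ^ 2 + eta ^ 2 <> 0.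
Proof.
intros He. assert (P := pow2_gt_0 eta He). assert (Q := pow2_ge_0 x). lra.
Qed.

Lemma pot_continuous (m y0 eta x : R) : eta <> 0 ->
  continuous (pot_re m y0 eta) x /\ continuous (pot_im y0 eta) x.
Proof.
intros He.
assert (N0 : forall x, (x - y0) ^ 2 + eta ^ 2 <> 0) by (intros; now apply sum_sqr_neq_0).
split; [apply (ex_derive_continuous (pot_re m y0 eta)) | apply (ex_derive_continuous (pot_im y0 eta))].
- unfold pot_re. auto_derive. specialize (N0 x). simpl in N0.
  apply Rmult_integral_contrapositive_currified; [lra|].
  apply Rmult_integral_contrapositive_currified; [exact N0|]. rewrite Rmult_1_r. exact N0.
- unfold pot_im. auto_derive. specialize (N0 x). simpl in N0.
  apply Rmult_integral_contrapositive_currified; [lra|].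
  apply Rmult_integral_contrapositive_currified; [exact N0|]. rewrite Rmult_1_r. exact N0.
Qed.

Lemma pot_bounded (m y0 eta x : R) : eta <> 0 ->
  Rabs (pot_re m y0 eta x) <= m ^ 2 + / (4 * eta ^ 2) /\
  Rabs (pot_im y0 eta x) <= m ^ 2 + / (4 * eta ^ 2).
Proof.
intros He.
assert (E2 := pow2_gt_0 eta He).
set (N := (x - y0) ^ 2 + eta ^ 2).
assert (P2 := pow2_ge_0 (x - y0)).
assert (N0 : eta ^ 2 <= N) by (unfold N; lra).
assert (B : forall c, - N <= c <= N -> - / (4 * eta ^ 2) <= c / (4 * N ^ 2) <= / (4 * eta ^ 2)).
{ intros c Hc.
  assert (I1 : / (4 * N) <= / (4 * eta ^ 2)) by (apply Rinv_le_contravar; lra).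
  assert (I2 : 0 < / (4 * N ^ 2)) by (apply Rinv_0_lt_compat; assert (0 < N ^ 2) by (apply pow_lt; lra); lra).
  assert (I3 : N * / (4 * N ^ 2) = / (4 * N)) by (field; lra).
  unfold Rdiv. split.
  - assert (- N * / (4 * N ^ 2) <= c * / (4 * N ^ 2)) by (apply Rmult_le_compat_r; lra). lra.
  - assert (c * / (4 * N ^ 2) <= N * / (4 * N ^ 2)) by (apply Rmult_le_compat_r; lra). lra. }
assert (m2 := pow2_ge_0 m).
split; apply Rabs_le; unfold pot_re, pot_im; fold N.
- assert (X := B ((x - y0) ^ 2 - eta ^ 2) ltac:(unfold N; lra)). lra.
- assert (S1 := pow2_ge_0 (x - y0 + eta)). assert (S2 := pow2_ge_0 (x - y0 - eta)).
  assert (X := B (2 * (x - y0) * eta) ltac:(unfold N; split; lra)). lra.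
Qed.

(** Puts the complex weak equation into the form of two real ones, coupled through [pot_im]. *)
Lemma TG_components (beta : R) (s : bool) (m : nat) (eps y0 : R) (phi : R -> R) (y : R) (g : C) :
  beta ^ 2 = 1 / 4 -> 0 < eps ->
  fst (g * TG beta s m eps y0 phi y)%C
   = fst g * Derive_n phi 2 y
     - (pot_re (INR m) y0 (pm s eps) y * fst g - pot_im y0 (pm s eps) y * snd g) * phi y /\
  snd (g * TG beta s m eps y0 phi y)%C
   = snd g * Derive_n phi 2 y
     - (pot_im y0 (pm s eps) y * fst g + pot_re (INR m) y0 (pm s eps) y * snd g) * phi y.
Proof.
intros Hb He. unfold TG. rewrite Hb. unfold pot_re, pot_im, shift.
set (eta := pm s eps). assert (eta <> 0) by (unfold eta, pm; destruct s; lra).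
set (x := y - y0). destruct g as [g1 g2].
assert (x ^ 2 + eta ^ 2 <> 0) by now apply sum_sqr_neq_0.
generalize (Derive_n phi 2 y) (phi y) (INR m). intros d p k.
unfold Cdiv, Cminus, Cinv, Copp, RtoC, Cmult, Cplus. cbn [fst snd].
assert ((x * x - eta * eta) ^ 2 + (x * eta + eta * x) ^ 2 <> 0).
{ replace ((x * x - eta * eta) ^ 2 + (x * eta + eta * x) ^ 2) with ((x ^ 2 + eta ^ 2) ^ 2) by ring.
  now apply pow_nonzero. }
split; field; split; assumption.
Qed.

(** Composition with it turns continuity relative to [[0, 1]] into continuity on the whole line,
    which the weak theory asks for. *)
Definition clamp (x : R) : R := Rmax 0 (Rmin x 1).

Lemma clamp_unit (x : R) : unit_interval (clamp x).
Proof. unfold clamp, unit_interval, Rmax, Rmin. repeat destruct (Rle_dec _ _); lra. Qed.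

Lemma clamp_id (x : R) : 0 <= x <= 1 -> clamp x = x.
Proof. intros. unfold clamp. rewrite Rmin_left, Rmax_right; lra. Qed.

Lemma clamp_continuous (g : R -> C) :
  (forall y, 0 <= y <= 1 ->
     filterlim g (within unit_interval (locally y)) (locally (g y))) ->
  forall x, continuous (fun x => fst (g (clamp x))) x /\ continuous (fun x => snd (g (clamp x))) x.
Proof.
intros H x.
assert (L : filterlim clamp (locally x) (within unit_interval (locally (clamp x)))).
{ intros P [d Hd]. exists d. intros y Hy. apply Hd; [|apply clamp_unit].
  change (Rabs (clamp y - clamp x) < d). change (Rabs (y - x) < d) in Hy.
  eapply Rle_lt_trans; [|exact Hy].
  unfold clamp, Rmax, Rmin. repeat destruct (Rle_dec _ _); unfold Rabs; repeat destruct (Rcase_abs _); lra. }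
assert (K := filterlim_comp _ _ _ _ _ _ _ _ L (H (clamp x) (clamp_unit x))).
split; apply filterlim_locally; intros e;
  destruct (proj1 (filterlim_locally _ _) K e) as [d Hd]; exists d; intros y Hy;
  specialize (Hd y Hy); apply Hd.
Qed.

Lemma is_RInt_C_components (f : R -> C) (a b : R) (l : C) :
  is_RInt (V := C_R_NormedModule) f a b l ->
  is_RInt (fun t => fst (f t)) a b (fst l) /\ is_RInt (fun t => snd (f t)) a b (snd l).
Proof.
intros H. split; [exact (is_RInt_fct_extend_fst f a b l H) | exact (is_RInt_fct_extend_snd f a b l H)].
Qed.

Definition wronskian (a a' b b' : C) : C := (a * b' - a' * b)%C.

Definition cfun (f1 f2 : R -> R) (y : R) : C := (f1 y, f2 y).

(** One solution is given on [[a, b]] only, because the Green's function solves the homogeneous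
    equation separately on each side of [z]. *)
Lemma wronskian_const (V1 V2 u1 u2 v1 v2 w1 w2 z1 z2 : R -> R) (a b : R) :
  a <= b -> solution V1 V2 w1 w2 z1 z2 ->
  (forall t, a <= t <= b -> is_derive u1 t (v1 t) /\ is_derive u2 t (v2 t) /\
    is_derive v1 t (V1 t * u1 t - V2 t * u2 t) /\ is_derive v2 t (V2 t * u1 t + V1 t * u2 t)) ->
  forall s t, a <= s <= b -> a <= t <= b ->
  wronskian (cfun u1 u2 s) (cfun v1 v2 s) (cfun w1 w2 s) (cfun z1 z2 s)
  = wronskian (cfun u1 u2 t) (cfun v1 v2 t) (cfun w1 w2 t) (cfun z1 z2 t).
Proof.
intros Hab Hw Hu.
assert (Const : forall f, (forall t, a <= t <= b -> is_derive f t 0) ->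
   forall s t, a <= s <= b -> a <= t <= b -> f s = f t).
{ intros f Hf.
  assert (M : forall s t, a <= s <= b -> a <= t <= b -> s <= t -> f s = f t).
  { intros s t Hs Ht Hst. apply Rle_antisym.
    - apply (derive_nonneg_le f (fun _ => 0)); [lra | intros; apply Hf; lra | intros; lra].
    - apply Ropp_le_cancel. apply (derive_nonneg_le (fun t => - f t) (fun _ => - 0)); [lra | | intros; lra].
      intros r Hr. apply (is_derive_opp f). apply Hf; lra. }
  intros s t Hs Ht. destruct (Rle_lt_dec s t); [apply M | symmetry; apply M]; lra. }
intros s t Hs Ht.
apply C_eq; unfold wronskian, cfun, Cminus, Cmult, Cplus, Copp; cbn [fst snd].
- apply (Const (fun s => u1 s * z1 s - u2 s * z2 s + - (v1 s * w1 s - v2 s * w2 s))); auto.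
  intros r Hr. destruct (Hw r) as (a1 & a2 & a3 & a4). destruct (Hu r Hr) as (b1 & b2 & b3 & b4).
  auto_derive; [repeat split; eexists; eassumption|].
  rewrite (Derive_eta u1 r _ b1), (Derive_eta u2 r _ b2), (Derive_eta v1 r _ b3), (Derive_eta v2 r _ b4).
  rewrite (Derive_eta w1 r _ a1), (Derive_eta w2 r _ a2), (Derive_eta z1 r _ a3), (Derive_eta z2 r _ a4). ring.
- apply (Const (fun s => u1 s * z2 s + u2 s * z1 s + - (v1 s * w2 s + v2 s * w1 s))); auto.
  intros r Hr. destruct (Hw r) as (a1 & a2 & a3 & a4). destruct (Hu r Hr) as (b1 & b2 & b3 & b4).
  auto_derive; [repeat split; eexists; eassumption|].
  rewrite (Derive_eta u1 r _ b1), (Derive_eta u2 r _ b2), (Derive_eta v1 r _ b3), (Derive_eta v2 r _ b4).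
  rewrite (Derive_eta w1 r _ a1), (Derive_eta w2 r _ a2), (Derive_eta z1 r _ a3), (Derive_eta z2 r _ a4). ring.
Qed.

(** * Product form of the Green's function *)

Section Green.

Variables (beta : R) (s : bool) (m : nat) (eps y0 : R) (G : R -> R -> C).
Hypotheses (Hb : beta ^ 2 = 1 / 4) (Heps : 0 < eps).
Hypothesis HG : is_green beta s m eps y0 G.
Let V1 := pot_re (INR m) y0 (pm s eps).
Let V2 := pot_im y0 (pm s eps).
Variables (l1 l2 l1' l2' r1 r2 r1' r2' : R -> R).
Hypothesis Hl : solution V1 V2 l1 l2 l1' l2'.
Hypothesis Hr : solution V1 V2 r1 r2 r1' r2'.
Hypotheses (L1 : l1 0 = 0) (L2 : l2 0 = 0) (R1 : r1 1 = 0) (R2 : r2 1 = 0).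
Let W := wronskian (cfun l1 l2 y0) (cfun l1' l2' y0) (cfun r1 r2 y0) (cfun r1' r2' y0).
Hypothesis HW : W <> RtoC 0.

Lemma wronskian_everywhere (y : R) :
  wronskian (cfun l1 l2 y) (cfun l1' l2' y) (cfun r1 r2 y) (cfun r1' r2' y) = W.
Proof.
apply (wronskian_const V1 V2 l1 l2 l1' l2' r1 r2 r1' r2' (Rmin y y0) (Rmax y y0)); auto.
- apply Rle_trans with y; [apply Rmin_l | apply Rmax_l].
- split; [apply Rmin_l | apply Rmax_l].
- split; [apply Rmin_r | apply Rmax_r].
Qed.

(** Bootstrap: [V G] is treated as a given continuous right side. The Dirac mass is real, so only
    the real part of [G] has a kink, the positive part of [y - z]. *)
Lemma green_classical (z : R) : 0 < z < 1 -> exists u1 u2 v1 v2 : R -> R,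
  (forall y, is_derive u1 y (v1 y)) /\ (forall y, is_derive u2 y (v2 y)) /\
  (forall y, 0 <= y <= 1 -> G y z = (u1 y + Rmax (y - z) 0, u2 y) /\
     is_derive v1 y (V1 y * fst (G y z) - V2 y * snd (G y z)) /\
     is_derive v2 y (V2 y * fst (G y z) + V1 y * snd (G y z))).
Proof.
intros Hz. destruct (HG z Hz) as (CG & _ & _ & TGG).
assert (He : pm s eps <> 0) by (unfold pm; destruct s; lra).
assert (CV : forall x, continuous V1 x /\ continuous V2 x) by (intros; now apply pot_continuous).
assert (CC := clamp_continuous (fun t => G t z) CG).
set (U1 := fun x => fst (G (clamp x) z)) in *. set (U2 := fun x => snd (G (clamp x) z)) in *.
set (h1 := fun x => V1 x * U1 x - V2 x * U2 x). set (h2 := fun x => V2 x * U1 x + V1 x * U2 x).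
assert (CU1 : forall x, continuous U1 x) by apply CC.
assert (CU2 : forall x, continuous U2 x) by apply CC.
assert (Ch1 : forall x, continuous h1 x).
{ intros x. apply (continuous_minus (fun x => V1 x * U1 x) (fun x => V2 x * U2 x));
    [apply (continuous_mult V1 U1) | apply (continuous_mult V2 U2)]; auto; apply CV. }
assert (Ch2 : forall x, continuous h2 x).
{ intros x. apply (continuous_plus (fun x => V2 x * U1 x) (fun x => V1 x * U2 x));
    [apply (continuous_mult V2 U1) | apply (continuous_mult V1 U2)]; auto; apply CV. }
destruct (weak_solution U1 h1 z 1 Hz CU1 Ch1) as (u1 & v1 & du1 & dv1 & E1).
{ intros phi T. destruct (is_RInt_C_components _ _ _ _ (TGG phi T)) as [I _].
  change (fst (RtoC (phi z))) with (phi z) in I. rewrite Rmult_1_l. eapply is_RInt_ext; [|exact I].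
  intros y. rewrite Rmin_left, Rmax_right by lra. intros Hy. cbv beta.
  rewrite (proj1 (TG_components beta s m eps y0 phi y (G y z) Hb Heps)).
  unfold h1, U1, U2. rewrite clamp_id by lra. reflexivity. }
destruct (weak_solution U2 h2 z 0 Hz CU2 Ch2) as (u2 & v2 & du2 & dv2 & E2).
{ intros phi T. destruct (is_RInt_C_components _ _ _ _ (TGG phi T)) as [_ I].
  change (snd (RtoC (phi z))) with 0 in I. rewrite Rmult_0_l. eapply is_RInt_ext; [|exact I].
  intros y. rewrite Rmin_left, Rmax_right by lra. intros Hy. cbv beta.
  rewrite (proj2 (TG_components beta s m eps y0 phi y (G y z) Hb Heps)).
  unfold h2, U1, U2. rewrite clamp_id by lra. reflexivity. }
exists u1, u2, v1, v2. split; [exact du1|]. split; [exact du2|]. intros y Hy.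
specialize (E1 y Hy). specialize (E2 y Hy). specialize (dv1 y). specialize (dv2 y).
unfold h1, h2, U1, U2 in *. rewrite clamp_id in * by lra.
split; [|split; assumption].
apply C_eq; simpl; lra.
Qed.

(** The identity [G W = l W(G, r) - r W(G, l)] needs no division by a solution. Left of [z] the
    Dirichlet condition at 0 gives [W(G, l) = 0], and [W(G, r)] is constant; its value [r z] comes
    from the jump at [z] and from [W(G, r) = 0] on the right. The other side is symmetric. *)
Lemma green_formula (y z : R) : 0 <= y <= 1 -> 0 < z < 1 ->
  (y <= z -> G y z = (cfun l1 l2 y * cfun r1 r2 z / W)%C) /\
  (z <= y -> G y z = (cfun r1 r2 y * cfun l1 l2 z / W)%C).
Proof.
intros Hy Hz.
destruct (green_classical z Hz) as (u1 & u2 & v1 & v2 & du1 & du2 & E).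
destruct (HG z Hz) as (_ & G0 & G1 & _).
assert (Left : forall t, 0 <= t <= z -> is_derive u1 t (v1 t) /\ is_derive u2 t (v2 t) /\
    is_derive v1 t (V1 t * u1 t - V2 t * u2 t) /\ is_derive v2 t (V2 t * u1 t + V1 t * u2 t)).
{ intros t Ht. destruct (E t ltac:(lra)) as (Eg & d1 & d2).
  rewrite Eg, Rmax_right in d1, d2 by lra. simpl in d1, d2. rewrite Rplus_0_r in d1, d2. auto. }
set (w1 := fun t => u1 t + (t - z)). set (x1 := fun t => v1 t + 1).
assert (Right : forall t, z <= t <= 1 -> is_derive w1 t (x1 t) /\ is_derive u2 t (v2 t) /\
    is_derive x1 t (V1 t * w1 t - V2 t * u2 t) /\ is_derive v2 t (V2 t * w1 t + V1 t * u2 t)).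
{ intros t Ht. destruct (E t ltac:(lra)) as (Eg & d1 & d2).
  rewrite Eg, Rmax_left in d1, d2 by lra. simpl in d1, d2. split; [|split; [|split]]; auto.
  - apply (is_derive_plus u1 (fun t => t - z)); [apply du1 | auto_derive; [easy|ring]].
  - unfold w1. rewrite <- (Rplus_0_r (_ - _)).
    apply (is_derive_plus v1 (fun _ => 1)); [exact d1 | apply (is_derive_const 1)]. }
assert (EL : forall t, 0 <= t <= z -> G t z = cfun u1 u2 t).
{ intros t Ht. destruct (E t ltac:(lra)) as (-> & _). rewrite Rmax_right by lra.
  unfold cfun. now rewrite Rplus_0_r. }
assert (ER : forall t, z <= t <= 1 -> G t z = cfun w1 u2 t).
{ intros t Ht. destruct (E t ltac:(lra)) as (-> & _). rewrite Rmax_left by lra. reflexivity. }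
assert (EW := wronskian_everywhere y).
assert (KLl := wronskian_const V1 V2 u1 u2 v1 v2 l1 l2 l1' l2' 0 z ltac:(lra) Hl Left).
assert (KLr := wronskian_const V1 V2 u1 u2 v1 v2 r1 r2 r1' r2' 0 z ltac:(lra) Hr Left).
assert (KRl := wronskian_const V1 V2 w1 u2 x1 v2 l1 l2 l1' l2' z 1 ltac:(lra) Hl Right).
assert (KRr := wronskian_const V1 V2 w1 u2 x1 v2 r1 r2 r1' r2' z 1 ltac:(lra) Hr Right).
assert (ZL : cfun l1 l2 0 = RtoC 0) by (unfold cfun; now rewrite L1, L2).
assert (ZR : cfun r1 r2 1 = RtoC 0) by (unfold cfun; now rewrite R1, R2).
assert (J0 : cfun w1 u2 z = cfun u1 u2 z) by (unfold cfun, w1; f_equal; ring).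
(* The unit jump of the slope at [z], while the values agree. *)
assert (J1 : cfun x1 v2 z = (cfun v1 v2 z + 1)%C)
  by (apply C_eq; unfold cfun, x1, Cplus, RtoC; simpl; ring).
assert (A0 : forall t, 0 <= t <= z ->
   wronskian (cfun u1 u2 t) (cfun v1 v2 t) (cfun l1 l2 t) (cfun l1' l2' t) = RtoC 0).
{ intros t Ht. rewrite (KLl t 0) by lra. rewrite <- (EL 0), G0, ZL by lra. unfold wronskian. ring. }
assert (A1 : forall t, z <= t <= 1 ->
   wronskian (cfun w1 u2 t) (cfun x1 v2 t) (cfun r1 r2 t) (cfun r1' r2' t) = RtoC 0).
{ intros t Ht. rewrite (KRr t 1) by lra. rewrite <- (ER 1), G1, ZR by lra. unfold wronskian. ring. }
split; intros Hyz.
- assert (B : wronskian (cfun u1 u2 y) (cfun v1 v2 y) (cfun r1 r2 y) (cfun r1' r2' y) = cfun r1 r2 z).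
  { rewrite (KLr y z) by lra. assert (X := A1 z ltac:(lra)). rewrite J0, J1 in X.
    unfold wronskian in *.
    transitivity (cfun r1 r2 z + RtoC 0)%C; [rewrite <- X|]; ring. }
  rewrite EL by lra. rewrite <- B.
  assert (A := A0 y ltac:(lra)).
  assert (X : (cfun u1 u2 y * W = cfun l1 l2 y *
     wronskian (cfun u1 u2 y) (cfun v1 v2 y) (cfun r1 r2 y) (cfun r1' r2' y))%C).
  { transitivity (cfun l1 l2 y * wronskian (cfun u1 u2 y) (cfun v1 v2 y) (cfun r1 r2 y) (cfun r1' r2' y)
      - cfun r1 r2 y * wronskian (cfun u1 u2 y) (cfun v1 v2 y) (cfun l1 l2 y) (cfun l1' l2' y))%C.
    - rewrite <- EW. unfold wronskian. ring.
    - rewrite A. ring. }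
  rewrite <- X. field. exact HW.
- assert (B : wronskian (cfun w1 u2 y) (cfun x1 v2 y) (cfun l1 l2 y) (cfun l1' l2' y)
      = (- cfun l1 l2 z)%C).
  { rewrite (KRl y z) by lra. assert (X := A0 z ltac:(lra)). rewrite J0, J1.
    unfold wronskian in *.
    transitivity (RtoC 0 - cfun l1 l2 z)%C; [rewrite <- X|]; ring. }
  rewrite ER by lra.
  replace (cfun l1 l2 z) with (- wronskian (cfun w1 u2 y) (cfun x1 v2 y) (cfun l1 l2 y) (cfun l1' l2' y))%C
    by (rewrite B; ring).
  assert (A := A1 y ltac:(lra)).
  assert (X : (cfun w1 u2 y * W = cfun r1 r2 y *
     - wronskian (cfun w1 u2 y) (cfun x1 v2 y) (cfun l1 l2 y) (cfun l1' l2' y))%C).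
  { transitivity (cfun l1 l2 y * wronskian (cfun w1 u2 y) (cfun x1 v2 y) (cfun r1 r2 y) (cfun r1' r2' y)
      - cfun r1 r2 y * wronskian (cfun w1 u2 y) (cfun x1 v2 y) (cfun l1 l2 y) (cfun l1' l2' y))%C.
    - rewrite <- EW. unfold wronskian. ring.
    - rewrite A. ring. }
  rewrite <- X. field. exact HW.
Qed.

End Green.

(** * Derivative in [y], norms in [z], and the estimate *)

Lemma is_derive_unit_components (f1 f2 : R -> R) (y d1 d2 : R) :
  is_derive f1 y d1 -> is_derive f2 y d2 -> is_derive_unit (cfun f1 f2) y (d1, d2).
Proof.
intros H1%is_derive_Reals H2%is_derive_Reals.
apply filterlim_locally. intros e.
destruct (H1 e (cond_pos e)) as [a1 Ha1]. destruct (H2 e (cond_pos e)) as [a2 Ha2].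
assert (Ha : 0 < Rmin a1 a2) by (apply Rmin_pos; apply cond_pos).
exists (mkposreal _ Ha). intros t Ht Hty _.
change (Rabs (t - y) < Rmin a1 a2) in Ht.
assert (N : t - y <> 0) by lra.
specialize (Ha1 (t - y) N ltac:(eapply Rlt_le_trans; [exact Ht | apply Rmin_l])).
specialize (Ha2 (t - y) N ltac:(eapply Rlt_le_trans; [exact Ht | apply Rmin_r])).
assert (Ey : forall t : R, y + (t - y) = t) by (intros; ring).
rewrite Ey in Ha1, Ha2.
replace ((cfun f1 f2 t - cfun f1 f2 y) / RtoC (t - y))%C
  with (((f1 t - f1 y) / (t - y), (f2 t - f2 y) / (t - y)) : C).
- split; assumption.
- apply C_eq; unfold cfun, Cdiv, Cminus, Cinv, Copp, RtoC, Cmult, Cplus; cbn [fst snd]; field; exact N.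
Qed.

Lemma is_derive_unit_scal (f1 f2 f1' f2' : R -> R) (c : C) (y : R) :
  is_derive f1 y (f1' y) -> is_derive f2 y (f2' y) ->
  is_derive_unit (fun t => cfun f1 f2 t * c)%C y (cfun f1' f2' y * c)%C.
Proof.
intros H1 H2. destruct c as [c1 c2].
apply (is_derive_unit_components (fun t => f1 t * c1 - f2 t * c2) (fun t => f1 t * c2 + f2 t * c1)).
- evar_last.
  + apply (is_derive_minus (fun t => f1 t * c1) (fun t => f2 t * c2)); apply is_derive_Rmult;
      [exact H1 | apply (is_derive_const c1) | exact H2 | apply (is_derive_const c2)].
  + unfold cfun, minus, plus, opp, zero; simpl. ring_real.
- evar_last.
  + apply (is_derive_plus (fun t => f1 t * c2) (fun t => f2 t * c1)); apply is_derive_Rmult;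
      [exact H1 | apply (is_derive_const c2) | exact H2 | apply (is_derive_const c1)].
  + unfold cfun, plus, zero; simpl. ring_real.
Qed.

Lemma is_derive_unit_ext_loc (f g : R -> C) (y : R) (l : C) :
  unit_interval y -> locally y (fun t => unit_interval t -> f t = g t) ->
  is_derive_unit f y l -> is_derive_unit g y l.
Proof.
intros Hy E. apply filterlim_ext_loc.
assert (Ey : f y = g y) by exact (locally_singleton y _ E Hy).
destruct E as [d Hd]. exists d. intros t Ht _ Hu. now rewrite Ey, (Hd t Ht Hu).
Qed.

Lemma Cmod_cfun_sqr (f1 f2 : R -> R) (t : R) : Cmod (cfun f1 f2 t) ^ 2 = f1 t ^ 2 + f2 t ^ 2.
Proof. unfold Cmod, cfun. cbn [fst snd]. apply pow2_sqrt. nra. Qed.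

Lemma Cmod_mult_div_sqr (a b c : C) : c <> RtoC 0 ->
  Cmod (a * b / c) ^ 2 = Cmod a ^ 2 / Cmod c ^ 2 * Cmod b ^ 2.
Proof.
intros Hc. rewrite Cmod_div, Cmod_mult by exact Hc.
assert (P := proj1 (Cmod_gt_0 c) Hc). field. lra.
Qed.

(** The values of [h] at 0, [y] and 1 are left free: the Green's function is not prescribed at the
    ends in [z], and its derivative jumps at [z = y]. *)
Lemma is_RInt_glued (h : R -> R) (Fl Fu fl fu : R -> R) (kl ku y : R) :
  0 <= y <= 1 ->
  (forall t, is_derive Fl t (fl t)) -> (forall t, is_derive Fu t (fu t)) ->
  (forall t, continuous fl t) -> (forall t, continuous fu t) ->
  (forall z, 0 < z < y -> h z = kl * fl z) -> (forall z, y < z < 1 -> h z = ku * fu z) ->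
  is_RInt h 0 1 (kl * (Fl y - Fl 0) + ku * (Fu 1 - Fu y)).
Proof.
intros Hy dl du cl cu El Eu.
apply (is_RInt_Chasles h 0 y 1 (kl * (Fl y - Fl 0)) (ku * (Fu 1 - Fu y))).
- apply (is_RInt_ext (fun z => scal kl (fl z))).
  + intros z. rewrite Rmin_left, Rmax_right by lra. intros Hz. symmetry. now apply El.
  + apply (is_RInt_scal fl). apply (is_RInt_derive Fl fl); auto.
- apply (is_RInt_ext (fun z => scal ku (fu z))).
  + intros z. rewrite Rmin_left, Rmax_right by lra. intros Hz. symmetry. now apply Eu.
  + apply (is_RInt_scal fu). apply (is_RInt_derive Fu fu); auto.
Qed.

Lemma sqrt_le_scaled (I c k m L : R) : 0 < m -> 0 <= L -> 0 <= k -> 0 <= c ->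
  c * (m ^ 2 * I) <= k ^ 2 * L ^ 2 -> sqrt c * sqrt I <= k / m * L.
Proof.
intros Hm HL Hk Hc H. rewrite <- sqrt_mult_alt by exact Hc.
assert (P : 0 <= k / m * L) by (apply Rmult_le_pos; [apply Rdiv_le_0_compat; lra | lra]).
rewrite <- (sqrt_pow2 (k / m * L)) by exact P.
apply sqrt_le_1_alt. apply Rmult_le_reg_r with (m ^ 2); [nra|].
replace ((k / m * L) ^ 2 * m ^ 2) with (k ^ 2 * L ^ 2) by (field; lra). lra.
Qed.

(** Each squared norm splits at [z = y] into two products of a squared value at [y] and a mass,
    divided by [|W|^2]; [solutions_estimate] bounds all four products. Only [eps0] depends on
    [m]. *)
Theorem theorem5 (beta : R) (s : bool) (hbeta2 : beta ^ 2 = 1 / 4) (hbeta : 0 < beta) :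
  exists K : R, 0 < K /\
  forall m : nat, (1 <= m)%nat ->
  exists eps0 : R, 0 < eps0 /\
  forall (eps y0 y : R) (G : R -> R -> C),
    0 < eps < eps0 -> 0 <= y0 <= 1 -> 0 <= y <= 1 ->
    INR m * Rabs (y - y0) <= 3 * beta ->
    is_green beta s m eps y0 G ->
    exists dG : R -> C,
      (forall z : R, 0 < z < 1 -> z <> y ->
         is_derive_unit (fun t => G t z) y (dG z)) /\
      square_integrable (G y) /\
      square_integrable dG /\
      Rpower (Cmod (shift s eps y0 y)) (- (1 / 2)) * L2norm (G y)
      + Rpower (Cmod (shift s eps y0 y)) (1 / 2) * L2norm dG
      <= K / INR m * (1 + Rabs (ln (INR m * Cmod (shift s eps y0 y)))).
Proof.
(* Each norm collects two products bounded with [3 * 10 ^ 15], and [6 * 10 ^ 15] is below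
   [(10 ^ 8) ^ 2]; the factor 2 counts the norms. *)
exists (2 * 10 ^ 8). split; [lra|]. intros m Hm.
set (M := INR m).
assert (M1 : 1 <= M) by (apply (le_INR 1 m) in Hm; exact Hm).
exists (/ (2 * M)). split; [apply Rinv_0_lt_compat; lra|].
intros eps y0 y G [He He0] Hy0 Hy Hyy HG.
(* The range [m |y - y0| <= 3 beta] thus becomes [|t| <= 3/2]. *)
assert (Hb : beta = 1 / 2) by nra.
assert (Hme : M * eps <= 1 / 2).
{ apply (Rmult_lt_compat_l M) in He0; [|lra].
  replace (M * / (2 * M)) with (1 / 2) in He0 by (field; lra). lra. }
set (sg := if s then 1 else -1).
assert (Hsg : sg ^ 2 = 1) by (unfold sg; destruct s; ring).
assert (Hpm : pm s eps = sg * eps) by (unfold sg, pm; destruct s; ring).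
assert (Hr : Cmod (shift s eps y0 y) = dist y0 eps y).
{ unfold Cmod, shift, dist. cbn [fst snd]. f_equal. rewrite Hpm, Rpow_mult_distr, Hsg. ring. }
rewrite Hr. set (r := dist y0 eps y). assert (r0 : 0 < r) by (apply sqrt_lt_R0, sqr_add_pos, He).
assert (Hne : pm s eps <> 0) by (unfold pm; destruct s; lra).
destruct (linear_ode _ _ (M ^ 2 + / (4 * pm s eps ^ 2)) 0
  (fun x => proj1 (pot_continuous M y0 (pm s eps) x Hne)) (fun x => proj2 (pot_continuous M y0 (pm s eps) x Hne))
  (fun x => proj1 (pot_bounded M y0 (pm s eps) x Hne)) (fun x => proj2 (pot_bounded M y0 (pm s eps) x Hne)))
  as (l1 & l2 & l1' & l2' & Hl & L1 & L2 & L3 & L4).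
destruct (linear_ode _ _ (M ^ 2 + / (4 * pm s eps ^ 2)) 1
  (fun x => proj1 (pot_continuous M y0 (pm s eps) x Hne)) (fun x => proj2 (pot_continuous M y0 (pm s eps) x Hne))
  (fun x => proj1 (pot_bounded M y0 (pm s eps) x Hne)) (fun x => proj2 (pot_bounded M y0 (pm s eps) x Hne)))
  as (r1 & r2 & r1' & r2' & Hrr & R1 & R2 & R3 & R4).
set (W := wronskian (cfun l1 l2 y0) (cfun l1' l2' y0) (cfun r1 r2 y0) (cfun r1' r2' y0)).
assert (Hl' := Hl). assert (Hrr' := Hrr). rewrite Hpm in Hl', Hrr'.
(* The estimates involve the Wronskian at the current point, the Green's function the one at [y0];
   they agree. *)
assert (ED : forall t, wr_re l1 l2 l1' l2' r1 r2 r1' r2' t ^ 2 + wr_im l1 l2 l1' l2' r1 r2 r1' r2' t ^ 2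
   = Cmod W ^ 2).
{ intros t. unfold W.
  rewrite <- (wronskian_everywhere s m eps y0 l1 l2 l1' l2' r1 r2 r1' r2' Hl Hrr t).
  rewrite <- (Cmod_cfun_sqr (wr_re l1 l2 l1' l2' r1 r2 r1' r2') (wr_im l1 l2 l1' l2' r1 r2 r1' r2') t).
  apply (f_equal (fun c => Cmod c ^ 2)). apply C_eq; unfold wronskian, cfun, Cminus, Cmult, Cplus, Copp; cbn [fst snd];
    unfold wr_re, wr_im; ring. }
assert (WP := wronskian_pos M y0 eps sg l1 l2 l1' l2' r1 r2 r1' r2' M1 He Hme Hsg Hy0 Hl' Hrr'
  L1 L2 L3 L4 R1 R2 R3 R4).
cbv beta zeta in WP. rewrite ED in WP.
assert (HW : W <> RtoC 0) by (intros E; rewrite E, Cmod_0 in WP; lra).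
assert (GF := green_formula beta s m eps y0 G hbeta2 He HG l1 l2 l1' l2' r1 r2 r1' r2' Hl Hrr
  L1 L2 R1 R2 HW).
fold W in GF.
set (fl := fun t => l1 t ^ 2 + l2 t ^ 2). set (fu := fun t => r1 t ^ 2 + r2 t ^ 2).
assert (csq : forall f1 f2 f1' f2' : R -> R, (forall t, is_derive f1 t (f1' t)) ->
   (forall t, is_derive f2 t (f2' t)) -> forall t, continuous (fun t => f1 t ^ 2 + f2 t ^ 2) t).
{ intros f1 f2 f1' f2' H1 H2 t. apply (ex_derive_continuous (fun t => f1 t ^ 2 + f2 t ^ 2)).
  auto_derive. split; [|split; [|easy]]; eexists; [apply H1 | apply H2]. }
assert (cfl : forall t, continuous fl t) by (apply (csq l1 l2 l1' l2'); intros; apply Hl).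
assert (cfu : forall t, continuous fu t) by (apply (csq r1 r2 r1' r2'); intros; apply Hrr).
set (Fl := RInt fl 0). set (Fu := RInt fu 0).
assert (dFl : forall t, is_derive Fl t (fl t)) by (intros; now apply is_derive_RInt_continuous).
assert (dFu : forall t, is_derive Fu t (fu t)) by (intros; now apply is_derive_RInt_continuous).
(* The value at the jump [z = y] is an arbitrary choice. *)
set (dG := fun z => if Rlt_dec z y then (cfun r1' r2' y * cfun l1 l2 z / W)%C
                    else (cfun l1' l2' y * cfun r1 r2 z / W)%C).
assert (IG := is_RInt_glued (fun z => Cmod (G y z) ^ 2) Fl Fu fl fu
  (Cmod (cfun r1 r2 y) ^ 2 / Cmod W ^ 2) (Cmod (cfun l1 l2 y) ^ 2 / Cmod W ^ 2) y Hy dFl dFu cfl cfu).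
specialize (IG
  ltac:(intros z Hz; cbv beta; rewrite (proj2 (GF y z Hy ltac:(lra))) by lra;
        rewrite Cmod_mult_div_sqr, (Cmod_cfun_sqr l1 l2 z) by exact HW; reflexivity)
  ltac:(intros z Hz; cbv beta; rewrite (proj1 (GF y z Hy ltac:(lra))) by lra;
        rewrite Cmod_mult_div_sqr, (Cmod_cfun_sqr r1 r2 z) by exact HW; reflexivity)).
assert (ID := is_RInt_glued (fun z => Cmod (dG z) ^ 2) Fl Fu fl fu
  (Cmod (cfun r1' r2' y) ^ 2 / Cmod W ^ 2) (Cmod (cfun l1' l2' y) ^ 2 / Cmod W ^ 2) y Hy dFl dFu cfl cfu).
specialize (ID
  ltac:(intros z Hz; cbv beta; unfold dG; destruct (Rlt_dec z y); [|lra];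
        rewrite Cmod_mult_div_sqr, (Cmod_cfun_sqr l1 l2 z) by exact HW; reflexivity)
  ltac:(intros z Hz; cbv beta; unfold dG; destruct (Rlt_dec z y); [lra|];
        rewrite Cmod_mult_div_sqr, (Cmod_cfun_sqr r1 r2 z) by exact HW; reflexivity)).
rewrite !Cmod_cfun_sqr in IG, ID.
exists dG. split; [|split; [|split]].
- intros z Hz Hzy. unfold dG. destruct (Rlt_dec z y) as [Hlt | Hlt].
  + apply (is_derive_unit_ext_loc (fun t => cfun r1 r2 t * (cfun l1 l2 z / W))%C); [exact Hy| |].
    * apply (locally_interval _ y z p_infty); [exact Hlt | exact I|]. intros t Ht _ Hu.
      simpl in Ht. rewrite (proj2 (GF t z Hu Hz)) by lra. unfold Cdiv. ring.
    * replace (cfun r1' r2' y * cfun l1 l2 z / W)%C with (cfun r1' r2' y * (cfun l1 l2 z / W))%C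
        by (unfold Cdiv; ring).
      apply is_derive_unit_scal; apply Hrr.
  + apply (is_derive_unit_ext_loc (fun t => cfun l1 l2 t * (cfun r1 r2 z / W))%C); [exact Hy| |].
    * apply (locally_interval _ y m_infty z); [exact I | simpl; lra|]. intros t _ Ht Hu.
      simpl in Ht. rewrite (proj1 (GF t z Hu Hz)) by lra. unfold Cdiv. ring.
    * replace (cfun l1' l2' y * cfun r1 r2 z / W)%C with (cfun l1' l2' y * (cfun r1 r2 z / W))%C
        by (unfold Cdiv; ring).
      apply is_derive_unit_scal; apply Hl.
- eexists; exact IG.
- eexists; exact ID.
- unfold L2norm. rewrite (is_RInt_unique _ _ _ _ IG), (is_RInt_unique _ _ _ _ ID).
  destruct (solutions_estimate M y0 eps sg l1 l2 l1' l2' r1 r2 r1' r2' M1 He Hme Hsg Hy0 Hl' Hrr'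
    L1 L2 R1 R2 y Fl Fu Hy ltac:(lra) dFl dFu) as [Sl Su].
  cbv beta zeta in Sl, Su. rewrite ED in Sl, Su. fold r in Sl, Su.
  set (L := 1 + Rabs (ln (M * r))) in *.
  assert (L0 : 1 <= L) by (unfold L; assert (X := Rabs_pos (ln (M * r))); lra).
  replace (Rpower r (- (1 / 2))) with (sqrt (/ r)).
  2:{ rewrite Rpower_Ropp. replace (1 / 2) with (/ 2) by field. rewrite Rpower_sqrt by lra.
      apply sqrt_inv. }
  replace (Rpower r (1 / 2)) with (sqrt r)
    by (replace (1 / 2) with (/ 2) by field; now rewrite Rpower_sqrt by lra).
  set (c := Cmod W ^ 2) in *.
  set (il := Fl y - Fl 0) in *. set (iu := Fu 1 - Fu y) in *.
  assert (K : forall a b d1 d2, M ^ 2 * a * iu <= 3 * 10 ^ 15 * L ^ 2 * c ->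
    M ^ 2 * b * il <= 3 * 10 ^ 15 * L ^ 2 * c -> d1 = b / c -> d2 = a / c ->
    M ^ 2 * (d1 * il + d2 * iu) <= (10 ^ 8) ^ 2 * L ^ 2).
  { intros a b d1 d2 H1 H2 -> ->. apply Rmult_le_reg_r with c; [exact WP|].
    replace (M ^ 2 * (b / c * il + a / c * iu) * c) with (M ^ 2 * b * il + M ^ 2 * a * iu) by (field; lra).
    assert (0 <= L ^ 2 * c) by (apply Rmult_le_pos; nra). lra. }
  assert (mono : forall F f1 f2, (forall t, is_derive F t (f1 t ^ 2 + f2 t ^ 2)) ->
     forall a b, a <= b -> 0 <= F b - F a).
  { intros F f1 f2 HF a b Hab. assert (F a <= F b); [|lra].
    apply (derive_nonneg_le F (fun t => f1 t ^ 2 + f2 t ^ 2)); auto.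
    intros; nra. }
  assert (pl : 0 <= il) by (apply (mono Fl l1 l2 dFl); lra).
  assert (pu : 0 <= iu) by (apply (mono Fu r1 r2 dFu); lra).
  assert (sq : forall a b : R, 0 <= a ^ 2 + b ^ 2) by (intros; nra).
  assert (split_le : forall a b i : R, 0 <= a -> 0 <= b -> 0 <= i ->
     M ^ 2 * (a + b) * i <= 3 * 10 ^ 15 * L ^ 2 * c ->
     M ^ 2 * a * i <= 3 * 10 ^ 15 * L ^ 2 * c /\ M ^ 2 * b * i <= 3 * 10 ^ 15 * L ^ 2 * c).
  { intros a b i Ha Hb' Hi H.
    assert (0 <= M ^ 2 * a * i) by (repeat apply Rmult_le_pos; nra).
    assert (0 <= M ^ 2 * b * i) by (repeat apply Rmult_le_pos; nra). lra. }
  destruct (split_le _ _ iu (Rdiv_le_0_compat _ _ (sq (l1 y) (l2 y)) r0)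
    (Rmult_le_pos _ _ (Rlt_le _ _ r0) (sq (l1' y) (l2' y))) pu Sl) as [S1 S2].
  destruct (split_le _ _ il (Rdiv_le_0_compat _ _ (sq (r1 y) (r2 y)) r0)
    (Rmult_le_pos _ _ (Rlt_le _ _ r0) (sq (r1' y) (r2' y))) pl Su) as [S3 S4].
  assert (ir0 : 0 < / r) by now apply Rinv_0_lt_compat.
  assert (E1 : sqrt (/ r) * sqrt ((r1 y ^ 2 + r2 y ^ 2) / c * il + (l1 y ^ 2 + l2 y ^ 2) / c * iu)
     <= 10 ^ 8 / M * L).
  { apply sqrt_le_scaled; try lra.
    eapply Rle_trans; [|apply (K _ _ _ _ S1 S3 eq_refl eq_refl)]. right. field. lra. }
  assert (E2 : sqrt r * sqrt ((r1' y ^ 2 + r2' y ^ 2) / c * il + (l1' y ^ 2 + l2' y ^ 2) / c * iu)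
     <= 10 ^ 8 / M * L).
  { apply sqrt_le_scaled; try lra.
    eapply Rle_trans; [|apply (K _ _ _ _ S2 S4 eq_refl eq_refl)]. right. field. lra. }
  replace (2 * 10 ^ 8 / M * L) with (10 ^ 8 / M * L + 10 ^ 8 / M * L) by (field; lra).
  now apply Rplus_le_compat.
Qed.
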